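(* Let $u\in\mathbb{K}$ be the solution of Problem $\mathcal{P}$ (the parabolic obstacle problem in the context), and let $\alpha\geqslant\tfrac12$. For any $v\in\mathbb{K}$ and any vector-valued function $\tau\in H_{\operatorname{div}}(Q_T)$, with $e:=v-u$, it holds $$ \|e(\cdot,T)\|^2_{\Omega}+\left(2-\frac1\alpha\right)\|\nabla e\|^2_{Q_T}\;\leqslant\; \|e(\cdot,0)\|^2_{\Omega}+\alpha\Bigl(\|\tau-\nabla v\|_{Q_T}+C_F\,\|\mathcal{F}_f(v,\tau)\|_{Q_T}\Bigr)^2, $$ where $$ \mathcal{F}_f(v,\tau):=\begin{cases}\mathcal{R}_f(v,\tau), & \text{if } (x,t)\in Q_T^+(v),\\ \{\mathcal{R}_f(v,\tau)\}_{\oplus}, & \text{if } (x,t)\in Q_T^\phi(v),\end{cases}\qquad \mathcal{R}_f(v,\tau):=f+\operatorname{div}\tau-v_t . $$ The right-hand side of this inequality vanishes if and only if $v=u$ and $\tau=\nabla u$.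
   Context: $\Omega\subset\mathbb{R}^n$ is open, connected and bounded with Lipschitz continuous boundary $\partial\Omega$, and $Q_T=\Omega\times(0,T)$. The obstacle $\phi=\phi(x)$ is time-independent and satisfies $\phi\in H^2(\Omega)$ and $\phi\leqslant0$ a.e. on $\partial\Omega$. The data satisfy $f\in L^2(Q_T)$, $u_0\in H^1_0(\Omega)$ and $u_0\geqslant\phi$ a.e. on $\Omega$. Subscript $t$ denotes the partial derivative in time; $\nabla$ and $\operatorname{div}$ are taken with respect to $x$ only. $\|\cdot\|_\Omega$ and $\|\cdot\|_{Q_T}$ denote the $L^2(\Omega)$ and $L^2(Q_T)$ norms (of scalar or vector functions). Admissible class: $$\mathbb{K}=\{w\in L^2((0,T),H^1_0(\Omega)):\ w_t\in L^2((0,T),H^{-1}(\Omega)),\ w\geqslant\phi(x) \text{ a.e. on } Q_T\}.$$ By a standard interpolation argument, elements of $\mathbb{K}$ are continuous in time with values in $L^2(\Omega)$. Problem $\mathcal{P}$: find $u\in\mathbb{K}$ such that for almost all $t$ and all $w\in\mathbb{K}$ $$\int_{Q_T}u_t(w-u)\,dx\,dt+\int_{Q_T}\nabla u\cdot\nabla(w-u)\,dx\,dt\geqslant\int_{Q_T}f(w-u)\,dx\,dt,\qquad u(x,0)=u_0(x)\ \ \forall x\in\Omega.$$ It is known that under these assumptions the problem is uniquely solvable. For $v\in\mathbb{K}$: $Q_T^+(v)=\{(x,t)\in Q_T: v(x,t)>\phi\}$ and $Q_T^\phi(v)=\{(x,t)\in Q_T: v(x,t)=\phi\}$. $H_{\operatorname{div}}(Q_T)=\{\tau(x,t)\in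 L^2(Q_T,\mathbb{R}^n):\ \operatorname{div}\tau\in L^2(\Omega)\text{ for a.e. } t\in(0,T)\}$. $\{a\}_\oplus=\max\{0,a\}$. $C_F$ is the constant in the Friedrichs inequality $\|w\|_\Omega\leqslant C_F\|\nabla w\|_\Omega$ for all $w\in H^1_0(\Omega)$.
   Formalization: The time derivative v_t is additionally assumed to be a measurable function on Q_T lying in L²(Ω) for a.e. t; for a general v in K it is only in H^{-1}(Ω), and then the pointwise residual F_f(v,τ) and its L²(Q_T) norm are undefined. *)

(* Defs.v *)
From HB Require Import structures.
From mathcomp Require Import all_boot all_order all_algebra.
From mathcomp Require Import all_classical all_reals all_analysis.

Set Implicit Arguments.
Unset Strict Implicit.
Unset Printing Implicit Defensive.

Import Order.TTheory GRing.Theory Num.Theory.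
Import numFieldNormedType.Exports.

Local Open Scope classical_set_scope.
Local Open Scope ring_scope.

Definition rV_display : measure_display. Proof. exact. Qed.

Section rV_measurable.
Context (R : realType) (n : nat).

Let coord (i : 'I_n) (x : 'rV[R]_n) : measurableTypeR R := x ord0 i.

Let rV_set0 : g_sigma_preimage coord set0.
Proof. exact: sigma_algebra0. Qed.

Let rV_setC A : g_sigma_preimage coord A -> g_sigma_preimage coord (~` A).
Proof. exact: sigma_algebraC. Qed.

Let rV_bigcup (F : (set 'rV[R]_n)^nat) :
  (forall i, g_sigma_preimage coord (F i)) ->
  g_sigma_preimage coord (\bigcup_i (F i)).
Proof. exact: sigma_algebra_bigcup. Qed.

(* The sigma-algebra generated by the coordinates, i.e. the Borel one. *)
HB.instance Definition _ := @isMeasurable.Build rV_display 'rV[R]_n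
  (g_sigma_preimage coord) rV_set0 rV_setC rV_bigcup.

Lemma measurable_coord (i : 'I_n) :
  measurable_fun [set: 'rV[R]_n]
    ((fun x => x ord0 i) : 'rV[R]_n -> measurableTypeR R).
Proof.
move=> _ Y mY; rewrite setTI; apply: sub_sigma_algebra => /=.
rewrite -bigcup_seq/=; exists i => /=; first by rewrite mem_index_enum.
by exists Y => //; rewrite setTI.
Qed.

Lemma measurable_fun_rV d (T : measurableType d) (f : T -> 'rV[R]_n) :
  (forall i, measurable_fun [set: T]
     ((fun t => f t ord0 i) : T -> measurableTypeR R)) ->
  measurable_fun [set: T] f.
Proof.
move=> mf.
suff prefS : g_sigma_preimage (fun i => coord i \o f) `<=` measurable.
  by rewrite g_sigma_preimage_comp in prefS; move=> _ A mA;
     apply: prefS; exists A.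
apply: smallest_sub; first exact: sigma_algebra_measurable.
rewrite -bigcup_seq; apply: bigcup_sub => i Ii.
by move=> A [B mB <-]; exact: mf.
Qed.

End rV_measurable.

Lemma product_sigma_finite d1 d2 (T1 : measurableType d1)
    (T2 : measurableType d2) (R : realType)
    (m1 : {sigma_finite_measure set T1 -> \bar R})
    (m2 : {sigma_finite_measure set T2 -> \bar R}) :
  sigma_finite setT (m1 \x m2)%E.
Proof.
have /sigma_finiteP[F [TF ndF Foo]] := sigma_finiteT m1.
have /sigma_finiteP[G [TG ndG Goo]] := sigma_finiteT m2.
exists (fun n => F n `*` G n).
 rewrite -setXTT TF TG predeqE => -[x y]; split.
    move=> [/= [n _ Fnx] [k _ Gky]]; exists (maxn n k) => //; split.
    - by move: x Fnx; exact/subsetPset/ndF/leq_maxl.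
    - by move: y Gky; exact/subsetPset/ndG/leq_maxr.
  by move=> [n _ []/= ? ?]; split; exists n.
move=> k; have [? ?] := Foo k; have [? ?] := Goo k.
split; first exact: measurableX.
by rewrite product_measure1E// lte_mul_pinfty// ge0_fin_numE.
Qed.

Section leb_rec.
Context (R : realType) (n : nat).
Variable mu : {sigma_finite_measure set 'rV[R]_n -> \bar R}.

Definition rV_cons (p : measurableTypeR R * 'rV[R]_n) : 'rV[R]_n.+1 :=
  \row_j (if unlift ord0 j is Some k then p.2 ord0 k else p.1).

Definition rV_uncons (x : 'rV[R]_n.+1) : measurableTypeR R * 'rV[R]_n :=
  (x ord0 ord0, \row_k x ord0 (lift ord0 k)).

Lemma rV_consK : cancel rV_cons rV_uncons.
Proof.
case=> a x; congr (_, _); first by rewrite mxE unlift_none.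
by apply/rowP => k; rewrite !mxE liftK.
Qed.

Lemma measurable_rV_cons : measurable_fun setT rV_cons.
Proof.
apply: measurable_fun_rV => j.
case: (unliftP ord0 j) => [k|] ->.
- apply: (eq_measurable_fun
    ((fun x : 'rV[R]_n => x ord0 k : measurableTypeR R) \o snd)).
    by move=> p _; rewrite mxE liftK.
  by apply: measurableT_comp => //; exact: measurable_coord.
- apply: (eq_measurable_fun fst) => //.
  by move=> p _; rewrite mxE unlift_none.
Qed.

Lemma measurable_rV_uncons : measurable_fun setT rV_uncons.
Proof.
apply: measurable_fun_pair; first exact: measurable_coord.
apply: measurable_fun_rV => k.
apply: (eq_measurable_fun
  (fun x : 'rV[R]_n.+1 => x ord0 (lift ord0 k) : measurableTypeR R)).
  by move=> x _ /=; rewrite mxE.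
exact: measurable_coord.
Qed.

Definition leb_step : set 'rV[R]_n.+1 -> \bar R :=
  pushforward (@lebesgue_measure R \x mu)%E rV_cons.

Let leb_step0 : leb_step set0 = 0%E.
Proof. by rewrite /leb_step /pushforward preimage_set0 measure0. Qed.

Let leb_step_ge0 A : (0 <= leb_step A)%E.
Proof. exact: (measure_ge0 (@lebesgue_measure R \x mu)%E). Qed.

Let leb_step_sigma_additive : semi_sigma_additive leb_step.
Proof.
move=> F mF tF mUF; rewrite /leb_step /pushforward preimage_bigcup.
have mc := measurable_rV_cons.
apply: measure_semi_sigma_additive.
- by move=> k; rewrite -[X in measurable X]setTI; exact: mc.
- apply/trivIsetP => /= i j _ _ ij; rewrite -preimage_setI.
  by move/trivIsetP : tF => /(_ _ _ _ _ ij) ->//; rewrite preimage_set0.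
- by rewrite -preimage_bigcup -[X in measurable X]setTI; exact: mc.
Qed.

HB.instance Definition _ := isMeasure.Build _ _ _
  leb_step leb_step0 leb_step_ge0 leb_step_sigma_additive.

Let leb_step_sigma_finite : sigma_finite setT leb_step.
Proof.
have [F TF Foo] := product_sigma_finite (@lebesgue_measure R) mu.
exists (fun k => rV_uncons @^-1` F k).
  by rewrite -preimage_bigcup -TF preimage_setT.
move=> k; have [mFk Fkoo] := Foo k; split.
  by rewrite -[X in measurable X]setTI; exact: measurable_rV_uncons.
rewrite /leb_step /pushforward -comp_preimage.
by rewrite (_ : rV_uncons \o rV_cons = id) //; apply/funext => p /=; rewrite rV_consK.
Qed.

HB.instance Definition _ := Measure_isSigmaFinite.Build _ _ _
  leb_step leb_step_sigma_finite.

End leb_rec.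

Fixpoint leb (R : realType) (n : nat) :
    {sigma_finite_measure set 'rV[R]_n -> \bar R} :=
  match n with
  | 0 => \d_(0 : 'rV[R]_0)
  | k.+1 => leb_step (leb R k)
  end.

Notation spacetime R n := ('rV[R]_n * measurableTypeR R)%type.

Definition leb_st (R : realType) (n : nat) :
    {measure set (spacetime R n) -> \bar R} :=
  (leb R n \x @lebesgue_measure R)%E.

Section L2.
Context d (X : measurableType d) (R : realType).
Variables (mu : {measure set X -> \bar R}) (D : set X).

Definition L2norm (f : X -> R) : \bar R := 'N[mu]_(2%:E)[EFin \o (f \_ D)]%E.

Definition in_L2 (f : X -> R) : Prop :=
  measurable_fun D f /\ (L2norm f < +oo)%E.

End L2.

Section euclidean.
Context (R : realType) (n : nat).
Implicit Types (x y : 'rV[R]_n).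

(* The library norm of ['rV[R]_n] is the sup norm. *)
Definition dotv x y : R := \sum_(i < n) x ord0 i * y ord0 i.
Definition enorm x : R := Num.sqrt (dotv x x).

Definition in_L2v d (X : measurableType d) (mu : {measure set X -> \bar R})
    (D : set X) (G : X -> 'rV[R]_n) : Prop :=
  forall i, in_L2 mu D (fun p => G p ord0 i).

Definition L2normv d (X : measurableType d) (mu : {measure set X -> \bar R})
    (D : set X) (G : X -> 'rV[R]_n) : \bar R :=
  L2norm mu D (enorm \o G).

Definition unitv (i : 'I_n) : 'rV[R]_n := delta_mx ord0 i.

Fixpoint Ck (k : nat) (f : 'rV[R]_n -> R) : Prop :=
  match k with
  | 0 => continuous f
  | k'.+1 => continuous f /\
      forall i, (forall x, derivable f x (unitv i)) /\ Ck k' ('D_(unitv i) f)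
  end.

Definition smooth (f : 'rV[R]_n -> R) : Prop := forall k, Ck k f.

Definition nabla (f : 'rV[R]_n -> R) (x : 'rV[R]_n) : 'rV[R]_n :=
  \row_i 'D_(unitv i) f x.

End euclidean.

Definition compactly_supported_in (R : realType) (V : topologicalType)
    (U : set V) (f : V -> R) : Prop :=
  compact (closure [set x | f x != 0]) /\ closure [set x | f x != 0] `<=` U.

Definition test_fun (R : realType) (n : nat) (Om : set 'rV[R]_n)
    (psi : 'rV[R]_n -> R) : Prop :=
  smooth psi /\ compactly_supported_in Om psi.

Definition time_test_fun (R : realType) (T : R) (eta : R -> R) : Prop :=
  (forall k t, derivable (derive1n k eta) t 1) /\
  compactly_supported_in (`]0, T[%classic : set R) eta.

Section sobolev.
Context (R : realType) (n : nat).
Variable Om : set 'rV[R]_n.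
Local Notation E := 'rV[R]_n.
Local Notation mu := (leb R n).

Definition weak_gradient (w : E -> R) (G : E -> E) : Prop :=
  in_L2v mu Om G /\
  forall psi, test_fun Om psi -> forall i,
    \int[mu]_(x in Om) (w x * nabla psi x ord0 i) =
    - \int[mu]_(x in Om) (G x ord0 i * psi x).

(* Meaningful for [w] in H1 only; unique up to a null set. *)
Definition wgrad (w : E -> R) : E -> E :=
  xget (fun=> 0) [set G | weak_gradient w G].

Definition H1 (w : E -> R) : Prop :=
  in_L2 mu Om w /\ exists G, weak_gradient w G.

Definition H2 (w : E -> R) : Prop :=
  H1 w /\ forall i, H1 (fun x => wgrad w x ord0 i).

Definition H1norm (w : E -> R) : \bar R :=
  sqrte (L2norm mu Om w ^+ 2 + L2normv mu Om (wgrad w) ^+ 2)%E.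

Definition H10 (w : E -> R) : Prop :=
  H1 w /\ exists psi : nat -> E -> R, (forall k, test_fun Om (psi k)) /\
    (fun k => H1norm (psi k \- w)) @ \oo --> 0%E.

(* H^{-1}, the dual of H10; functionals only matter through their values
   on H10. *)
Definition Hm1norm (l : (E -> R) -> R) : \bar R :=
  ereal_sup [set (`|l psi|)%:E | psi in
    [set psi | H10 psi /\ (H1norm psi <= 1)%E]].

Definition Hm1 (l : (E -> R) -> R) : Prop :=
  (forall (a : R) w1 w2, H10 w1 -> H10 w2 ->
     l (fun x => a * w1 x + w2 x) = a * l w1 + l w2) /\
  (Hm1norm l < +oo)%E.

Definition friedrichs_constant (C : R) : Prop :=
  0 < C /\
  forall w, H10 w -> (L2norm mu Om w <= C%:E * L2normv mu Om (wgrad w))%E.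

End sobolev.

Section boundary.
Context (R : realType) (n : nat).
Local Notation E := 'rV[R]_n.
Implicit Types (A Om : set E).

Definition boundary Om : set E := closure Om `\` interior Om.

(* Near each boundary point [Om] lies on one side of a Lipschitz graph, over
   the hyperplane orthogonal to a unit vector [nu]; a function on that
   hyperplane is encoded as a function on the whole space that is constant
   along [nu]. *)
Definition lipschitz_boundary Om : Prop :=
  forall x0, boundary Om x0 ->
  exists (r : R) (nu : E) (gamma : E -> R) (L : R),
    [/\ 0 < r, enorm nu = 1,
        forall x y, `|gamma x - gamma y| <= L * enorm (x - y),
        forall x (s : R), gamma (x + s *: nu) = gamma x &
        forall x, enorm (x - x0) < r -> (Om x <-> gamma x < dotv x nu)].

Definition diam A : \bar R :=
  ereal_sup [set (enorm (p.1 - p.2))%:E | p in A `*` A].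

Definition hausdorff_gauge (s : nat) A : \bar R :=
  if `[< A = set0 >] then 0%E else (diam A ^+ s)%E.

(* [s]-dimensional Hausdorff measure, up to the normalizing factor. *)
Definition hausdorff (s : nat) A : \bar R :=
  ereal_sup [set
    ereal_inf [set (\sum_(0 <= k <oo) hausdorff_gauge s (C k))%E | C in
      [set C : nat -> set E |
        A `<=` \bigcup_k C k /\ forall k, (diam (C k) <= delta%:E)%E]]
    | delta in [set delta : R | 0 < delta]].

(* [g] is the trace of [w]: the trace operator is the continuous extension to
   H1(Om) of the restriction of smooth functions to the boundary. *)
Definition trace Om (w g : E -> R) : Prop :=
  measurable_fun (boundary Om) g /\
  exists psi : nat -> E -> R,
    [/\ forall k, smooth (psi k),
        (fun k => H1norm Om (psi k \- w)) @ \oo --> 0%E &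
        (fun k => \int[hausdorff n.-1]_(x in boundary Om)
                    ((psi k x - g x) ^+ 2)%:E)%E @ \oo --> 0%E].

Definition ae_nonpos_on_boundary Om (w : E -> R) : Prop :=
  exists g, trace Om w g /\
    hausdorff n.-1 [set x | boundary Om x /\ 0 < g x] = 0%E.

End boundary.

(* Bochner measurability on [I] of a function with values in the space [X]
   endowed with the distance [dist]: pointwise a.e. limit of simple functions. *)
Definition strongly_measurable (R : realType) (V : Type) (X : set V)
    (dist : V -> V -> \bar R) (I : set (measurableTypeR R))
    (u : R -> V) : Prop :=
  exists s : nat -> R -> V,
    (forall k, [/\ forall t, I t -> X (s k t), finite_set (s k @` I) &
       forall c, measurable (I `&` (s k @^-1` [set c]) : set (measurableTypeR R))]) /\
    {ae @lebesgue_measure R, forall t, I t ->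
       (fun k => dist (s k t) (u t)) @ \oo --> 0%E}.

Definition slice (X Y Z : Type) (w : X * Y -> Z) (t : Y) : X -> Z :=
  fun x => w (x, t).

Section parabolic.
Context (R : realType) (n : nat).
Variables (Om : set 'rV[R]_n) (T : R).
Local Notation E := 'rV[R]_n.
Local Notation mu := (leb R n).
Local Notation lambda := (@lebesgue_measure R).
Local Notation st := (leb_st R n).
Local Notation I := (`]0, T[%classic : set (measurableTypeR R)).
Implicit Types (u v w g V : spacetime R n -> R) (tau G : spacetime R n -> E).

Definition QT : set (spacetime R n) := Om `*` I.

Definition is_gradx w G : Prop :=
  in_L2v st QT G /\
  {ae lambda, forall t, I t -> weak_gradient Om (slice w t) (slice G t)}.

Definition gradx w : spacetime R n -> E :=
  xget (fun=> 0) [set G | is_gradx w G].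

(* L2((0,T), H10(Om)), its elements being identified with functions on QT; the
   finiteness of the norm is that of [w] and of its gradient in L2(QT). *)
Definition L2H10 w : Prop :=
  [/\ in_L2 st QT w, exists G, is_gradx w G,
      {ae lambda, forall t, I t -> H10 Om (slice w t)} &
      strongly_measurable (H10 Om) (fun a b => H1norm Om (a \- b)) I (slice w)].

Definition L2Hm1 (xi : R -> (E -> R) -> R) : Prop :=
  [/\ {ae lambda, forall t, I t -> Hm1 Om (xi t)},
      strongly_measurable (Hm1 Om) (fun a b => Hm1norm Om (a \- b)) I xi &
      (\int[lambda]_(t in I) (Hm1norm Om (xi t) ^+ 2) < +oo)%E].

Definition is_dt w (xi : R -> (E -> R) -> R) : Prop :=
  L2Hm1 xi /\
  forall psi eta, H10 Om psi -> time_test_fun T eta ->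
    \int[lambda]_(t in I) (xi t psi * eta t) =
    - \int[lambda]_(t in I)
        ((\int[mu]_(x in Om) (w (x, t) * psi x)) * derive1 eta t).

Definition dt w : R -> (E -> R) -> R :=
  xget (fun _ _ => 0) [set xi | is_dt w xi].

(* The time derivative is a function, acting on H10 by integration. *)
Definition is_dt_fun w g : Prop :=
  measurable_fun QT g /\
  {ae lambda, forall t, I t -> in_L2 mu Om (slice g t) /\
     forall psi, H10 Om psi ->
       dt w t psi = \int[mu]_(x in Om) (g (x, t) * psi x)}.

Definition dt_fun w : spacetime R n -> R :=
  xget (fun=> 0) [set g | is_dt_fun w g].

Definition is_divx tau g : Prop :=
  measurable_fun QT g /\
  {ae lambda, forall t, I t -> in_L2 mu Om (slice g t) /\
     forall psi, test_fun Om psi ->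
       \int[mu]_(x in Om) dotv (tau (x, t)) (nabla psi x) =
       - \int[mu]_(x in Om) (g (x, t) * psi x)}.

Definition divx tau : spacetime R n -> R :=
  xget (fun=> 0) [set g | is_divx tau g].

Definition Hdiv tau : Prop := in_L2v st QT tau /\ exists g, is_divx tau g.

(* [V] is the representative of [w] in C([0,T], L2(Om)). *)
Definition time_continuous_version w V : Prop :=
  [/\ forall t : R, 0 <= t <= T -> in_L2 mu Om (slice V t),
      forall t0 : R, 0 <= t0 <= T ->
        L2norm mu Om (slice V t \- slice V t0)
          @[t --> within `[0, T]%classic (nbhs t0)] --> 0%E &
      {ae lambda, forall t, I t ->
        {ae mu, forall x, Om x -> V (x, t) = w (x, t)}}].

Section obstacle.
Variables (phi : E -> R) (f : spacetime R n -> R).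

Definition admissible w : Prop :=
  [/\ L2H10 w, exists xi, is_dt w xi &
      {ae st, forall p, QT p -> phi p.1 <= w p}].

Definition obstacle_solution (u0 : E -> R) u : Prop :=
  [/\ admissible u,
      forall w, admissible w ->
        \int[st]_(p in QT) (f p * (w p - u p)) <=
        \int[lambda]_(t in I) dt u t (slice w t \- slice u t) +
        \int[st]_(p in QT) dotv (gradx u p) (gradx (w \- u) p) &
      exists2 U : spacetime R n -> R, time_continuous_version u U &
        {ae mu, forall x, Om x -> U (x, 0) = u0 x}].

Definition residual v tau (p : spacetime R n) : R :=
  f p + divx tau p - dt_fun v p.

(* As [v >= phi] a.e., the second case is [v = phi] up to a null set. *)
Definition obstacle_residual v tau (p : spacetime R n) : R :=
  if phi p.1 < v p then residual v tau p else Num.max 0 (residual v tau p).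

End obstacle.

End parabolic.

(* Main.v *)
(* Let e = v - u.  The energy inequality bounds |e(T)|^2 - |e(0)|^2 by twice the
   integral of <v_t - u_t, e>.  The variational inequality tested with v removes
   u_t, and integrating div tau by parts leaves the residual R and tau - grad v.
   Pointwise -R e <= |F| |e|: on {v = phi} the error e = phi - u is nonpositive, so
   only the positive part of R contributes.  The Cauchy-Schwarz, Friedrichs and
   Young inequalities conclude.  Before the last one, the estimate reads
   |e(T)|^2 + 2 |grad e|^2 <= |e(0)|^2 + 2 (|tau - grad v| + C |F|) |grad e|, so a
   vanishing majorant forces e = 0 for every alpha.

   The energy inequality only needs an upper bound, and
   (V(t) - V(t-h), V(t)) >= (|V(t)|^2 - |V(t-h)|^2) / 2 gives it after averaging
   over t: the increments of V against a simple curve near e are Steklov averages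
   of the time derivative.

   For the converse, localizing the variational inequality in time and comparing
   u with c + psi and c + psi (phi - c), where psi is a bump and c an admissible
   function close to u(t), gives R <= 0 and R (phi - u) <= 0 almost everywhere.
   Hence R = 0 where u > phi, and F = 0. *)

Require Import Defs.
From HB Require Import structures.
From mathcomp Require Import all_boot all_order all_algebra.
From mathcomp Require Import all_classical all_reals all_analysis.
From mathcomp Require Import measurable_realfun ring lra.

Set Implicit Arguments.
Unset Strict Implicit.
Unset Printing Implicit Defensive.

Import Order.TTheory GRing.Theory Num.Theory.
Import numFieldNormedType.Exports.

Local Open Scope classical_set_scope.
Local Open Scope ring_scope.

Import HBSimple HBNNSimple.

(** * Integration up to null sets *)

(** Null sets shape the argument. The Borel sigma-algebras are not complete, and norms and pairings
    of slices are measurable in time only after modification on a null set, hence [aemeas] and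
    [aeint]. In the converse, the variational inequality localized at time t holds off a null set of
    times that depends on the comparison function. Competitors and tests must therefore come from
    countable families fixed in advance, which excludes u(t) itself: competitors constant in time
    come arbitrarily near to it, and the error vanishes with the distance. The trace hypothesis
    provides smooth functions tending to phi in H1; multiplied by a test function, they put psi phi
    in H10 although phi need not lie there. The same obstacle appears in the energy inequality:
    increments of V are known against fixed functions only, and a simple curve takes finitely many
    values. Its error is c d + K / c up to a factor, where d is the squared L2 distance to the curve
    and K the squared norm of the time derivative; c is taken large first, then d small. *)

Lemma measurable_fun_ifD d d' (X : measurableType d) (Y : measurableType d')
    (D : set X) (b : X -> bool) (f g : X -> Y) : measurable D ->
  measurable_fun D b -> measurable_fun D f -> measurable_fun D g ->
  measurable_fun D (fun x => if b x then f x else g x).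
Proof.
move=> mD mb mf mg; apply: measurable_fun_if => //;
  [exact: measurable_funS mf|exact: measurable_funS mg].
Qed.

Section ae_integral.
Context d (X : measurableType d) (R : realType).
Variables (mu : {measure set X -> \bar R}) (D : set X).
Hypothesis mD : measurable D.

(* No measurability is needed: the integral is a supremum over simple
   functions, which may be set to zero on a null set. *)
Lemma ge0_ae_le_integral (f g : X -> \bar R) :
  (forall x, D x -> (0 <= f x)%E) -> (forall x, D x -> (0 <= g x)%E) ->
  {ae mu, forall x, D x -> (f x <= g x)%E} ->
  (\int[mu]_(x in D) f x <= \int[mu]_(x in D) g x)%E.
Proof.
move=> f0 g0 [N [mN N0 fgN]].
rewrite !ge0_integralE//; apply: ge_ereal_sup => _ /= [h hf <-].
have mNC : measurable (~` N) by exact: measurableC.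
pose h' := mul_nnsfun h (indic_nnsfun R mNC).
have -> : sintegral mu h = sintegral mu h'.
  rewrite -!integralT_nnsfun; apply: ge0_ae_eq_integral => //.
  - by apply/measurable_EFinP; exact: measurable_funP.
  - by apply/measurable_EFinP; exact: measurable_funP.
  - by move=> x _; rewrite lee_fin.
  - by move=> x _; rewrite lee_fin.
  - exists N; split => // x /= /not_implyP[_]; rewrite /h' /= => H.
    apply: contrapT => nN; apply: H; congr (_%:E).
    by rewrite ?/mindic indicE mem_set ?mulr1.
apply: ereal_sup_ubound; exists h' => //= x.
rewrite /h' /= /mindic indicE; case: (boolP (x \in ~` N)) => [|_].
- rewrite inE => /= nN; rewrite mulr1.
  apply: le_trans (hf x) _; rewrite /patch; case: ifPn => // xD.
  by apply: contrapT => H; apply: nN; apply: fgN => /= K; apply/H/K/set_mem.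
- rewrite mulr0 /patch; case: ifPn => // xD; exact/g0/set_mem.
Qed.

Lemma ae_eq_integral' (f g : X -> \bar R) :
  {ae mu, forall x, D x -> f x = g x} ->
  (\int[mu]_(x in D) f x = \int[mu]_(x in D) g x)%E.
Proof.
move=> fg; rewrite integralE [RHS]integralE; congr (_ - _)%E; apply/eqP;
  rewrite eq_le; apply/andP; split; apply: ge0_ae_le_integral => //;
  by apply: filterS fg => x /= H Dx; rewrite ?funeposE ?funenegE H.
Qed.

Lemma ae_eq_Rintegral (f g : X -> R) :
  {ae mu, forall x, D x -> f x = g x} ->
  \int[mu]_(x in D) f x = \int[mu]_(x in D) g x.
Proof.
by move=> fg; congr fine; apply: ae_eq_integral'; apply: filterS fg => x /= H Dx; rewrite H.
Qed.

Definition aemeas (f : X -> R) :=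
  exists2 g, measurable_fun D g & {ae mu, forall x, D x -> f x = g x}.

(* Integrability up to modification on a null set: Borel measurability is not
   preserved by such modifications. *)
Definition aeint (f : X -> R) :=
  exists2 g, mu.-integrable D (EFin \o g) & {ae mu, forall x, D x -> f x = g x}.

Lemma integrable_aeint f : mu.-integrable D (EFin \o f) -> aeint f.
Proof. by move=> fi; exists f => //; exact: aeW. Qed.

Lemma aeint_aemeas f : aeint f -> aemeas f.
Proof. by move=> [g /measurable_int/measurable_EFinP mg fg]; exists g. Qed.

Lemma measurable_aemeas f : measurable_fun D f -> aemeas f.
Proof. by move=> mf; exists f => //; exact: aeW. Qed.

Lemma aeint_ae f g : {ae mu, forall x, D x -> f x = g x} -> aeint f -> aeint g.
Proof.
move=> fg [h hi fh]; exists h => //.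
by apply: filterS2 fg fh => x /= H K Dx; rewrite -H// K.
Qed.

Lemma aemeas_ae f g : {ae mu, forall x, D x -> f x = g x} -> aemeas f -> aemeas g.
Proof.
move=> fg [h hi fh]; exists h => //.
by apply: filterS2 fg fh => x /= H K Dx; rewrite -H// K.
Qed.

Lemma aemeasM f g : aemeas f -> aemeas g -> aemeas (fun x => f x * g x).
Proof.
move=> [f' mf ff] [g' mg gg]; exists (fun x => f' x * g' x).
  exact: measurable_funM.
by apply: filterS2 ff gg => x /= H K Dx; rewrite H// K.
Qed.

Lemma aeintD f g : aeint f -> aeint g -> aeint (fun x => f x + g x).
Proof.
move=> [f' mf ff] [g' mg gg]; exists (fun x => f' x + g' x).
  by apply: (eq_integrable mD _ _ _ (integrableD mD mf mg)) => x _.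
by apply: filterS2 ff gg => x /= H K Dx; rewrite H// K.
Qed.

Lemma aeintZ a f : aeint f -> aeint (fun x => a * f x).
Proof.
move=> [f' mf ff]; exists (fun x => a * f' x).
  by apply: (eq_integrable mD _ _ _ (integrableZl mD a mf)) => x _.
by apply: filterS ff => x /= H Dx; rewrite H.
Qed.

Lemma aeintN f : aeint f -> aeint (fun x => - f x).
Proof.
move=> /(aeintZ (-1)); apply: aeint_ae; apply: aeW => x _.
by rewrite mulN1r.
Qed.

Lemma aeintB f g : aeint f -> aeint g -> aeint (fun x => f x - g x).
Proof. by move=> fi /aeintN gi; exact: aeintD. Qed.

Lemma aeint_abs f : aeint f -> aeint (fun x => `|f x|).
Proof.
move=> [f' mf ff]; exists (fun x => `|f' x|); first exact: integrable_norm.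
by apply: filterS ff => x /= H Dx; rewrite H.
Qed.

Lemma aeint_sum (I : Type) (s : seq I) (f : I -> X -> R) :
  (forall i, aeint (f i)) -> aeint (fun x => \sum_(i <- s) f i x).
Proof.
move=> fi; elim: s => [|i s IH].
  apply: integrable_aeint; apply: (eq_integrable mD _ _ _ (integrable0 mu D)) => x _ /=.
  by rewrite big_nil.
apply: aeint_ae (aeintD (fi i) IH).
by apply: aeW => x _; rewrite big_cons.
Qed.

Lemma aeint_dominated f g : aemeas f -> aeint g ->
  {ae mu, forall x, D x -> `|f x| <= g x} -> aeint f.
Proof.
move=> [f' mf ff] [g' ig gg] fg.
(* The domination holds only almost everywhere; setting the representative to zero where it fails
   makes it hold on all of [D] and keeps it measurable. *)
pose b : X -> bool := fun x => `|f' x| <= g' x.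
have mg : measurable_fun D g' by apply/measurable_EFinP; exact: measurable_int ig.
pose h x := if b x then f' x else 0.
exists h.
  apply: le_integrable ig => //.
    apply/measurable_EFinP; apply: measurable_fun_ifD => //.
    apply: measurable_fun_ler => //; exact: measurableT_comp.
  move=> x Dx /=; rewrite lee_fin /h; case: ifPn => [bx|_]; last by rewrite normr0.
  by apply: le_trans bx _; rewrite ler_norm.
apply: filterS3 ff gg fg => x /= H K L Dx.
by rewrite H// /h /b -H// -K// L.
Qed.

Lemma RintD f g : aeint f -> aeint g ->
  \int[mu]_(x in D) (f x + g x) = \int[mu]_(x in D) f x + \int[mu]_(x in D) g x.
Proof.
move=> [f' mf ff] [g' mg gg].
rewrite (ae_eq_Rintegral ff) (ae_eq_Rintegral gg) -RintegralD//.
by apply: ae_eq_Rintegral; apply: filterS2 ff gg => x /= H K Dx; rewrite H// K.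
Qed.

Lemma RintZ a f : aeint f ->
  \int[mu]_(x in D) (a * f x) = a * \int[mu]_(x in D) f x.
Proof.
move=> [f' mf ff]; rewrite (ae_eq_Rintegral ff) -RintegralZl//.
by apply: ae_eq_Rintegral; apply: filterS ff => x /= H Dx; rewrite H.
Qed.

Lemma RintN f : aeint f ->
  \int[mu]_(x in D) (- f x) = - \int[mu]_(x in D) f x.
Proof.
move=> fi; rewrite -mulN1r -RintZ//.
by apply: eq_Rintegral => x _; rewrite mulN1r.
Qed.

Lemma RintB f g : aeint f -> aeint g ->
  \int[mu]_(x in D) (f x - g x) = \int[mu]_(x in D) f x - \int[mu]_(x in D) g x.
Proof. by move=> fi gi; rewrite RintD ?RintN//; exact: aeintN. Qed.

Lemma Rint0 : \int[mu]_(x in D) (0 : R) = 0.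
Proof. by rewrite Rintegral_cst// mul0r. Qed.

Lemma Rint_sum (I : Type) (s : seq I) (f : I -> X -> R) :
  (forall i, aeint (f i)) ->
  \int[mu]_(x in D) (\sum_(i <- s) f i x) = \sum_(i <- s) \int[mu]_(x in D) f i x.
Proof.
move=> fi; elim: s => [|i s IH].
  by rewrite big_nil -[RHS]Rint0; apply: eq_Rintegral => x _; rewrite big_nil.
rewrite big_cons -IH -RintD//; last exact: aeint_sum.
by apply: eq_Rintegral => x _; rewrite big_cons.
Qed.

Lemma le_Rint f g : aeint f -> aeint g ->
  {ae mu, forall x, D x -> f x <= g x} ->
  \int[mu]_(x in D) f x <= \int[mu]_(x in D) g x.
Proof.
move=> fi gi fg; rewrite -subr_ge0 -RintB//.
rewrite (_ : Rintegral _ _ _ = \int[mu]_(x in D) (Num.max 0 (g x - f x))).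
  by apply: Rintegral_ge0 => x _; rewrite le_max lexx.
apply: ae_eq_Rintegral; apply: filterS fg => x /= H Dx.
by apply/esym/max_idPr; rewrite subr_ge0 H.
Qed.

Lemma Rint_ge0 f : {ae mu, forall x, D x -> 0 <= f x} ->
  0 <= \int[mu]_(x in D) f x.
Proof.
move=> f0; rewrite (_ : Rintegral _ _ _ = \int[mu]_(x in D) (Num.max 0 (f x))).
  by apply: Rintegral_ge0 => x _; rewrite le_max lexx.
apply: ae_eq_Rintegral; apply: filterS f0 => x /= H Dx.
by apply/esym/max_idPr; rewrite H.
Qed.

Lemma le_normr_Rint f : aeint f ->
  `|\int[mu]_(x in D) f x| <= \int[mu]_(x in D) `|f x|.
Proof.
move=> [f' mf ff]; rewrite (ae_eq_Rintegral ff).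
apply: le_trans (le_normr_Rintegral mD mf) _.
rewrite le_eqVlt; apply/orP; left; apply/eqP/esym/ae_eq_Rintegral.
by apply: filterS ff => x /= H Dx; rewrite H.
Qed.

Lemma Rint_eq0 f : aeint f -> {ae mu, forall x, D x -> 0 <= f x} ->
  \int[mu]_(x in D) f x = 0 -> {ae mu, forall x, D x -> f x = 0}.
Proof.
move=> [f' mf ff] f0 I0.
have : {ae mu, forall x, D x -> (EFin \o f') x = cst 0%E x}.
  apply/(ae_eq_integral_abs _ mD (measurable_int _ mf)).
  have : \int[mu]_(x in D) `|f' x| = 0.
    rewrite -I0; apply: ae_eq_Rintegral.
    by apply: filterS2 ff f0 => x /= H K Dx; rewrite -H// ger0_norm// K.
  move=> K; rewrite -[LHS]fineK; last first.
    apply: integrable_fin_num => //; exact: integrable_abse.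
  by congr (_%:E).
by apply: filterS2 ff => x /= H + Dx; rewrite H// => /(_ Dx) [].
Qed.

Lemma aemeas_lim (f_ : nat -> X -> R) f : (forall k, aemeas (f_ k)) ->
  {ae mu, forall x, D x -> (fun k => f_ k x) @ \oo --> f x} -> aemeas f.
Proof.
move=> mf [N [mN N0 fN]].
have /choice[g Hg] : forall k, exists g, measurable_fun D g /\ {ae mu, forall x, D x -> f_ k x = g x}.
  by move=> k; have [g mg fg] := mf k; exists g.
have /ae_foralln[M [mM M0 gM]] : forall k, {ae mu, forall x, D x -> f_ k x = g k x}.
  by move=> k; have [] := Hg k.
(* The representatives are known to converge only off a null set, so everything is multiplied by the
   indicator of its measurable complement. *)
pose B := ~` (N `|` M).
have mB : measurable B by apply: measurableC; exact: measurableU.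
exists (fun x => f x * \1_B x).
  apply: (@measurable_fun_cvg _ _ _ _ (fun k x => g k x * \1_B x)).
    move=> k; apply: measurable_funM; first by have [] := Hg k.
    exact: measurable_indic.
  move=> x Dx; rewrite indicE; case: (boolP (x \in B)) => [|_]; last first.
    by rewrite mulr0; under eq_fun do rewrite mulr0; exact: cvg_cst.
  rewrite inE /B => /= /not_orP[nN nM]; rewrite mulr1; under eq_fun do rewrite mulr1.
  have -> : (g^~ x) = (f_^~ x).
    apply/funext => k; apply/esym; apply: contrapT => K; apply: nM; apply: gM => /= H.
    exact/K/H.
  by apply: contrapT => K; apply: nN; apply: fN => /= H; exact/K/H.
exists (N `|` M); split; first exact: measurableU.
  apply: measure_negligible; first exact: measurableU.
  by apply: negligibleU; exact/negligibleP.
move=> x /= /not_implyP[Dx K]; apply: contrapT => H; apply: K.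
by rewrite ?/mindic indicE mem_set ?mulr1.
Qed.

Lemma dominated_cvg_Rint (f_ : nat -> X -> R) f g : (forall k, aemeas (f_ k)) ->
  aeint g -> (forall k, {ae mu, forall x, D x -> `|f_ k x| <= g x}) ->
  {ae mu, forall x, D x -> (fun k => f_ k x) @ \oo --> f x} ->
  aeint f /\ (fun k => \int[mu]_(x in D) f_ k x) @ \oo --> \int[mu]_(x in D) f x.
Proof.
move=> mf gi fg fl.
have fgA := ae_foralln fg.
have mf' : aemeas f by exact: aemeas_lim fl.
have fi : aeint f.
  apply: aeint_dominated gi _ => //.
  apply: filterS2 fgA fl => x /= H K Dx.
  have /cvg_norm L := K Dx.
  rewrite -(cvg_lim _ L)//; apply: limr_le; first exact: cvgP L.
  by near=> k; exact: H.
split => //.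
have /choice[h Hh] : forall k, exists h, measurable_fun D h /\ {ae mu, forall x, D x -> f_ k x = h x}.
  by move=> k; have [h mh fh] := mf k; exists h.
have [g' gi' gg] := gi; have [f' fi' ff] := fi.
have -> : (fun k => \int[mu]_(x in D) f_ k x) = (fun k => \int[mu]_(x in D) h k x).
  by apply/funext => k; apply: ae_eq_Rintegral; have [] := Hh k.
rewrite (ae_eq_Rintegral ff).
have hA : {ae mu, forall x, forall k, D x -> f_ k x = h k x}.
  by apply: ae_foralln => k; have [] := Hh k.
have [] := @dominated_convergence _ _ _ mu D mD (fun k => EFin \o h k) (EFin \o f') (EFin \o g').
- by move=> k; apply/measurable_EFinP; have [] := Hh k.
- exact: measurable_int fi'.
- apply: filterS3 fl hA ff => x /= H K L Dx.
  apply: cvg_EFin; first by near=> k.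
  under eq_fun do rewrite /= -K//.
  by rewrite -L//; exact: H.
- exact: gi'.
- apply: filterS3 fgA gg hA => x /= H K L Dx k /=.
  by rewrite lee_fin -K// -L// H.
move=> _ _; rewrite -[X in _ --> X]fineK; last exact: integrable_fin_num.
by move/fine_cvg.
Unshelve. all: by end_near.
Qed.

End ae_integral.

(** * Square-integrable functions *)

(** The Cauchy-Schwarz inequalities for scalar, vector and H1 products all come from this, applied
    to the square norm of f + s g. *)
Lemma discriminant_le (R : realFieldType) (A B C : R) :
  0 <= C -> (forall s, 0 <= A + 2 * s * B + s ^+ 2 * C) -> B ^+ 2 <= A * C.
Proof.
rewrite le_eqVlt => /orP[/eqP <-|C0] H.
  have [->|B0] := eqVneq B 0; first by rewrite expr0n mulr0.
  (* With C = 0 the polynomial is affine; at this point it equals -1. *)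
  have := H (- (A + 1) / (2 * B)).
  have -> : A + 2 * (- (A + 1) / (2 * B)) * B + (- (A + 1) / (2 * B)) ^+ 2 * 0 = -1.
    by field.
  by rewrite lerNr oppr0 ler10.
(* The minimizer of the quadratic polynomial. *)
have := H (- B / C).
have -> : A + 2 * (- B / C) * B + (- B / C) ^+ 2 * C = (A * C - B ^+ 2) / C.
  by field; rewrite gt_eqF.
by rewrite pmulr_lge0 ?invr_gt0// subr_ge0.
Qed.

Lemma cauchy_schwarz_sqrt (R : rcfType) (A B C : R) :
  0 <= A -> 0 <= C -> B ^+ 2 <= A * C -> `|B| <= Num.sqrt A * Num.sqrt C.
Proof. by move=> A0 C0 H; rewrite -sqrtrM// -sqrtr_sqr ler_sqrt// mulr_ge0. Qed.

Lemma sqrt_triangle (R : rcfType) (A B C : R) :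
  0 <= A -> 0 <= C -> B ^+ 2 <= A * C ->
  Num.sqrt (A + 2 * B + C) <= Num.sqrt A + Num.sqrt C.
Proof.
move=> A0 C0 H; have := cauchy_schwarz_sqrt A0 C0 H => K.
rewrite -(ger0_norm (addr_ge0 (sqrtr_ge0 A) (sqrtr_ge0 C))) -sqrtr_sqr ler_sqrt ?sqr_ge0//.
rewrite sqrrD !sqr_sqrtr// mulr_natl lerD2r lerD2l ler_pMn2r//.
by apply: le_trans K; rewrite ler_norm.
Qed.

Lemma sqrD_le (R : realFieldType) (a b : R) : (a + b) ^+ 2 <= 2 * a ^+ 2 + 2 * b ^+ 2.
Proof. by have := sqr_ge0 (a - b); nra. Qed.

Lemma young (R : realFieldType) (k a b : R) : 0 < k ->
  a * b <= 2^-1 * (k * a ^+ 2 + k^-1 * b ^+ 2).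
Proof.
move=> k0; have := mulr_ge0 (ltW k0) (sqr_ge0 (a - k^-1 * b)).
have -> : k * (a - k^-1 * b) ^+ 2 = k * a ^+ 2 - 2 * (a * b) + k^-1 * b ^+ 2.
  by field; rewrite gt_eqF.
lra.
Qed.

(* Locked, lest [ring] and [lra] unfold the integrals. *)
HB.lock Definition ip d (X : measurableType d) (R : realType)
    (mu : {measure set X -> \bar R}) (D : set X) (f g : X -> R) : R :=
  \int[mu]_(x in D) (f x * g x).

HB.lock Definition ipv d (X : measurableType d) (R : realType)
    (mu : {measure set X -> \bar R}) (D : set X) n (G H : X -> 'rV[R]_n) : R :=
  \int[mu]_(x in D) dotv (G x) (H x).

Section square_integrable.
Context d (X : measurableType d) (R : realType).
Variables (mu : {measure set X -> \bar R}) (D : set X).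
Hypothesis mD : measurable D.
Local Notation L2 := (in_L2 mu D).

Local Notation ip := (ip mu D).

Lemma ipE f g : ip f g = \int[mu]_(x in D) (f x * g x).
Proof. by rewrite ip.unlock. Qed.

Lemma L2normE f : L2norm mu D f = sqrte (\int[mu]_(x in D) ((f x) ^+ 2)%:E)%E.
Proof.
rewrite /L2norm unlock poweR12_sqrt; last by apply: integral_ge0 => x _; exact: poweR_ge0.
congr sqrte; rewrite [RHS]integral_mkcond; apply: eq_integral => x _ /=.
rewrite /patch; case: ifPn => _; rewrite ?normr0 ?powR0//.
by rewrite powR_mulrn ?normr_ge0// real_normK// num_real.
Qed.

Lemma L2norm_sq f : (L2norm mu D f ^+ 2 = \int[mu]_(x in D) ((f x) ^+ 2)%:E)%E.
Proof.
by rewrite L2normE sqr_sqrte// integral_ge0// => x _; rewrite lee_fin sqr_ge0.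
Qed.

Lemma L2norm_ge0 f : (0 <= L2norm mu D f)%E.
Proof. by rewrite L2normE sqrte_ge0. Qed.

Lemma L2norm_lty f : (L2norm mu D f < +oo)%E = (\int[mu]_(x in D) ((f x) ^+ 2)%:E < +oo)%E.
Proof.
rewrite -L2norm_sq; have := L2norm_ge0 f.
by case: (L2norm mu D f) => [r||]//=; rewrite ?ltry// expe2 mulyy.
Qed.

Lemma in_L2P f : L2 f <->
  measurable_fun D f /\ mu.-integrable D (EFin \o (fun x => f x ^+ 2)).
Proof.
split=> -[mf]; rewrite ?L2norm_lty => h; split=> //.
  apply/integrableP; split; first by apply/measurable_EFinP; exact: measurable_funX.
  apply: le_lt_trans h; rewrite le_eqVlt; apply/orP; left; apply/eqP.
  by apply: eq_integral => x _ /=; rewrite ger0_norm// sqr_ge0.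
rewrite L2norm_lty; case/integrableP : h => _; apply: le_lt_trans.
rewrite le_eqVlt; apply/orP; left; apply/eqP.
by apply: eq_integral => x _ /=; rewrite ger0_norm// sqr_ge0.
Qed.

Lemma in_L2_measurable f : L2 f -> measurable_fun D f.
Proof. by case. Qed.

Lemma in_L2_integrableM f g : L2 f -> L2 g ->
  mu.-integrable D (EFin \o (fun x => f x * g x)).
Proof.
move=> /in_L2P[mf fi] /in_L2P[mg gi].
apply: le_integrable (integrableD mD fi gi) => //.
  by apply/measurable_EFinP; exact: measurable_funM.
move=> x Dx /=; rewrite lee_fin [leRHS]ger0_norm ?addr_ge0 ?sqr_ge0//.
rewrite ler_norml; apply/andP; split.
  by have := sqr_ge0 (f x + g x); have := sqr_ge0 (f x); have := sqr_ge0 (g x); nra.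
by have := sqr_ge0 (f x - g x); have := sqr_ge0 (f x); have := sqr_ge0 (g x); nra.
Qed.

Lemma in_L2_aeintM f g : L2 f -> L2 g -> aeint mu D (fun x => f x * g x).
Proof. by move=> fi gi; apply: integrable_aeint; exact: in_L2_integrableM. Qed.

Lemma eq_in_L2 f g : (forall x, D x -> f x = g x) -> L2 f -> L2 g.
Proof.
move=> fg /in_L2P[mf fi]; apply/in_L2P; split.
  by apply: eq_measurable_fun mf => x /set_mem /fg.
by apply: (eq_integrable mD _ _ _ fi) => x /set_mem /fg /= ->.
Qed.

Lemma in_L2Z a f : L2 f -> L2 (fun x => a * f x).
Proof.
move=> /in_L2P[mf fi]; apply/in_L2P; split; first exact: measurable_funM.
apply: (eq_integrable mD _ _ _ (integrableZl mD (a ^+ 2) fi)) => x _ /=.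
by rewrite -EFinM exprMn.
Qed.

Lemma in_L2D f g : L2 f -> L2 g -> L2 (fun x => f x + g x).
Proof.
move=> fl gl; have fgi := in_L2_integrableM fl gl.
move: fl gl => /in_L2P[mf fi] /in_L2P[mg gi]; apply/in_L2P; split.
  exact: measurable_funD.
apply: (eq_integrable mD _ _ _ (integrableD mD (integrableD mD fi gi) (integrableZl mD 2 fgi))) => x _ /=.
by rewrite -!EFinD; congr EFin; ring.
Qed.

Lemma in_L2N f : L2 f -> L2 (fun x => - f x).
Proof. by move=> /(in_L2Z (-1)); apply: eq_in_L2 => x _; rewrite mulN1r. Qed.

Lemma in_L2B f g : L2 f -> L2 g -> L2 (fun x => f x - g x).
Proof. by move=> fl gl; apply: in_L2D => //; exact: in_L2N. Qed.

Lemma in_L2_0 : L2 (fun=> 0).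
Proof.
apply/in_L2P; split; first exact: measurable_cst.
by apply: (eq_integrable mD _ _ _ (integrable0 mu D)) => x _ /=; rewrite expr0n.
Qed.

Lemma in_L2_le (f g : X -> R) : measurable_fun D f -> (forall x, D x -> `|f x| <= `|g x|) ->
  L2 g -> L2 f.
Proof.
move=> mf fg /in_L2P[mg gi]; apply/in_L2P; split => //.
apply: le_integrable gi => //.
  by apply/measurable_EFinP; exact: measurable_funX.
by move=> x Dx /=; rewrite lee_fin !normrX lerXn2r ?nnegrE// fg.
Qed.

Lemma ip_ge0 f : 0 <= ip f f.
Proof. by rewrite ipE; apply: Rintegral_ge0 => x _; rewrite -expr2 sqr_ge0. Qed.

Lemma L2norm_sq_ip f : L2 f -> (L2norm mu D f ^+ 2 = (ip f f)%:E)%E.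
Proof.
move=> /in_L2P[mf fi]; rewrite L2norm_sq ipE /Rintegral -[LHS]fineK.
  by congr ((fine _)%:E); apply: eq_integral => x _; rewrite -expr2.
exact: integrable_fin_num.
Qed.

Lemma L2norm_ip f : L2 f -> L2norm mu D f = (Num.sqrt (ip f f))%:E.
Proof. by move=> fl; rewrite L2normE -L2norm_sq L2norm_sq_ip. Qed.

Lemma ipC f g : ip f g = ip g f.
Proof. by rewrite !ipE; apply: eq_Rintegral => x _; rewrite mulrC. Qed.

Lemma ipDl f g h : L2 f -> L2 g -> L2 h -> ip (fun x => f x + g x) h = ip f h + ip g h.
Proof.
move=> fl gl hl; rewrite !ipE -RintD//; try exact: in_L2_aeintM.
by apply: eq_Rintegral => x _; rewrite mulrDl.
Qed.

Lemma ipZl a f h : L2 f -> L2 h -> ip (fun x => a * f x) h = a * ip f h.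
Proof.
move=> fl hl; rewrite !ipE -RintZ//; try exact: in_L2_aeintM.
by apply: eq_Rintegral => x _; rewrite mulrA.
Qed.

Lemma ipBl f g h : L2 f -> L2 g -> L2 h -> ip (fun x => f x - g x) h = ip f h - ip g h.
Proof.
move=> fl gl hl; rewrite !ipE -RintB//; try exact: in_L2_aeintM.
by apply: eq_Rintegral => x _; rewrite mulrBl.
Qed.

Lemma ipDr f g h : L2 f -> L2 g -> L2 h -> ip h (fun x => f x + g x) = ip h f + ip h g.
Proof. by move=> *; rewrite ipC ipDl// ipC [ip g h]ipC. Qed.

Lemma ipZr a f h : L2 f -> L2 h -> ip h (fun x => a * f x) = a * ip h f.
Proof. by move=> *; rewrite ipC ipZl// ipC. Qed.

Lemma ipBr f g h : L2 f -> L2 g -> L2 h -> ip h (fun x => f x - g x) = ip h f - ip h g.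
Proof. by move=> *; rewrite ipC ipBl// ipC [ip g h]ipC. Qed.

Lemma ip_ae (f f' g g' : X -> R) : {ae mu, forall x, D x -> f x = f' x} ->
  {ae mu, forall x, D x -> g x = g' x} -> ip f g = ip f' g'.
Proof.
move=> ff gg; rewrite !ipE; apply: ae_eq_Rintegral => //.
by apply: filterS2 ff gg => x /= H K Dx; rewrite H// K.
Qed.

Lemma ip_expand f g s : L2 f -> L2 g ->
  ip (fun x => f x + s * g x) (fun x => f x + s * g x) =
  ip f f + 2 * s * ip f g + s ^+ 2 * ip g g.
Proof.
move=> fl gl; have sgl := in_L2Z s gl.
have fsgl := in_L2D fl sgl.
rewrite ipDl// ipDr// ipDr// !ipZr// !ipZl// (ipC g f); ring.
Qed.

Lemma ip_sq_le f g : L2 f -> L2 g -> ip f g ^+ 2 <= ip f f * ip g g.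
Proof.
move=> fl gl; apply: discriminant_le => [|s]; first exact: ip_ge0.
rewrite -ip_expand//; exact: ip_ge0.
Qed.

Lemma ip_le f g : L2 f -> L2 g -> `|ip f g| <= Num.sqrt (ip f f) * Num.sqrt (ip g g).
Proof. by move=> fl gl; apply: cauchy_schwarz_sqrt; rewrite ?ip_ge0// ip_sq_le. Qed.

Lemma ip_eq0 f : L2 f -> ip f f = 0 -> {ae mu, forall x, D x -> f x = 0}.
Proof.
rewrite ipE => fl /(Rint_eq0 mD (in_L2_aeintM fl fl)) H.
have K := H _; apply: filterS (K _) => [x /= L Dx|].
  by apply/eqP; rewrite -sqrf_eq0 expr2 L.
by apply: aeW => x _; rewrite -expr2 sqr_ge0.
Qed.

Lemma L2norm_ae (f g : X -> R) : {ae mu, forall x, D x -> f x = g x} -> L2norm mu D f = L2norm mu D g.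
Proof.
move=> fg; rewrite !L2normE; congr sqrte; apply: ae_eq_integral' => //.
by apply: filterS fg => x /= H Dx; rewrite H.
Qed.

Lemma L2norm0 (f : X -> R) : {ae mu, forall x, D x -> f x = 0} -> L2norm mu D f = 0%E.
Proof.
move=> f0; rewrite (L2norm_ae f0) L2norm_ip; last exact: in_L2_0.
by rewrite ipE; under eq_Rintegral do rewrite mul0r; rewrite Rint0// sqrtr0.
Qed.

Section vector_valued.
Variable n : nat.
Local Notation L2v := (@in_L2v R n _ X mu D).
Implicit Types G H : X -> 'rV[R]_n.

Local Notation ipv := (ipv mu D).

Lemma ipvE G H : ipv G H = \int[mu]_(x in D) dotv (G x) (H x).
Proof. by rewrite ipv.unlock. Qed.

Lemma dotv_ge0 (x : 'rV[R]_n) : 0 <= dotv x x.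
Proof. by apply: sumr_ge0 => i _; rewrite -expr2 sqr_ge0. Qed.

Lemma dotvC (x y : 'rV[R]_n) : dotv x y = dotv y x.
Proof. by apply: eq_bigr => i _; rewrite mulrC. Qed.

Lemma dotvDl (x y z : 'rV[R]_n) : dotv (x + y) z = dotv x z + dotv y z.
Proof. by rewrite -big_split; apply: eq_bigr => i _; rewrite mxE mulrDl. Qed.

Lemma dotvBl (x y z : 'rV[R]_n) : dotv (x - y) z = dotv x z - dotv y z.
Proof. by rewrite -sumrB; apply: eq_bigr => i _; rewrite !mxE mulrBl. Qed.

Lemma dotvZl a (x z : 'rV[R]_n) : dotv (a *: x) z = a * dotv x z.
Proof. by rewrite mulr_sumr; apply: eq_bigr => i _; rewrite mxE mulrA. Qed.

Lemma dotv_eq0 (x : 'rV[R]_n) : dotv x x = 0 -> x = 0.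
Proof.
move=> /eqP; rewrite psumr_eq0; last by move=> i _; rewrite -expr2 sqr_ge0.
move=> /allP H; apply/rowP => i; rewrite mxE; apply/eqP.
have /implyP/(_ isT) := H i (mem_index_enum i).
by rewrite -expr2 sqrf_eq0.
Qed.

Lemma enorm_sq (x : 'rV[R]_n) : enorm x ^+ 2 = dotv x x.
Proof. by rewrite sqr_sqrtr// dotv_ge0. Qed.

Lemma in_L2v_aeint G H : L2v G -> L2v H -> aeint mu D (fun x => dotv (G x) (H x)).
Proof.
by move=> gl hl; apply: aeint_sum => // i; exact: in_L2_aeintM (gl i) (hl i).
Qed.

Lemma ipv_sum G H : L2v G -> L2v H ->
  ipv G H = \sum_i ip (fun x => G x ord0 i) (fun x => H x ord0 i).
Proof.
move=> gl hl; rewrite !ipvE Rint_sum//.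
  by apply: eq_bigr => i _; rewrite ipE.
by move=> i; exact: in_L2_aeintM (gl i) (hl i).
Qed.

Lemma ipv_ge0 G : 0 <= ipv G G.
Proof. by rewrite ipvE; apply: Rintegral_ge0 => x _; exact: dotv_ge0. Qed.

Lemma in_L2vD G H : L2v G -> L2v H -> L2v (fun x => G x + H x).
Proof.
move=> gl hl i; apply: eq_in_L2 (in_L2D (gl i) (hl i)) => x _.
by rewrite mxE.
Qed.

Lemma in_L2vZ a G : L2v G -> L2v (fun x => a *: G x).
Proof. by move=> gl i; apply: eq_in_L2 (in_L2Z a (gl i)) => x _; rewrite mxE. Qed.

Lemma in_L2vB G H : L2v G -> L2v H -> L2v (fun x => G x - H x).
Proof.
move=> gl hl i; apply: eq_in_L2 (in_L2B (gl i) (hl i)) => x _.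
by rewrite !mxE.
Qed.

Lemma in_L2v_dotv G : (forall i, measurable_fun D (fun x => G x ord0 i)) ->
  L2v G <-> mu.-integrable D (EFin \o (fun x => dotv (G x) (G x))).
Proof.
move=> mG; split=> [gl|gi i].
  have := integrable_sum mD (index_enum 'I_n) (P := predT)
    (h := fun i => EFin \o (fun x => G x ord0 i * G x ord0 i)).
  move=> /(_ mu) H; apply: (eq_integrable mD _ _ _ (H _)) => [x _|i _].
    by rewrite /= sumEFin.
  exact: in_L2_integrableM (gl i) (gl i).
apply/in_L2P; split => //; apply: le_integrable gi => //.
  by apply/measurable_EFinP; exact: measurable_funX.
move=> x Dx /=; rewrite lee_fin ger0_norm ?sqr_ge0// ger0_norm ?dotv_ge0//.
rewrite /dotv (bigD1 i)//= expr2 lerDl sumr_ge0// => j _.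
by rewrite -expr2 sqr_ge0.
Qed.

Lemma ipvC G H : ipv G H = ipv H G.
Proof. by rewrite !ipvE; apply: eq_Rintegral => x _; rewrite dotvC. Qed.

Lemma ipvDl G H K : L2v G -> L2v H -> L2v K ->
  ipv (fun x => G x + H x) K = ipv G K + ipv H K.
Proof.
move=> gl hl kl; rewrite !ipvE -RintD//; try exact: in_L2v_aeint.
by apply: eq_Rintegral => x _; rewrite dotvDl.
Qed.

Lemma ipvZl a G K : L2v G -> L2v K -> ipv (fun x => a *: G x) K = a * ipv G K.
Proof.
move=> gl kl; rewrite !ipvE -RintZ//; try exact: in_L2v_aeint.
by apply: eq_Rintegral => x _; rewrite dotvZl.
Qed.

Lemma ipvBl G H K : L2v G -> L2v H -> L2v K ->
  ipv (fun x => G x - H x) K = ipv G K - ipv H K.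
Proof.
move=> gl hl kl; rewrite !ipvE -RintB//; try exact: in_L2v_aeint.
by apply: eq_Rintegral => x _; rewrite dotvBl.
Qed.

Lemma ipvDr G H K : L2v G -> L2v H -> L2v K ->
  ipv K (fun x => G x + H x) = ipv K G + ipv K H.
Proof. by move=> *; rewrite ipvC ipvDl// ipvC [ipv H K]ipvC. Qed.

Lemma ipvZr a G K : L2v G -> L2v K -> ipv K (fun x => a *: G x) = a * ipv K G.
Proof. by move=> *; rewrite ipvC ipvZl// ipvC. Qed.

Lemma ipvBr G H K : L2v G -> L2v H -> L2v K ->
  ipv K (fun x => G x - H x) = ipv K G - ipv K H.
Proof. by move=> *; rewrite ipvC ipvBl// ipvC [ipv H K]ipvC. Qed.

Lemma ipv_ae G G' H H' : {ae mu, forall x, D x -> G x = G' x} ->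
  {ae mu, forall x, D x -> H x = H' x} -> ipv G H = ipv G' H'.
Proof.
move=> gg hh; rewrite !ipvE; apply: ae_eq_Rintegral => //.
by apply: filterS2 gg hh => x /= K L Dx; rewrite K// L.
Qed.

Lemma ipv_expand G H s : L2v G -> L2v H ->
  ipv (fun x => G x + s *: H x) (fun x => G x + s *: H x) =
  ipv G G + 2 * s * ipv G H + s ^+ 2 * ipv H H.
Proof.
move=> gl hl; have shl := in_L2vZ s hl.
have gshl := in_L2vD gl shl.
rewrite ipvDl// ipvDr// ipvDr// !ipvZr// !ipvZl// (ipvC H G); ring.
Qed.

Lemma ipv_le G H : L2v G -> L2v H ->
  `|ipv G H| <= Num.sqrt (ipv G G) * Num.sqrt (ipv H H).
Proof.
move=> gl hl; apply: cauchy_schwarz_sqrt; rewrite ?ipv_ge0//.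
apply: discriminant_le => [|s]; first exact: ipv_ge0.
rewrite -ipv_expand//; exact: ipv_ge0.
Qed.

Lemma L2normv_sq_ipv G : L2v G -> (L2normv mu D G ^+ 2 = (ipv G G)%:E)%E.
Proof.
move=> gl; rewrite /L2normv L2norm_sq ipvE /Rintegral -[LHS]fineK.
  by congr ((fine _)%:E); apply: eq_integral => x _; rewrite /= enorm_sq.
apply: integrable_fin_num => //.
have mG i : measurable_fun D (fun x => G x ord0 i) by exact: in_L2_measurable (gl i).
have := (in_L2v_dotv mG).1 gl; apply: eq_integrable => // x _ /=.
by rewrite enorm_sq.
Qed.

Lemma L2normv_ipv G : L2v G -> L2normv mu D G = (Num.sqrt (ipv G G))%:E.
Proof. by move=> gl; rewrite /L2normv L2normE -L2norm_sq L2normv_sq_ipv. Qed.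

Lemma ipv_eq0 G : L2v G -> ipv G G = 0 -> {ae mu, forall x, D x -> G x = 0}.
Proof.
rewrite ipvE => gl /(Rint_eq0 mD (in_L2v_aeint gl gl)) H.
have K := H _; apply: filterS (K _) => [x /= L Dx|].
  by apply: dotv_eq0; exact: L.
by apply: aeW => x _; exact: dotv_ge0.
Qed.

End vector_valued.
End square_integrable.

(** * Smooth bumps and the fundamental lemma *)

Section flat_exponential.
Context (R : realType).
Implicit Types (p : {poly R}) (x : R).

(* These functions are closed under derivation; [flat 1] is the classical
   smooth function that vanishes exactly on the half-line [x <= 0]. *)
Definition flat p x : R := if 0 < x then p.[x^-1] * expR (- x^-1) else 0.

(** The derivative of p(1/x) exp(-1/x) is q(1/x) exp(-1/x) for this polynomial q; the factor X^2
    comes from differentiating 1/x. *)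
Definition flat_step p : {poly R} := 'X^2 * (p - p^`()).

(** From exp z >= z at z = y / (n+1), raised to the power n+1. The spare factor 1/y is what makes
    [flat p] vanish linearly at 0. *)
Lemma exp_monomial_le n (y : R) : 0 < y ->
  y ^+ n * expR (- y) <= n.+1%:R ^+ n.+1 * y^-1.
Proof.
move=> y0; rewrite expRN.
have n0 : 0 < n.+1%:R :> R by rewrite ltr0n.
have H1 : y / n.+1%:R <= expR (y / n.+1%:R).
  by apply: le_trans (expR_ge1Dx _); rewrite lerDr.
have : (y / n.+1%:R) ^+ n.+1 <= expR y.
  have -> : expR y = expR (y / n.+1%:R) ^+ n.+1.
    by rewrite -expRM_natr divfK// gt_eqF.
  apply: lerXn2r => //; rewrite nnegrE ?expR_ge0//.
  by rewrite divr_ge0// ltW.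
rewrite exprMn exprVn => H.
rewrite ler_pdivrMr ?expR_gt0// mulrAC ler_pdivlMr//.
by rewrite -exprSr mulrC -ler_pdivrMr ?exprn_gt0.
Qed.

Lemma flat_le p : exists2 C, 0 <= C & forall x, `|flat p x| <= C * `|x|.
Proof.
exists (\sum_(i < size p) `|p`_i| * i.+1%:R ^+ i.+1).
  by apply: sumr_ge0 => i _; rewrite mulr_ge0// exprn_ge0.
move=> x; rewrite /flat; case: ifPn => x0; last first.
  rewrite normr0 mulr_ge0//; apply: sumr_ge0 => i _.
  by rewrite mulr_ge0// exprn_ge0.
rewrite horner_coef mulr_suml mulr_suml; apply: le_trans (ler_norm_sum _ _ _) _.
apply: ler_sum => i _; rewrite -mulrA normrM -mulrA ler_wpM2l//.
have := @exp_monomial_le i x^-1; rewrite invr_gt0 invrK => /(_ x0).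
by rewrite (gtr0_norm x0) ger0_norm// mulr_ge0 ?expR_ge0 ?exprn_ge0 ?invr_ge0 ?ltW.
Qed.

Lemma is_derive_flat p x : is_derive x 1 (flat p) (flat (flat_step p) x).
Proof.
have [x0|x0|->] := ltgtP x 0.
- apply: (@near_eq_is_derive _ _ _ (cst 0)).
    near=> y; rewrite /flat ltNge ifN// negbK ltW//; near: y; exact: lt_nbhsl.
  by rewrite /flat ltNge (ltW x0)/=; exact: is_derive_cst.
- apply: (@near_eq_is_derive _ _ _ ((horner p \o (fun y => y^-1)) * (expR \o (fun y => - y^-1)))).
    near=> y; rewrite /flat ifT//; near: y; exact: lt_nbhsr.
  have xN0 : x != 0 by rewrite gt_eqF.
  have dV : is_derive x 1 (fun y : R => y^-1) (- x ^- 2).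
    have /= := @is_deriveV _ id x 1 1 xN0 (is_derive_id _ _).
    by rewrite /GRing.scale /= mulr1.
  have dN : is_derive x 1 (fun y : R => - y^-1) (x ^- 2).
    by have := is_deriveN dV; rewrite opprK.
  have d1 := @is_derive1_comp _ (horner p) _ x _ _ (is_derive_poly p x^-1) dV.
  have d2 := @is_derive1_comp _ expR _ x _ _ (is_derive_expR _) dN.
  apply: is_derive_eq (is_deriveM d1 d2) _.
  rewrite /flat x0 /flat_step /= hornerM hornerXn hornerD hornerN /GRing.scale /=.
  rewrite exprVn; ring.
(* At 0 the difference quotient of [flat p] is [flat ('X * p)], which tends to 0 by the linear
   bound. *)
- have [C C0 HC] := flat_le ('X * p).
  have f0 q : flat q 0 = 0 by rewrite /flat ltxx.
  have H : (fun h => h^-1 *: (flat p (h + 0) - flat p 0)) @ 0^' --> (0 : R).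
    apply/cvgr0Pnorm_le => e e0.
    near=> h.
    have h0 : h != 0 by near: h; exact: nbhs_dnbhs_neq.
    rewrite f0 subr0 addr0.
    have -> : h^-1 *: flat p h = flat ('X * p) h.
      rewrite /flat; case: ifPn => // _; last by rewrite scaler0.
      by rewrite hornerM hornerX -mulrA.
    apply: le_trans (HC h) _.
    have hd : `|h| <= e / (C + 1).
      by near: h; apply: dnbhs0_le; rewrite divr_gt0// ltr_wpDl.
    have C1 : 0 < C + 1 by rewrite ltr_wpDl.
    move: hd; rewrite ler_pdivlMr// => hd; apply: le_trans hd.
    by rewrite mulrC ler_wpM2l// lerDl.
  have E : (fun h => h^-1 *: ((flat p \o shift 0) (h *: 1) - flat p 0)) =
    (fun h => h^-1 *: (flat p (h + 0) - flat p 0)).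
    by apply/funext => h /=; rewrite [h *: 1]mulr1.
  apply: DeriveDef.
    by rewrite /derivable E; apply/cvg_ex; exists 0.
  by rewrite /derive E [RHS]f0; apply: cvg_lim H.
Unshelve. all: by end_near. Qed.

Lemma flat_ge0 x : 0 <= flat 1 x.
Proof. by rewrite /flat; case: ifP => // _; rewrite hornerC mul1r expR_ge0. Qed.

Lemma flat_le1 x : flat 1 x <= 1.
Proof.
rewrite /flat; case: ifP => // x0; rewrite hornerC mul1r.
by rewrite -expR0 ler_expR oppr_le0 invr_ge0 ltW.
Qed.

Lemma flat_gt0 x : (0 < flat 1 x) = (0 < x).
Proof.
rewrite /flat; case: ifP => [_|x0]; last by rewrite ltxx.
by rewrite hornerC mul1r expR_gt0.
Qed.

Lemma continuous_flat p : continuous (flat p).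
Proof.
move=> x; apply/differentiable_continuous/derivable1_diffP.
by have [] := is_derive_flat p x.
Qed.

End flat_exponential.

Section iterated_directional_derivatives.
Context (R : realType) (V : normedModType R) (I : Type) (dir : I -> V).

(** [Ck] over an arbitrary normed space and family of directions: with a single direction it also
    covers functions of time, so the closure properties are proved once. *)
Fixpoint CkV (k : nat) (f : V -> R) : Prop :=
  match k with
  | 0 => continuous f
  | k'.+1 => continuous f /\
      forall i, (forall x, derivable f x (dir i)) /\ CkV k' ('D_(dir i) f)
  end.

Lemma CkVW k f : CkV k.+1 f -> CkV k f.
Proof.
elim: k f => [|k IH] f; first by case.
move=> [cf df]; split => // i; have [dfi Dfi] := df i; split => //.
exact: IH.
Qed.

Lemma CkV_cst k (c : R) : CkV k (fun=> c).
Proof.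
elim: k c => [|k IH] c /=; first by move=> x; exact: cvg_cst.
split; first by move=> x; exact: cvg_cst.
move=> i; split; first by move=> x; exact: derivable_cst.
rewrite (_ : 'D_(dir i) _ = fun=> 0)//.
by apply/funext => x; exact: derive_cst.
Qed.

Lemma CkVD k f g : CkV k f -> CkV k g -> CkV k (fun x => f x + g x).
Proof.
elim: k f g => [|k IH] f g /=.
  by move=> cf cg x; exact: cvgD (cf x) (cg x).
move=> [cf df] [cg dg]; split; first by move=> x; exact: cvgD (cf x) (cg x).
move=> i; have [dfi Dfi] := df i; have [dgi Dgi] := dg i; split.
  by move=> x; exact: derivableD.
rewrite (_ : 'D_(dir i) _ = fun x => 'D_(dir i) f x + 'D_(dir i) g x); first exact: IH.
by apply/funext => x; exact: deriveD.
Qed.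

Lemma CkVM k f g : CkV k f -> CkV k g -> CkV k (fun x => f x * g x).
Proof.
elim: k f g => [|k IH] f g.
  by move=> /= cf cg x; exact: cvgM (cf x) (cg x).
move=> F G; have F' := CkVW F; have G' := CkVW G.
case: F => cf df; case: G => cg dg; split; first by move=> x; exact: cvgM (cf x) (cg x).
move=> i; have [dfi Dfi] := df i; have [dgi Dgi] := dg i; split.
  by move=> x; exact: derivableM.
rewrite (_ : 'D_(dir i) _ = fun x => f x * 'D_(dir i) g x + g x * 'D_(dir i) f x).
  by apply: CkVD; exact: IH.
by apply/funext => x; exact: deriveM.
Qed.

Lemma CkVN k f : CkV k f -> CkV k (fun x => - f x).
Proof.
move=> kf; have := CkVM (CkV_cst k (-1)) kf.
by congr CkV; apply/funext => x; rewrite mulN1r.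
Qed.

Lemma CkVB k f g : CkV k f -> CkV k g -> CkV k (fun x => f x - g x).
Proof. by move=> kf kg; apply: CkVD => //; exact: CkVN. Qed.

Lemma CkVX k f m : CkV k f -> CkV k (fun x => f x ^+ m).
Proof.
move=> kf; elim: m => [|m IH].
  have := CkV_cst k 1; by congr CkV; apply/funext => x; rewrite expr0.
by have := CkVM kf IH; congr CkV; apply/funext => x; rewrite exprS.
Qed.

Lemma CkV_prod k (J : Type) (s : seq J) (f : J -> V -> R) :
  (forall j, CkV k (f j)) -> CkV k (fun x => \prod_(j <- s) f j x).
Proof.
move=> kf; elim: s => [|j s IH].
  have := CkV_cst k 1; by congr CkV; apply/funext => x; rewrite big_nil.
by have := CkVM (kf j) IH; congr CkV; apply/funext => x; rewrite big_cons.
Qed.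

(** Along each direction [l] is affine with slope [a i], so a derivation replaces [p] by
    [flat_step p] and multiplies by [a i]; the induction therefore treats all polynomials at
    once. *)
Lemma CkV_flat k p (l : V -> R) (a : I -> R) : continuous l ->
  (forall i x h, l (h *: dir i + x) = h * a i + l x) -> CkV k (flat p \o l).
Proof.
move=> cl la; elim: k p => [|k IH] p.
  by move=> x; apply: continuous_comp; [exact: cl|exact: continuous_flat].
have cfl : continuous (flat p \o l).
  by move=> x; apply: continuous_comp; [exact: cl|exact: continuous_flat].
split => // i.
have [dp Dp] : (forall y, derivable (flat p) y (a i)) /\
    (forall y, 'D_(a i) (flat p) y = a i * flat (flat_step p) y).
  split => y; have [dy Dy] := is_derive_flat p y.
    by apply: diff_derivable; exact/derivable1_diffP.
  rewrite deriveE; last exact/derivable1_diffP.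
  rewrite -Dy [in RHS]deriveE; last exact/derivable1_diffP.
  by rewrite -[in LHS](mulr1 (a i)) -[_ * 1]/(a i *: (1 : R^o)) linearZ.
have E x : (fun h => h^-1 *: (((flat p \o l) \o shift x) (h *: dir i) - (flat p \o l) x)) =
    (fun h => h^-1 *: ((flat p \o shift (l x)) (h *: a i) - flat p (l x))).
  by apply/funext => h /=; rewrite la.
split; first by move=> x; rewrite /derivable E; exact: dp.
rewrite (_ : 'D_(dir i) _ = fun x => a i * (flat (flat_step p) \o l) x).
  by apply: CkVM; [exact: CkV_cst|exact: IH].
by apply/funext => x; rewrite /derive E; exact: Dp.
Qed.

End iterated_directional_derivatives.

Lemma Ck_CkV (R : realType) n k (f : 'rV[R]_n -> R) :
  Ck k f <-> CkV (@unitv R n) k f.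
Proof. by elim: k f => [|k IH] f. Qed.

Lemma CkV_derive1n (R : realType) (f : R -> R) :
  (forall k, CkV (fun _ : unit => (1 : R^o)) k f) ->
  forall k t, derivable (derive1n k f) t 1.
Proof.
move=> sf k; elim: k f sf => [|k IH] f sf t.
  by have [_ /(_ tt)[]] := sf 1%N.
rewrite derive1Sn; apply: IH => k'; have [_ /(_ tt)[_]] := sf k'.+1.
by congr CkV; apply/funext => x; rewrite derive1E.
Qed.

Lemma compactly_supported_sub (R : realType) (V : topologicalType)
    (U K : set V) (f : V -> R) : hausdorff_space V -> compact K ->
  (forall x, f x != 0 -> K x) -> K `<=` U -> compactly_supported_in U f.
Proof.
move=> hV cK fK KU.
have clK : closed K by exact: compact_closed.
have sub : closure [set x | f x != 0] `<=` K.
  by rewrite [X in _ `<=` X](closure_id K).1//; apply: closureS => x /fK.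
split; last exact: subset_trans KU.
by apply: subclosed_compact cK sub; exact: closed_closure.
Qed.

Lemma compactly_supported_0 (R : realType) (V : topologicalType) (U : set V) :
  compactly_supported_in U (fun=> 0 : R).
Proof.
rewrite /compactly_supported_in (_ : [set x | _] = set0).
  by rewrite closure0; split => //; exact: compact0.
by apply/seteqP; split => x //=; rewrite eqxx.
Qed.

Lemma compactly_supported_mul (R : realType) (V : topologicalType) (U : set V)
    (f g : V -> R) : compactly_supported_in U f ->
  compactly_supported_in U (fun x => f x * g x).
Proof.
move=> [cf fU]; have sub : closure [set x | f x * g x != 0] `<=` closure [set x | f x != 0].
  by apply: closureS => x /=; apply: contraNneq => ->; rewrite mul0r.
split; last exact: subset_trans fU.
by apply: subclosed_compact cf sub; exact: closed_closure.
Qed.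

(** * Rational boxes and smooth approximation of open sets *)

Section boxes.
Context (R : realType) (n : nat).
Local Notation E := 'rV[R]_n.
Local Notation code := {ffun 'I_n -> rat * rat}.

(** Rational corners make the boxes countable: every open set is a countable union of them, hence
    lies in the sigma-algebra generated by the coordinates. *)
Definition box (q : code) : set E :=
  [set x | forall i, ratr (q i).1 < x ord0 i < ratr (q i).2].
Definition cbox (q : code) : set E :=
  [set x | forall i, ratr (q i).1 <= x ord0 i <= ratr (q i).2].

Lemma box_cbox q : box q `<=` cbox q.
Proof. by move=> x Hx i; have /andP[/ltW -> /ltW ->] := Hx i. Qed.

Lemma cbox_compact q : compact (cbox q).
Proof.
rewrite (_ : cbox q = [set v : E | forall i, `[ratr (q i).1, ratr (q i).2]%classic (v ord0 i)]).
  exact: (@rV_compact R n (fun i => `[ratr (q i).1, ratr (q i).2]%classic) (fun i => @segment_compact R _ _)).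
by apply/seteqP; split => x /= H i; have := H i; rewrite /= in_itv.
Qed.

Lemma open_box (U : set E) x : open U -> U x ->
  exists q, box q x /\ cbox q `<=` U.
Proof.
move=> oU Ux.
have /nbhs_ballP[e e0 eU] : nbhs x U by exact: open_nbhs_nbhs.
(* Corners within half the radius keep the closed box inside the open sup-norm ball. *)
have e02 : 0 < e / 2 by rewrite divr_gt0.
have /choice[a Ha] : forall i, exists a : rat, x ord0 i - e / 2 < ratr a < x ord0 i.
  move=> i; have [|a] := @rat_in_itvoo R (x ord0 i - e / 2) (x ord0 i).
    by rewrite ltrBlDr ltrDl.
  by rewrite in_itv /= => ?; exists a.
have /choice[b Hb] : forall i, exists b : rat, x ord0 i < ratr b < x ord0 i + e / 2.
  move=> i; have [|b] := @rat_in_itvoo R (x ord0 i) (x ord0 i + e / 2).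
    by rewrite ltrDl.
  by rewrite in_itv /= => ?; exists b.
exists [ffun i => (a i, b i)]; split.
  by move=> i; rewrite ffunE /=; have /andP[_ ->] := Ha i; have /andP[-> _] := Hb i.
move=> y Hy; apply: eU; split => // i j.
rewrite (ord1 i); have := Hy j; rewrite ffunE /= /ball /= => /andP[h1 h2].
have /andP[h3 h4] := Ha j; have /andP[h5 h6] := Hb j.
by rewrite ltr_distlC; apply/andP; split; lra.
Qed.

Lemma box_measurable q : measurable (box q).
Proof.
rewrite (_ : box q = \bigcap_(i in [set: 'I_n])
   ((fun x : E => x ord0 i : measurableTypeR R) @^-1` `]ratr (q i).1, ratr (q i).2[%classic)).
  apply: fin_bigcap_measurable => // i _.
  rewrite -[X in measurable X]setTI; apply: measurable_coord => //.
apply/seteqP; split => x /=.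
  by move=> H i _ /=; rewrite in_itv /=; exact: H.
by move=> H i; have := H i I; rewrite /= in_itv.
Qed.

Lemma open_rV_measurable (U : set E) : open U -> measurable U.
Proof.
move=> oU.
rewrite (_ : U = \bigcup_(q in [set: code]) (if `[< cbox q `<=` U >] then box q else set0)).
  apply: countable_bigcupT_measurable => // q.
  by case: asboolP => _ //; exact: box_measurable.
apply/seteqP; split => x.
  move=> Ux; have [q [bq qU]] := open_box oU Ux; exists q => //.
  by case: asboolP.
by move=> [q _]; case: asboolP => // qU /box_cbox /qU.
Qed.

Lemma continuous_rV_measurable (f : E -> R) : continuous f -> measurable_fun setT f.
Proof.
move=> /continuousP cf; apply: (measurability _ (RGenOpens.measurableE R)).
move=> _ [_ [a [b ->] <-]]; rewrite setTI; apply: open_rV_measurable.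
exact/cf/interval_open.
Qed.

Definition bump (q : code) (x : E) : R :=
  \prod_i (flat 1 (x ord0 i - ratr (q i).1) * flat 1 (ratr (q i).2 - x ord0 i)).

Lemma bump_itv q x : 0 <= bump q x <= 1.
Proof.
apply/andP; split; first by apply: prodr_ge0 => i _; rewrite mulr_ge0 ?flat_ge0.
apply: prodr_ile1 => i _; rewrite mulr_ge0 ?flat_ge0//=.
by rewrite mulr_ile1 ?flat_ge0 ?flat_le1.
Qed.

Lemma bump_gt0 q x : box q x -> 0 < bump q x.
Proof.
move=> bx; apply: prodr_gt0 => i _.
by have /andP[h1 h2] := bx i; rewrite mulr_gt0 ?flat_gt0 ?subr_gt0.
Qed.

Lemma bump_out q x : ~ box q x -> bump q x = 0.
Proof.
move=> bx; apply/eqP; rewrite eq_le; have /andP[-> _] := bump_itv q x.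
rewrite andbT leNgt; apply/negP => b0; apply: bx => i.
have := b0; rewrite /bump (bigD1 i)//= => H.
have nz : flat 1 (x ord0 i - ratr (q i).1) * flat 1 (ratr (q i).2 - x ord0 i) != 0.
  by apply: contraTneq H => ->; rewrite mul0r ltxx.
move: nz; rewrite mulf_eq0 negb_or => /andP[].
by rewrite !neq_lt !ltNge !flat_ge0 /= -!ltNge !flat_gt0 !subr_gt0 => -> ->.
Qed.

Lemma smooth_cst (c : R) : smooth (fun=> c : R) (n := n).
Proof. by move=> k; apply/Ck_CkV; exact: CkV_cst. Qed.

Lemma smoothD (f g : E -> R) : smooth f -> smooth g -> smooth (fun x => f x + g x).
Proof.
by move=> sf sg k; apply/Ck_CkV; apply: CkVD; apply/Ck_CkV; [exact: sf|exact: sg].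
Qed.

Lemma smoothM (f g : E -> R) : smooth f -> smooth g -> smooth (fun x => f x * g x).
Proof.
by move=> sf sg k; apply/Ck_CkV; apply: CkVM; apply/Ck_CkV; [exact: sf|exact: sg].
Qed.

Lemma smoothB (f g : E -> R) : smooth f -> smooth g -> smooth (fun x => f x - g x).
Proof.
by move=> sf sg k; apply/Ck_CkV; apply: CkVB; apply/Ck_CkV; [exact: sf|exact: sg].
Qed.

Lemma smooth_bump q : smooth (bump q).
Proof.
move=> k; apply/Ck_CkV; apply: CkV_prod => i.
have cc : continuous (fun x : E => x ord0 i) by move=> x; exact: coord_continuous.
apply: CkVM.
- apply: (@CkV_flat _ _ _ _ _ _ (fun x : E => x ord0 i - ratr (q i).1) (fun j => (unitv R j) ord0 i)).
    by move=> x; exact: (@cvgB R R E (nbhs (x : E)) _ _ _ _ _ (cc x) (cvg_cst _)).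
  by move=> j x h; rewrite !mxE addrA.
- apply: (@CkV_flat _ _ _ _ _ _ (fun x : E => ratr (q i).2 - x ord0 i) (fun j => - (unitv R j) ord0 i)).
    by move=> x; exact: (@cvgB R R E (nbhs (x : E)) _ _ _ _ _ (cvg_cst _) (cc x)).
  by move=> j x h; rewrite !mxE; ring.
Qed.

Lemma smooth_continuous (f : E -> R) : smooth f -> continuous f.
Proof. by move=> /(_ 0%N). Qed.

(** A smooth substitute for the indicator of the union of the boxes: it vanishes off them, and where
    some bump is positive the power k sends the product to 0. *)
Definition approx_open (s : seq code) (k : nat) (x : E) : R :=
  1 - \prod_(q <- s) (1 - bump q x) ^+ k.

Lemma approx_open_itv s k x : 0 <= approx_open s k x <= 1.
Proof.
have b q : 0 <= (1 - bump q x) ^+ k <= 1.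
  have /andP[h1 h2] := bump_itv q x.
  by rewrite exprn_ge0 ?exprn_ile1 ?subr_ge0// lerBlDr lerDl.
rewrite /approx_open subr_ge0 lerBlDr lerDl prodr_ge0 ?prodr_ile1// => q _.
by have /andP[] := b q.
Qed.

Lemma smooth_approx_open s k : smooth (approx_open s k).
Proof.
apply: smoothB; first exact: smooth_cst.
move=> k'; apply/Ck_CkV; apply: CkV_prod => q; apply: CkVX; apply: CkVB.
  exact: CkV_cst.
by apply/Ck_CkV; exact: smooth_bump.
Qed.

Lemma approx_open_out s k x : (forall q, q \in s -> ~ box q x) -> approx_open s k x = 0.
Proof.
move=> H; rewrite /approx_open big_seq big1 ?subrr// => q qs.
by rewrite bump_out ?subr0 ?expr1n//; exact: H.
Qed.

Lemma bigcup_cbox_compact (s : seq code) : compact (\bigcup_(q in [set` s]) cbox q).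
Proof.
elim: s => [|q s IH].
  by rewrite set_nil bigcup_set0; exact: compact0.
rewrite (_ : \bigcup_(r in _) _ = cbox q `|` \bigcup_(r in [set` s]) cbox r).
  by apply: compactU => //; exact: cbox_compact.
apply/seteqP; split=> x.
  move=> [r] /=; rewrite inE => /orP[/eqP->|rs] Hx; first by left.
  by right; exists r.
move=> [Hx|[r /= rs Hx]]; first by exists q; rewrite //= mem_head.
by exists r; rewrite //= inE rs orbT.
Qed.

Lemma test_approx_open (Om : set E) s k :
  (forall q, q \in s -> cbox q `<=` Om) -> test_fun Om (approx_open s k).
Proof.
move=> sO; split; first exact: smooth_approx_open.
apply: (@compactly_supported_sub _ _ _ (\bigcup_(q in [set` s]) cbox q)).
- exact: norm_hausdorff.
- exact: bigcup_cbox_compact.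
- move=> x; apply: contraNP => H; apply/eqP/approx_open_out => q qs bq.
  by apply: H; exists q => //; exact: box_cbox.
- by move=> x [q /= qs]; exact: sO.
Qed.

Definition exhaust (U : set E) (k : nat) : seq code :=
  [seq q <- pmap unpickle (iota 0 k) | `[< cbox q `<=` U >]].

Lemma exhaust_sub U k q : q \in exhaust U k -> cbox q `<=` U.
Proof. by rewrite mem_filter => /andP[/asboolP]. Qed.

(** A single index [k] is both the number of codes inspected and the exponent. Once the code of a
    box around x has been reached, the growing exponent does the rest. *)
Lemma cvg_approx_open (U : set E) x : open U ->
  (fun k => approx_open (exhaust U k) k x) @ \oo --> (\1_U x : R).
Proof.
move=> oU; rewrite indicE; case: (boolP (x \in U)); last first.
  rewrite notin_setE => nU; apply: cvg_near_cst; apply: nearW => k.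
  by rewrite approx_open_out// => q /exhaust_sub qU /box_cbox /qU.
rewrite inE => Ux; have [q [bq qU]] := open_box oU Ux.
have b0 := bump_gt0 bq; have /andP[_ b1] := bump_itv q x.
have le k : (pickle q < k)%N ->
    \prod_(r <- exhaust U k) (1 - bump r x) ^+ k <= (1 - bump q x) ^+ k.
  move=> qk; have qs : q \in exhaust U k.
    rewrite mem_filter; apply/andP; split; first exact/asboolP.
    by rewrite mem_pmap; apply/mapP; exists (pickle q); rewrite ?pickleK// mem_iota.
  rewrite (big_rem q)//= -[leRHS]mulr1 ler_wpM2l ?exprn_ge0 ?subr_ge0//.
  apply: prodr_ile1 => r _; have /andP[h1 h2] := bump_itv r x.
  by rewrite exprn_ge0 ?exprn_ile1 ?subr_ge0// lerBlDr lerDl.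
have g0 : (fun k => (1 - bump q x) ^+ k) @ \oo --> (0 : R).
  by apply: cvg_expr; rewrite ger0_norm ?subr_ge0// ltrBlDr ltrDl.
rewrite /= -[X in _ --> X]subr0; apply: cvgB; first exact: cvg_cst.
apply: squeeze_cvgr g0; last exact: cvg_cst.
near=> k; apply/andP; split; last by apply: le; near: k; exact: nbhs_infty_gt.
by apply: prodr_ge0 => r _; have /andP[_ ?] := bump_itv r x; rewrite exprn_ge0 ?subr_ge0.
Unshelve. all: by end_near. Qed.

End boxes.

Lemma ae_forall_count d (X : measurableType d) (R : realType) (mu : {measure set X -> \bar R})
    (C : countType) (P : C -> X -> Prop) :
  (forall c, {ae mu, forall x, P c x}) -> {ae mu, forall x, forall c, P c x}.
Proof.
move=> H; have L := @ae_foralln _ _ _ mu (fun k x => forall c : C, pickle c = k -> P c x).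
have : {ae mu, forall x (k : nat) (c : C), pickle c = k -> P c x}.
  apply: L => k; have [[c ck]|nk] := pselect (exists c : C, pickle c = k).
    apply: filterS (H c) => x Px c' ck'; rewrite (_ : c' = c)//.
    by apply: (pcan_inj pickleK); rewrite ck ck'.
  by apply: aeW => x c ck; case: nk; exists c.
by apply: filterS => x K c; exact: (K (pickle c)).
Qed.

Lemma norm_diff_le (R : realDomainType) (A B a b : R) : 0 <= A <= 1 -> 0 <= b <= 1 ->
  `|A * (1 - B) - a * (1 - b)| <= `|A - a| + `|B - b|.
Proof.
move=> /andP[A0 A1] /andP[b0 b1].
have -> : A * (1 - B) - a * (1 - b) = (A - a) * (1 - b) + A * (b - B) by ring.
apply: le_trans (ler_normD _ _) _; rewrite !normrM lerD//.
  by rewrite ler_piMr// ger0_norm ?subr_ge0// lerBlDr lerDl.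
by rewrite distrC ler_piMl// ger0_norm.
Qed.

(** * A countable family of test functions and the fundamental lemma *)

Section test_functions.
Context (R : realType) (n : nat).
Local Notation E := 'rV[R]_n.
Variable Om : set E.
Hypothesis oOm : open Om.

Lemma test_fun0 : test_fun Om (fun=> 0).
Proof. by split; [exact: smooth_cst|exact: compactly_supported_0]. Qed.

Lemma test_funM f g : test_fun Om f -> smooth g -> test_fun Om (fun x => f x * g x).
Proof.
by move=> [sf cf] sg; split; [exact: smoothM|exact: compactly_supported_mul].
Qed.

Lemma test_fun_out f x : test_fun Om f -> ~ Om x -> f x = 0.
Proof.
move=> [_ [_ fO]] nOx; apply: contrapT => /eqP fx; apply: nOx; apply: fO.
exact: subset_closure.
Qed.

Lemma test_fun_measurable f : test_fun Om f -> measurable_fun setT f.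
Proof. by move=> [sf _]; apply: continuous_rV_measurable; exact: smooth_continuous. Qed.

Lemma measurable_Om : measurable Om.
Proof. exact: open_rV_measurable. Qed.

(* A countable family of test functions, closed under f, g |-> f (1 - g) and
   rich enough to approximate the indicator of every Borel subset of [Om]. *)
Definition tcode : countType := GenTree.tree (seq {ffun 'I_n -> rat * rat} * nat).

Fixpoint test_of (t : GenTree.tree (seq {ffun 'I_n -> rat * rat} * nat)) : E -> R :=
  match t with
  | GenTree.Leaf (s, k) => approx_open [seq q <- s | `[< cbox q `<=` Om >]] k
  | GenTree.Node _ [:: t1; t2] => fun x => test_of t1 x * (1 - test_of t2 x)
  | _ => fun=> 0
  end.

(** Trees nest a list of subtrees, so an induction principle adapted to binary nodes is built by
    hand. The disjunction lets nodes with another number of children, which code the zero function,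
    be settled without induction. *)
Lemma tcode_ind (P : tcode -> Prop) :
  (forall s k, P (GenTree.Leaf (s, k))) ->
  (forall m l, P (GenTree.Node m l) \/
    exists t1 t2, l = [:: t1; t2] /\ (P t1 -> P t2 -> P (GenTree.Node m l))) ->
  forall t, P t.
Proof.
move=> H0 H1.
have H2 m a b : P a -> P b -> P (GenTree.Node m [:: a; b]).
  by have [//|[t1 [t2 [[<- <-] H]]]] := H1 m [:: a; b].
have H3 m l : size l != 2 -> P (GenTree.Node m l).
  by have [//|[t1 [t2 [-> _]]]] := H1 m l.
fix IH 1; case=> [[s k]|m [|a [|b [|c l]]]].
(* Clearing [IH] keeps automation from applying it to the tree itself, which the guard condition
   would reject. *)
- by clear IH; exact: H0.
- by clear IH; exact: H3.
- by clear IH; exact: H3.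
- exact (H2 m a b (IH a) (IH b)).
- by clear IH; exact: H3.
Qed.

Lemma test_of_itv t x : 0 <= test_of t x <= 1.
Proof.
elim/tcode_ind: t => [s k|m l]; first exact: approx_open_itv.
case: l => [|a [|b [|c l]]]; try by left; rewrite /= lexx ler01.
right; exists a, b; split => //= /andP[a0 a1] /andP[b0 b1].
by rewrite mulr_ge0 ?subr_ge0//= mulr_ile1 ?subr_ge0// lerBlDr lerDl.
Qed.

Lemma test_of_test t : test_fun Om (test_of t).
Proof.
elim/tcode_ind: t => [s k|m l].
  by apply: test_approx_open => q; rewrite mem_filter => /andP[/asboolP].
case: l => [|a [|b [|c l]]]; try by left; exact: test_fun0.
right; exists a, b; split => //= ta tb.
by apply: test_funM => //; apply: smoothB; [exact: smooth_cst|by case: tb].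
Qed.

Lemma test_of_measurable t D : measurable_fun D (test_of t).
Proof. exact: measurable_funS (test_fun_measurable (test_of_test t)). Qed.

Section approximation.
Variables (mu : {measure set E -> \bar R}) (h : E -> R).
Hypothesis hi : mu.-integrable Om (EFin \o h).

Let mOm := measurable_Om.

(** The weight |h| comes from the function to be tested, so that approximating an indicator in this
    sense approximates its integral against [h]. *)
Definition approximable (A : set E) := measurable A /\
  forall e, 0 < e -> exists t, \int[mu]_(x in Om) (`|h x| * `|\1_A x - test_of t x|) < e.

Let habs : mu.-integrable Om (EFin \o (fun x => `|h x|)).
Proof. exact: integrable_norm. Qed.

Let wint (k : E -> R) : measurable_fun Om k -> (forall x, Om x -> `|k x| <= 1) ->
  aeint mu Om (fun x => `|h x| * k x).
Proof.
move=> mk k1; apply: aeint_dominated (integrable_aeint habs) _ => //.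
  apply: measurable_aemeas; apply: measurable_funM => //.
  by apply/measurable_EFinP; exact: measurable_int habs.
by apply: aeW => x Ox; rewrite normrM normr_id ler_piMr// k1.
Qed.

Let mdiff A t : measurable A -> measurable_fun Om (fun x => `|\1_A x - test_of t x| : R).
Proof.
move=> mA; apply: measurableT_comp => //; apply: measurable_funB.
  exact: measurable_indic.
exact: test_of_measurable.
Qed.

Let indic_itv (A : set E) x : 0 <= (\1_A x : R) <= 1.
Proof. by rewrite indicE; case: (_ \in _); rewrite ?lexx ler01. Qed.

Let wdiff A t : measurable A -> aeint mu Om (fun x => `|h x| * `|\1_A x - test_of t x|).
Proof.
move=> mA; apply: wint; first exact: mdiff.
move=> x _; rewrite normr_id ler_norml.
have /andP[? ?] := indic_itv A x; have /andP[? ?] := test_of_itv t x; lra.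
Qed.

Lemma approximable_open U : open U -> approximable U.
Proof.
move=> oU; split; first exact: open_rV_measurable.
have oUO : open (U `&` Om) by exact: openI.
have mU : measurable U by exact: open_rV_measurable.
pose f k : tcode := GenTree.Leaf (exhaust (U `&` Om) k, k).
have fE k : test_of (f k) = approx_open (exhaust (U `&` Om) k) k.
  congr approx_open; apply/all_filterP/allP => q /exhaust_sub qU; apply/asboolP.
  by apply: subset_trans qU _ => x [].
have [] := @dominated_cvg_Rint _ _ _ mu Om mOm
    (fun k x => `|h x| * `|\1_U x - test_of (f k) x|) (fun=> 0) (fun x => `|h x|).
- by move=> k; apply: aeint_aemeas; exact: wdiff.
- exact: integrable_aeint.
- move=> k; apply: aeW => x Ox; rewrite normrM normr_id ler_piMr// normr_id ler_norml.
  by have /andP[? ?] := indic_itv U x; have /andP[? ?] := test_of_itv (f k) x; lra.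
- apply: aeW => x Ox; rewrite -[X in _ --> X](mulr0 `|h x|); apply: cvgMr.
  rewrite -(@normr0 _ R) -(subrr (\1_U x)); apply: cvg_norm; apply: cvgB; first exact: cvg_cst.
  under eq_fun do rewrite fE.
  rewrite (_ : \1_U x = \1_(U `&` Om) x); first exact: cvg_approx_open.
  by rewrite !indicE in_setI [X in _ && X]mem_set ?andbT.
move=> _; rewrite Rint0// => /cvgrPdist_lt H e e0.
have [k _ /(_ k (leqnn k))] := H e e0.
rewrite sub0r normrN => H'; exists (f k); apply: le_lt_trans H'; exact: ler_norm.
Qed.

Lemma approximableT : approximable setT.
Proof. by apply: approximable_open; exact: openT. Qed.

Lemma approximableD A B : approximable A -> approximable B -> approximable (A `\` B).
Proof.
move=> [mA hA] [mB hB]; split; first exact: measurableD.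
move=> e e0; have e2 : 0 < e / 2 by rewrite divr_gt0.
have [t ht] := hA _ e2; have [s hs] := hB _ e2.
(* This node codes f (1 - g), the counterpart of the indicator of a set difference. *)
exists (GenTree.Node 0 [:: t; s]).
apply: (@le_lt_trans _ _ (\int[mu]_(x in Om) (`|h x| * `|\1_A x - test_of t x| +
  `|h x| * `|\1_B x - test_of s x|))).
  apply: le_Rint => //.
  - by apply: wdiff; exact: measurableD.
  - by apply: aeintD => //; exact: wdiff.
  - apply: aeW => x Ox; rewrite -mulrDr ler_wpM2l//=.
    have -> : \1_(A `\` B) x = \1_A x * (1 - \1_B x) :> R.
      rewrite !indicE in_setD; case: (x \in A); case: (x \in B);
        by rewrite ?subrr ?subr0 ?mulr1 ?mulr0 ?mul0r.
    by apply: norm_diff_le; [exact: indic_itv|exact: test_of_itv].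
by rewrite RintD//; try exact: wdiff; lra.
Qed.

Lemma approximableC A : approximable A -> approximable (~` A).
Proof. by move=> hA; rewrite -setTD; apply: approximableD => //; exact: approximableT. Qed.

Lemma approximableU A B : approximable A -> approximable B -> approximable (A `|` B).
Proof.
move=> hA hB; rewrite -[_ `|` _]setCK setCU; apply: approximableC.
by rewrite -setDE; apply: approximableD => //; exact: approximableC.
Qed.

(** Finite unions are obtained from differences and complements; dominated convergence passes to the
    countable union, with half of [e] spent on each step. *)
Lemma approximable_bigcup (F : nat -> set E) :
  (forall k, approximable (F k)) -> approximable (\bigcup_k F k).
Proof.
move=> hF.
have mU : measurable (\bigcup_k F k) by apply: bigcupT_measurable => k; have [] := hF k.
split => // e e0.
pose G k := \big[setU/set0]_(i < k) F i.
have hG k : approximable (G k).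
  elim: k => [|k IH]; last by rewrite /G big_ord_recr; exact: approximableU.
  by rewrite /G big_ord0 -(setDv setT); apply: approximableD; exact: approximableT.
have mG k : measurable (G k) by have [] := hG k.
have e2 : 0 < e / 2 by rewrite divr_gt0.
have wd k : aeint mu Om (fun x => `|h x| * `|\1_(\bigcup_k F k) x - \1_(G k) x|).
  apply: wint.
    apply: measurableT_comp => //; apply: measurable_funB; exact: measurable_indic.
  move=> x _; rewrite normr_id ler_norml.
  have /andP[? ?] := indic_itv (\bigcup_k F k) x.
  have /andP[? ?] := indic_itv (G k) x; lra.
have [] := @dominated_cvg_Rint _ _ _ mu Om mOm
    (fun k x => `|h x| * `|\1_(\bigcup_k F k) x - \1_(G k) x|) (fun=> 0) (fun x => `|h x|).
- by move=> k; apply: aeint_aemeas.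
- exact: integrable_aeint.
- move=> k; apply: aeW => x Ox; rewrite normrM normr_id ler_piMr// normr_id ler_norml.
  have /andP[? ?] := indic_itv (\bigcup_k F k) x.
  have /andP[? ?] := indic_itv (G k) x; lra.
- apply: aeW => x Ox; rewrite -[X in _ --> X](mulr0 `|h x|); apply: cvgMr.
  rewrite -(@normr0 _ R) -(subrr (\1_(\bigcup_k F k) x)); apply: cvg_norm; apply: cvgB; first exact: cvg_cst.
  case: (pselect ((\bigcup_k F k) x)) => [[i _ Fix]|nF].
    apply: cvg_near_cst; near=> k.
    have Gx : G k x.
      by rewrite /G -bigcup_mkord; exists i => //=; near: k; exact: nbhs_infty_gt.
    have Ux : (\bigcup_k F k) x by exists i.
    by rewrite !indicE (mem_set Gx) (mem_set Ux).
  apply: cvg_near_cst; apply: nearW => k.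
  have nG : ~ G k x by rewrite /G -bigcup_mkord => -[i _ Fi]; apply: nF; exists i.
  by rewrite !indicE (memNset nG) (memNset nF).
move=> _; rewrite Rint0// => /cvgrPdist_lt H.
have [k _ /(_ k (leqnn k))] := H _ e2.
rewrite sub0r normrN => /(le_lt_trans (ler_norm _)) Hk.
have [_ /(_ _ e2)[t ht]] := hG k; exists t.
apply: (@le_lt_trans _ _ (\int[mu]_(x in Om) (`|h x| * `|\1_(\bigcup_k F k) x - \1_(G k) x| +
  `|h x| * `|\1_(G k) x - test_of t x|))).
  apply: le_Rint => //.
  - exact: wdiff.
  - by apply: aeintD => //; exact: wdiff.
  - by apply: aeW => x Ox; rewrite -mulrDr ler_wpM2l//=; exact: ler_distD.
by rewrite RintD//; [lra|exact: wdiff].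
Unshelve. all: by end_near. Qed.

(** Approximable sets form a sigma-algebra containing the open sets, hence the preimages of open
    half-lines under the coordinates, which generate the Borel sets. *)
Lemma measurable_approximable A : measurable A -> approximable A.
Proof.
have sigC : sigma_algebra setT approximable.
  split.
  - by rewrite -(setDv setT); apply: approximableD; exact: approximableT.
  - by move=> B hB; rewrite setTD; exact: approximableC.
  - exact: approximable_bigcup.
move: A; apply: smallest_sub => //.
rewrite -bigcup_seq; apply: bigcup_sub => i _ _ [B mB <-]; rewrite setTI.
rewrite /= in mB; move: B mB.
suff : @measurable _ (measurableTypeR R) `<=`
    [set B | approximable ((fun x : E => x ord0 i) @^-1` B)] by [].
rewrite [X in X `<=` _](_ : _ = (@RGenOInfty.G R).-sigma.-measurable); last exact: RGenOInfty.measurableE.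
apply: smallest_sub.
  split => /=.
  - by rewrite preimage_set0; case: sigC.
  - by move=> B hB; rewrite setTD preimage_setC; exact: approximableC.
  - by move=> F hF; rewrite preimage_bigcup; exact: approximable_bigcup.
move=> _ [x ->] /=; apply: approximable_open.
have cc : continuous (fun x : E => x ord0 i) by move=> y; exact: coord_continuous.
by move/continuousP : cc; apply; exact: interval_open.
Qed.

End approximation.

(** Approximating the indicator of {g > 0} bounds the integral of the positive part of [g] by 0. The
    tests range over the countable family alone because, in the application, each of them excludes a
    null set of times. *)
Lemma ae_le0_of_tests (mu : {measure set E -> \bar R}) (g : E -> R) :
  mu.-integrable Om (EFin \o g) ->
  (forall t : tcode, \int[mu]_(x in Om) (g x * test_of t x) <= 0) ->
  {ae mu, forall x, Om x -> g x <= 0}.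
Proof.
move=> gi gt; have mOm := measurable_Om.
have mg : measurable_fun Om g by apply/measurable_EFinP; exact: measurable_int gi.
have mA : measurable (Om `&` [set x | 0 < g x]).
  have := measurable_fun_ltr (@measurable_cst _ _ _ _ Om (0 : R)) mg => /(_ mOm [set true]).
  by move=> H; have := H I; congr measurable; apply/seteqP; split=> x.
pose A := Om `&` [set x | 0 < g x].
have [_ hA] := measurable_approximable gi mA.
have gA : aeint mu Om (fun x => g x * \1_A x).
  apply: aeint_dominated (aeint_abs (integrable_aeint gi)) _ => //.
    apply: measurable_aemeas; apply: measurable_funM => //; exact: measurable_indic.
  apply: aeW => x Ox; rewrite normrM ler_piMr// indicE.
  by case: (_ \in _); rewrite ?normr1 ?normr0.
have gtA t : aeint mu Om (fun x => g x * test_of t x).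
  apply: aeint_dominated (aeint_abs (integrable_aeint gi)) _ => //.
    apply: measurable_aemeas; apply: measurable_funM => //; exact: test_of_measurable.
  apply: aeW => x Ox; rewrite normrM ler_piMr//.
  by have /andP[? ?] := test_of_itv t x; rewrite ger0_norm.
have gtD t : aeint mu Om (fun x => `|g x| * `|\1_A x - test_of t x|).
  apply: aeint_ae (aeint_abs (aeintB mOm gA (gtA t))).
  by apply: aeW => x _; rewrite -mulrBr normrM.
have A0 : \int[mu]_(x in Om) (g x * \1_A x) = 0.
  apply/eqP; rewrite eq_le; apply/andP; split; last first.
    apply: Rint_ge0; apply: aeW => x Ox; rewrite indicE.
    case: (boolP (x \in A)) => [|_]; last by rewrite mulr0.
    by rewrite inE mulr1 => -[_ /ltW].
  apply/ler_addgt0Pl => e e0; rewrite addr0; have [t /ltW ht] := hA _ e0.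
  apply: le_trans ht; rewrite -[leLHS]subr0; apply: (@le_trans _ _
    (\int[mu]_(x in Om) (g x * \1_A x) - \int[mu]_(x in Om) (g x * test_of t x))).
    by rewrite lerB.
  rewrite -RintB//; apply: le_Rint => //; first exact: aeintB.
  by apply: aeW => x _; rewrite -mulrBr -normrM ler_norm.
have := Rint_eq0 mOm gA _ A0.
have ge0 : {ae mu, forall x, Om x -> 0 <= g x * \1_A x}.
  apply: aeW => x Ox; rewrite indicE; case: (boolP (x \in A)) => [|_]; last by rewrite mulr0.
  by rewrite inE mulr1 => -[_ /ltW].
move=> /(_ ge0); apply: filterS => x /= H Ox; rewrite leNgt; apply/negP => g0.
have := H Ox; rewrite indicE mem_set ?mulr1; last by split.
by move=> gx; rewrite gx ltxx in g0.
Qed.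

Lemma ae_eq0_of_tests (mu : {measure set E -> \bar R}) (g : E -> R) :
  mu.-integrable Om (EFin \o g) ->
  (forall psi, test_fun Om psi -> \int[mu]_(x in Om) (g x * psi x) = 0) ->
  {ae mu, forall x, Om x -> g x = 0}.
Proof.
move=> gi gt; have mOm := measurable_Om.
have H1 : {ae mu, forall x, Om x -> g x <= 0}.
  by apply: ae_le0_of_tests gi _ => t; rewrite gt//; exact: test_of_test.
have gN : mu.-integrable Om (EFin \o (fun x => - g x)).
  have := integrableZl mOm (-1) gi; apply: eq_integrable => // x _ /=.
  by rewrite -EFinM mulN1r.
have H2 : {ae mu, forall x, Om x -> - g x <= 0}.
  apply: ae_le0_of_tests gN _ => t.
  under eq_Rintegral do rewrite mulNr.
  rewrite RintN//; first by rewrite gt ?oppr0//; exact: test_of_test.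
  apply: aeint_dominated (aeint_abs (integrable_aeint gi)) _ => //.
    apply: measurable_aemeas; apply: measurable_funM => //; last exact: test_of_measurable.
    by apply/measurable_EFinP; exact: measurable_int gi.
  apply: aeW => x Ox; rewrite normrM ler_piMr//.
  by have /andP[? ?] := test_of_itv t x; rewrite ger0_norm.
apply: filterS2 H1 H2 => x /= a b Ox; apply/eqP; rewrite eq_le a//=.
by rewrite -oppr_le0 b.
Qed.

End test_functions.

Lemma Rint_FTC2 (R : realType) (g : R -> R) (a b : R) : a <= b ->
  (forall x, derivable g x 1) -> continuous (derive1 g) ->
  \int[@lebesgue_measure R]_(x in `[a, b]) derive1 g x = g b - g a.
Proof.
rewrite le_eqVlt => /orP[/eqP <- _ _|ab dg cg].
  by rewrite set_itv1 Rintegral_set1 subrr.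
rewrite /Rintegral (@continuous_FTC2 _ (derive1 g) g)//.
- exact: continuous_subspaceT.
- have cg' : continuous g by move=> x; exact/differentiable_continuous/derivable1_diffP.
  split => //.
    by apply: cvg_at_right_filter; exact: cg'.
  by apply: cvg_at_left_filter; exact: cg'.
Qed.

(** * Integration by parts *)

Section lebesgue_rV.
Context (R : realType).

Definition sup_ball n (M : R) : set 'rV[R]_n := [set x | forall i, `|x ord0 i| <= M].
Arguments sup_ball : clear implicits.

Lemma sup_ball_measurable n M : measurable (sup_ball n M).
Proof.
rewrite (_ : sup_ball n M = \bigcap_(i in [set: 'I_n])
   ((fun x : 'rV[R]_n => x ord0 i : measurableTypeR R) @^-1` `[- M, M]%classic)).
  apply: fin_bigcap_measurable => // i _.
  rewrite -[X in measurable X]setTI; apply: measurable_coord => //.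
apply/seteqP; split => x /=.
  by move=> H i _ /=; rewrite in_itv /= -ler_norml; exact: H.
by move=> H i; have := H i I; rewrite /= in_itv /= -ler_norml.
Qed.

Lemma sup_ball_compact n M : compact (sup_ball n M).
Proof.
rewrite (_ : sup_ball n M = [set v : 'rV[R]_n | forall i, `[- M, M]%classic (v ord0 i)]).
  exact: (@rV_compact R n (fun i => `[- M, M]%classic) (fun i => @segment_compact R _ _)).
by apply/seteqP; split => x /= H i; have := H i; rewrite /= in_itv /= -ler_norml.
Qed.

Lemma leb_sup_ball n M : (leb R n (sup_ball n M) < +oo)%E.
Proof.
elim: n => [|n IH] /=.
  by rewrite diracE; case: (_ \in _); rewrite ltry.
rewrite /leb_step /pushforward.
rewrite (_ : _ @^-1` _ = `[- M, M]%classic `*` sup_ball n M).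
  rewrite product_measure1E//; last exact: sup_ball_measurable.
  have mI : (@lebesgue_measure R ([set` `[- M, M]%R] : set R) < +oo)%E.
    by rewrite lebesgue_measure_itv /=; case: ifP => _; rewrite -?EFinB ltry.
  by rewrite lte_mul_pinfty// ge0_fin_numE.
apply/seteqP; split => -[a x] /=.
  move=> H; split.
    by rewrite /= in_itv /= -ler_norml; have := H ord0; rewrite mxE unlift_none.
  by move=> i; have := H (lift ord0 i); rewrite mxE liftK.
rewrite in_itv /= -ler_norml => -[aM xM] i; rewrite mxE.
by case: (unliftP ord0 i) => [k|] _ //=.
Qed.

Lemma bounded_sup_ball n (Om : set 'rV[R]_n) : bounded_set Om ->
  exists M, Om `<=` sup_ball n M.
Proof.
move=> [M [_ HM]]; exists (M + 1) => x Ox i.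
have := HM (M + 1); rewrite ltrDl => /(_ ltr01 x Ox); apply: le_trans.
rewrite /Num.Def.normr /= mx_normrE.
by apply: (@le_bigmax _ _ _ _ (fun ij : 'I_1 * 'I_n => `|x ij.1 ij.2|) (ord0, i)).
Qed.

Lemma leb_bounded n (Om : set 'rV[R]_n) : measurable Om -> bounded_set Om ->
  (leb R n Om < +oo)%E.
Proof.
move=> mO /bounded_sup_ball[M OM].
apply: le_lt_trans (leb_sup_ball n M); apply: le_measure => //; rewrite inE//.
exact: sup_ball_measurable.
Qed.

Lemma integrable_bounded_support n (f : 'rV[R]_n -> R) (M : R) : continuous f ->
  (forall x, ~ sup_ball n M x -> f x = 0) -> (leb R n).-integrable setT (EFin \o f).
Proof.
move=> cf f0; have mB := @sup_ball_measurable n M.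
have -> : EFin \o f = (EFin \o f) \_ (sup_ball n M).
  apply/funext => x; rewrite /patch; case: ifPn => //.
  by rewrite notin_setE /= => /f0 ->.
apply/(integrable_mkcond _ mB); apply: measurable_bounded_integrable => //.
- exact: leb_sup_ball.
- exact: measurable_funS (continuous_rV_measurable cf).
have cB := @sup_ball_compact n M.
have /compact_bounded : compact (f @` sup_ball n M).
  by apply: continuous_compact => //; exact: continuous_subspaceT.
move=> [K [Kr HK]]; exists K; split => // L KL x Bx.
by apply: (HK L KL); exists x.
Qed.

Section fubini_step.
Variable n : nat.
Local Notation lam := (@lebesgue_measure R).

Lemma rV_cons_add0 (h a : R) (y : 'rV[R]_n) :
  rV_cons (h + a, y) = h *: unitv R ord0 + rV_cons (a, y).
Proof.
apply/rowP => j; rewrite !mxE /=; case: (unliftP ord0 j) => [k|] -> /=.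
  by rewrite mulr0 add0r.
by rewrite mulr1.
Qed.

Lemma rV_cons_addS (h a : R) (y : 'rV[R]_n) j :
  rV_cons (a, h *: unitv R j + y) = h *: unitv R (lift ord0 j) + rV_cons (a, y).
Proof.
apply/rowP => i; rewrite !mxE /=; case: (unliftP ord0 i) => [k|] -> /=.
  by rewrite !mxE /= (inj_eq lift_inj).
by rewrite mulr0 add0r.
Qed.

Lemma continuous_rV_consl (y : 'rV[R]_n) : continuous (fun a : R => rV_cons (a, y)).
Proof.
move=> a; apply/cvg_ballP => e e0.
near=> b; split => // i j; rewrite !mxE.
case: (unlift ord0 j) => [k|] /=; first exact: ballxx.
by near: b; exact: (@near_ball R R a e e0).
Unshelve. all: by end_near. Qed.

Lemma continuous_rV_consr (a : R) : continuous (fun y : 'rV[R]_n => rV_cons (a, y)).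
Proof.
move=> y A /nbhs_ballP[e e0 eA]; apply/nbhs_ballP; exists e => // z [_ yz].
apply: eA; split => // i j; rewrite !mxE.
by case: (unlift ord0 j) => [k|] /=; [exact: yz|exact: ballxx].
Qed.

Lemma integrable_rV_cons (f : 'rV[R]_n.+1 -> R) :
  (leb R n.+1).-integrable setT (EFin \o f) ->
  (lam \x leb R n)%E.-integrable setT (EFin \o f \o @rV_cons R n).
Proof.
move=> /integrableP[mf fi]; apply/integrableP; split.
  by apply: measurableT_comp => //; exact: measurable_rV_cons.
apply: le_lt_trans fi; rewrite le_eqVlt; apply/orP; left; apply/eqP.
rewrite [in RHS]/= /leb_step.
rewrite (@ge0_integral_pushforward _ _ _ _ _ _ (@measurable_rV_cons R n))//.
by apply: (measurableT_comp (f := abse) _ mf).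
Qed.

Lemma Rint_leb_cons (f : 'rV[R]_n.+1 -> R) :
  (leb R n.+1).-integrable setT (EFin \o f) ->
  \int[leb R n.+1]_x f x = \int[(lam \x leb R n)%E]_p f (rV_cons p).
Proof.
move=> fi; have fi' := integrable_rV_cons fi.
rewrite /Rintegral; congr fine; rewrite [in LHS]/= /leb_step.
rewrite (@integral_pushforward _ _ _ _ _ _ (@measurable_rV_cons R n))//.
by have /measurable_int := fi.
Qed.

End fubini_step.

(* Induction on the dimension: the coordinate of differentiation is either the
   first one, and then the inner integral vanishes by the fundamental theorem of
   calculus, or it is one of the others, and then it vanishes by induction. *)
Lemma Rint_partial_eq0 n (F : 'rV[R]_n -> R) (M : R) i :
  (forall x, derivable F x (unitv R i)) -> continuous ('D_(unitv R i) F) ->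
  (forall x, ~ sup_ball n M x -> F x = 0) ->
  \int[leb R n]_x ('D_(unitv R i) F x) = 0.
Proof.
elim: n F i => [F [] //|n IH F i dF cF F0].
(* Increments of length at most 1, started outside the larger ball, stay where [F] vanishes. *)
have DF0 x : ~ sup_ball n.+1 (M + 1) x -> 'D_(unitv R i) F x = 0.
  move=> /existsNP[j /negP]; rewrite -ltNge => xM.
  rewrite /derive; apply: cvg_lim => //.
  apply: cvg_near_cst; near=> h.
  have F0' (y : 'rV[R]_n.+1) : M < `|y ord0 j| -> F y = 0.
    by move=> My; apply: F0 => /(_ j); rewrite leNgt My.
  rewrite /= !F0' ?subrr ?scaler0//.
    by apply: lt_trans xM; rewrite ltrDl.
  rewrite !mxE.
  have h1 : `|h| <= 1 by near: h; exact: dnbhs0_le.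
  have : `|h * ((ord0 == ord0 :> 'I_1) && (j == i))%:R| <= 1.
    by rewrite normrM; case: (_ && _); rewrite ?normr1 ?mulr1// normr0 mulr0.
  set u := h * _ => u1.
  have := ler_normB (u + x ord0 j) u; rewrite [u + _]addrC addrK.
  by lra.
have DFi : (leb R n.+1).-integrable setT (EFin \o 'D_(unitv R i) F).
  exact: integrable_bounded_support DF0.
rewrite Rint_leb_cons//.
have DFi' := integrable_rV_cons DFi.
case: (unliftP ord0 i) => [j|] iE; subst i.
- have H a : \int[leb R n]_y ('D_(unitv R (lift ord0 j)) F (rV_cons (a, y))) = 0.
    pose Fa y := F (rV_cons (a, y)).
    (* The partial map has literally the difference quotients of [F], so derivability and
       derivatives transfer at once. *)
    have E x : (fun h => h^-1 *: ((Fa \o shift x) (h *: unitv R j) - Fa x)) =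
        fun h => h^-1 *: ((F \o shift (rV_cons (a, x))) (h *: unitv R (lift ord0 j))
        - F (rV_cons (a, x))).
      by apply/funext => h; rewrite /Fa /= rV_cons_addS.
    have DE x : 'D_(unitv R j) Fa x = 'D_(unitv R (lift ord0 j)) F (rV_cons (a, x)).
      by rewrite /derive E.
    rewrite -[RHS](IH Fa j).
    + by apply: eq_Rintegral => y _; rewrite DE.
    + by move=> x; rewrite /derivable E; exact: dF.
    + rewrite (_ : 'D_(unitv R j) Fa = 'D_(unitv R (lift ord0 j)) F \o (fun y => rV_cons (a, y))).
        by move=> x; apply: continuous_comp; [exact: continuous_rV_consr|exact: cF].
      by apply/funext => x; rewrite DE.
    + move=> x xM; apply: F0 => K; apply: xM => k.
      by have := K (lift ord0 k); rewrite mxE liftK.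
  rewrite /Rintegral -(@integral12_prod_meas1 _ _ _ _ R (@lebesgue_measure R) (leb R n) _ DFi').
  rewrite (_ : fubini_F _ _ = fun a => (\int[leb R n]_y ('D_(unitv R (lift ord0 j)) F (rV_cons (a, y)))%:E)%E)//.
  rewrite (@ae_eq_integral' _ _ _ _ _ _ (fun=> 0%E)); first by rewrite integral0.
  have := ae_integrable1 DFi'; apply: filterS => a /= ia _.
  by rewrite -[LHS]fineK ?integrable_fin_num//; congr (_%:E); exact: H.
- have H y : \int[@lebesgue_measure R]_a ('D_(unitv R ord0) F (rV_cons (a, y))) = 0.
    pose Fy a := F (rV_cons (a, y)).
    have E a : (fun h : R => h^-1 *: ((Fy \o shift a) (h *: 1) - Fy a)) =
        fun h => h^-1 *: ((F \o shift (rV_cons (a, y))) (h *: unitv R ord0)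
        - F (rV_cons (a, y))).
      by apply/funext => h; rewrite /Fy /= -rV_cons_add0 [h *: 1]mulr1.
    have DE a : derive1 Fy a = 'D_(unitv R ord0) F (rV_cons (a, y)).
      by rewrite derive1E /derive E.
    (* Beyond K - 1 = |M| + 1 both [F] and its derivative vanish, so the integral over the line is
       the one over [-K, K] and its boundary terms are zero. *)
    pose K := `|M| + 2.
    have K0 : - K <= K by rewrite /K; have := normr_ge0 M; lra.
    have FK a : K - 1 < `|a| -> forall G : 'rV[R]_n.+1 -> R,
        (forall x, ~ sup_ball n.+1 (M + 1) x -> G x = 0) -> G (rV_cons (a, y)) = 0.
      move=> aK G G0; apply: G0 => /(_ ord0); rewrite mxE unlift_none /=.
      by move: aK; rewrite /K; have := ler_norm M; lra.
    have F0' x : ~ sup_ball n.+1 (M + 1) x -> F x = 0.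
      by move=> xM; apply: F0 => L; apply: xM => k; apply: le_trans (L k) _; rewrite lerDl.
    have dFy x : derivable Fy x 1 by rewrite /derivable E; exact: dF.
    have cFy : continuous (derive1 Fy).
      rewrite (_ : derive1 Fy = 'D_(unitv R ord0) F \o (fun a => rV_cons (a, y))).
        by move=> x; apply: continuous_comp; [exact: continuous_rV_consl|exact: cF].
      by apply/funext => x; rewrite DE.
    have := Rint_FTC2 K0 dFy cFy.
    have nK : K - 1 < `|K| by have := ler_norm K; lra.
    rewrite /Fy (FK _ nK F F0') (FK (- K) _ F F0') ?normrN// subrr => I0.
    rewrite -I0 Rintegral_mkcond [RHS]Rintegral_mkcond.
    apply: eq_Rintegral => a _; rewrite patch_setT /patch -DE.
    case: ifPn => //; rewrite notin_setE /= in_itv /= -ler_norml => /negP; rewrite -ltNge => aK.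
    by rewrite DE (FK a _ _ DF0)//; move: aK; rewrite /K; lra.
  rewrite /Rintegral -(@integral21_prod_meas1 _ _ _ _ R (@lebesgue_measure R) (leb R n) _ DFi').
  rewrite (_ : fubini_G _ _ = fun y => (\int[@lebesgue_measure R]_a ('D_(unitv R ord0) F (rV_cons (a, y)))%:E)%E)//.
  rewrite (@ae_eq_integral' _ _ _ _ _ _ (fun=> 0%E)); first by rewrite integral0.
  have := ae_integrable2 DFi'; apply: filterS => y /= iy _.
  by rewrite -[LHS]fineK ?integrable_fin_num//; congr (_%:E); exact: H.
Unshelve. all: by end_near. Qed.

End lebesgue_rV.

(** * Sobolev spaces *)

(** The H1 inner product. It involves the chosen gradients, so its linearity rests on their
    uniqueness up to null sets. *)
HB.lock Definition hip (R : realType) n (Om : set 'rV[R]_n) (w z : 'rV[R]_n -> R) : R :=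
  ip (leb R n) Om w z + ipv (leb R n) Om (wgrad Om w) (wgrad Om z).

Section H1_theory.
Context (R : realType) (n : nat).
Local Notation E := 'rV[R]_n.
Variable Om : set E.
Hypotheses (oOm : open Om) (bOm : bounded_set Om).
Local Notation mu := (leb R n).
Local Notation L2 := (in_L2 mu Om).
Local Notation L2v := (in_L2v mu Om).

Let mOm : measurable Om := measurable_Om oOm.

Let Om_fin : (mu Om < +oo)%E.
Proof. exact: leb_bounded. Qed.

Lemma in_L2_integrable f : L2 f -> mu.-integrable Om (EFin \o f).
Proof.
move=> fl; have l1 : L2 (fun=> 1).
  apply/in_L2P => //; split; first exact: measurable_cst.
  apply: measurable_bounded_integrable => //; exists 1; split => // M M1 x _ /=.
  by rewrite expr1n normr1 ltW.
apply: (eq_integrable mOm _ _ _ (in_L2_integrableM mOm fl l1)) => x _ /=.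
by rewrite mulr1.
Qed.

Lemma continuous_bounded_Om (f : E -> R) : continuous f ->
  exists2 C, 0 <= C & forall x, Om x -> `|f x| <= C.
Proof.
move=> cf; have [M OM] := bounded_sup_ball bOm.
have cB : compact (@sup_ball R n M) by exact: sup_ball_compact.
have /compact_bounded : compact (f @` @sup_ball R n M).
  by apply: continuous_compact => //; exact: continuous_subspaceT.
move=> [K [Kr HK]]; exists (Num.max 0 (K + 1)); first by rewrite le_max lexx.
move=> x Ox; rewrite le_max; apply/orP; right.
by apply: (HK (K + 1)); [rewrite ltrDl|exists x => //; exact: OM].
Qed.

Lemma in_L2_boundedM (f g : E -> R) : continuous f -> L2 g -> L2 (fun x => f x * g x).
Proof.
move=> cf gl; have [C C0 HC] := continuous_bounded_Om cf.
apply: (in_L2_le mOm _ _ (in_L2Z mOm C gl)).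
  apply: measurable_funM; last by case: gl.
  exact: measurable_funS (continuous_rV_measurable cf).
by move=> x Ox; rewrite !normrM ler_wpM2r// (ger0_norm C0) HC.
Qed.

Lemma continuous_in_L2 (f : E -> R) : continuous f -> L2 f.
Proof.
move=> cf; have l1 : L2 (fun=> 1).
  apply/in_L2P => //; split; first exact: measurable_cst.
  apply: measurable_bounded_integrable => //; exists 1; split => // M M1 x _ /=.
  by rewrite expr1n normr1 ltW.
by apply: eq_in_L2 (in_L2_boundedM cf l1) => // x _; rewrite mulr1.
Qed.

Lemma smooth_partial (f : E -> R) i : smooth f -> smooth ('D_(unitv R i) f).
Proof. by move=> sf k; have [_ /(_ i)[_]] := sf k.+1. Qed.

Lemma smooth_derivable (f : E -> R) i x : smooth f -> derivable f x (unitv R i).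
Proof. by move=> sf; have [_ /(_ i)[+ _]] := sf 1%N; apply. Qed.

Lemma nablaE (f : E -> R) x i : nabla f x ord0 i = 'D_(unitv R i) f x.
Proof. by rewrite mxE. Qed.

Lemma smooth_in_L2 f : smooth f -> L2 f.
Proof. by move=> /smooth_continuous; exact: continuous_in_L2. Qed.

Lemma smooth_nabla_L2v f : smooth f -> L2v (nabla f).
Proof.
move=> sf i; apply: eq_in_L2 (smooth_in_L2 (smooth_partial i sf)) => // x _.
by rewrite nablaE.
Qed.

Lemma test_partial_out f i x : test_fun Om f -> ~ Om x -> 'D_(unitv R i) f x = 0.
Proof.
move=> [sf [_ fO]] nOx; rewrite (@near_eq_derive _ _ _ f (cst 0)); first exact: derive_cst.
have oC : open (~` closure [set x | f x != 0]) by rewrite openC; exact: closed_closure.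
have : nbhs x (~` closure [set x | f x != 0]).
  by apply: open_nbhs_nbhs; split => // /fO.
apply: filterS => y /= ny; apply: contrapT => /eqP fy; apply: ny.
exact: subset_closure.
Qed.

(** The product of [p] and a test function vanishes off [Om], so the integral of its partial
    derivative over the whole space, which is zero, is the one over [Om]. *)
Lemma smooth_weak_gradient p : smooth p -> weak_gradient Om p (nabla p).
Proof.
move=> sp; split; first exact: smooth_nabla_L2v.
move=> psi tpsi i; have [spsi _] := tpsi.
have [M OM] := bounded_sup_ball bOm.
have sF : smooth (fun x => p x * psi x) by exact: smoothM.
have DE x : 'D_(unitv R i) (fun x => p x * psi x) x =
    p x * nabla psi x ord0 i + nabla p x ord0 i * psi x.
  by rewrite !nablaE deriveM; try exact: smooth_derivable; rewrite [X in _ + X]mulrC.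
have := @Rint_partial_eq0 R n (fun x => p x * psi x) M i
  (fun x => @smooth_derivable _ i x sF) (smooth_continuous (smooth_partial i sF)).
have H0 x : ~ @sup_ball R n M x -> p x * psi x = 0.
  by move=> nM; rewrite (test_fun_out tpsi) ?mulr0// => /OM.
move=> /(_ H0) I0.
have I1 : \int[mu]_(x in Om) (p x * nabla psi x ord0 i + nabla p x ord0 i * psi x) = 0.
  rewrite -I0 Rintegral_mkcond [RHS]Rintegral_mkcond; apply: eq_Rintegral => x _.
  rewrite patch_setT DE /patch; case: ifPn => //; rewrite notin_setE => nO.
  by rewrite (test_fun_out tpsi)// nablaE (test_partial_out _ tpsi)// !mulr0 addr0.
apply/eqP; rewrite -addr_eq0 -RintD// ?I1//.
- exact: in_L2_aeintM (smooth_in_L2 sp) (smooth_nabla_L2v spsi i).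
- exact: in_L2_aeintM (smooth_nabla_L2v sp i) (smooth_in_L2 spsi).
Qed.

Lemma weak_gradient_unique w G H : weak_gradient Om w G -> weak_gradient Om w H ->
  {ae mu, forall x, Om x -> G x = H x}.
Proof.
move=> [Gl Gw] [Hl Hw].
have K i : {ae mu, forall x, Om x -> G x ord0 i - H x ord0 i = 0}.
  have GHl := in_L2B mOm (Gl i) (Hl i).
  apply: (ae_eq0_of_tests oOm (in_L2_integrable GHl)) => psi tpsi.
  have pl : L2 psi by apply: smooth_in_L2; case: tpsi.
  under eq_Rintegral do rewrite mulrBl.
  rewrite RintB//; try exact: in_L2_aeintM.
  by apply/eqP; rewrite subr_eq0 -eqr_opp -Gw// -Hw.
have : {ae mu, forall x, forall i, Om x -> G x ord0 i - H x ord0 i = 0}.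
  by apply: ae_forall_count => i; exact: K.
by apply: filterS => x L Ox; apply/rowP => i; apply/eqP; rewrite -subr_eq0 L.
Qed.

Lemma weak_gradient_comb a w z G H : L2 w -> L2 z ->
  weak_gradient Om w G -> weak_gradient Om z H ->
  weak_gradient Om (fun x => a * w x + z x) (fun x => a *: G x + H x).
Proof.
move=> wl zl [Gl Gw] [Hl Hw]; split.
  by apply: in_L2vD => //; exact: in_L2vZ.
move=> psi tpsi i; have spsi : smooth psi by case: tpsi.
have pl := smooth_in_L2 spsi; have dl := smooth_nabla_L2v spsi i.
under eq_Rintegral do rewrite mulrDl -mulrA.
rewrite RintD//; last 2 first.
- by apply: aeintZ => //; exact: in_L2_aeintM.
- exact: in_L2_aeintM.
rewrite RintZ//; last exact: in_L2_aeintM.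
under [in RHS]eq_Rintegral do rewrite !mxE mulrDl -mulrA.
rewrite RintD//; last 2 first.
- by apply: aeintZ => //; exact: (in_L2_aeintM mOm (Gl i) pl).
- exact: (in_L2_aeintM mOm (Hl i) pl).
rewrite RintZ//; last exact: (in_L2_aeintM mOm (Gl i) pl).
by rewrite Gw// Hw// opprD mulrN.
Qed.

Lemma weak_gradient_ae (w z : E -> R) G : {ae mu, forall x, Om x -> w x = z x} ->
  weak_gradient Om w G -> weak_gradient Om z G.
Proof.
move=> wz [Gl Gw]; split => // psi tpsi i; rewrite -Gw//.
by apply: ae_eq_Rintegral; apply: filterS wz => x /= H Ox; rewrite H.
Qed.

Lemma wgradP w : H1 Om w -> weak_gradient Om w (wgrad Om w).
Proof. by move=> [_ [G wG]]; apply: (@xgetPex _ (fun=> 0) [set G | weak_gradient Om w G]); exists G. Qed.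

Lemma H1_L2 w : H1 Om w -> L2 w. Proof. by case. Qed.

Lemma H1_wgrad_L2v w : H1 Om w -> L2v (wgrad Om w).
Proof. by move=> /wgradP[]. Qed.

Lemma wgrad_ae w G : weak_gradient Om w G -> {ae mu, forall x, Om x -> wgrad Om w x = G x}.
Proof.
move=> wG; have wg : weak_gradient Om w (wgrad Om w).
  by apply: (@xgetPex _ (fun=> 0) [set G | weak_gradient Om w G]); exists G.
exact: weak_gradient_unique wg wG.
Qed.

Lemma H1_comb a w z : H1 Om w -> H1 Om z -> H1 Om (fun x => a * w x + z x).
Proof.
move=> hw hz; split.
  by apply: in_L2D => //; [apply: in_L2Z => //|]; exact: H1_L2.
exists (fun x => a *: wgrad Om w x + wgrad Om z x).
by apply: weak_gradient_comb; by [exact: H1_L2|exact: wgradP].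
Qed.

Lemma wgrad_comb a w z : H1 Om w -> H1 Om z -> {ae mu, forall x, Om x ->
  wgrad Om (fun x => a * w x + z x) x = a *: wgrad Om w x + wgrad Om z x}.
Proof.
move=> hw hz; apply: wgrad_ae.
by apply: weak_gradient_comb; by [exact: H1_L2|exact: wgradP].
Qed.

Lemma smooth_H1 p : smooth p -> H1 Om p.
Proof.
by move=> sp; split; [exact: smooth_in_L2|exists (nabla p); exact: smooth_weak_gradient].
Qed.

Lemma H1_0 : H1 Om (fun=> 0).
Proof. by apply: smooth_H1; exact: smooth_cst. Qed.

Lemma H1Z a w : H1 Om w -> H1 Om (fun x => a * w x).
Proof.
by move=> hw; have := H1_comb a hw H1_0; congr H1; apply/funext => x; rewrite addr0.
Qed.

Lemma H1B w z : H1 Om w -> H1 Om z -> H1 Om (w \- z).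
Proof.
move=> hw hz; have := H1_comb (-1) hz hw; congr H1.
by apply/funext => x; rewrite mulN1r addrC.
Qed.

Lemma wgradB w z : H1 Om w -> H1 Om z -> {ae mu, forall x, Om x ->
  wgrad Om (w \- z) x = wgrad Om w x - wgrad Om z x}.
Proof.
move=> hw hz; have := wgrad_comb (-1) hz hw; apply: filterS => x + Ox => /(_ Ox).
rewrite scaleN1r addrC => <-; congr (wgrad Om _ x).
by apply/funext => y; rewrite mulN1r addrC.
Qed.

Local Notation hip := (hip Om).

Lemma hipE w z : hip w z = ip mu Om w z + ipv mu Om (wgrad Om w) (wgrad Om z).
Proof. by rewrite hip.unlock. Qed.

Definition hn w : R := Num.sqrt (hip w w).

Lemma hip_ge0 w : 0 <= hip w w.
Proof. by rewrite hipE addr_ge0 ?ip_ge0 ?ipv_ge0. Qed.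

Lemma hn_ge0 w : 0 <= hn w. Proof. exact: sqrtr_ge0. Qed.

Lemma hn_sq w : hn w ^+ 2 = hip w w.
Proof. by rewrite sqr_sqrtr// hip_ge0. Qed.

Lemma H1normE w : H1 Om w -> H1norm Om w = (hn w)%:E.
Proof.
move=> hw; rewrite /H1norm L2norm_sq_ip//; last exact: H1_L2.
rewrite L2normv_sq_ipv//; last exact: H1_wgrad_L2v.
by rewrite /hn hipE.
Qed.

Lemma hipC w z : hip w z = hip z w.
Proof. by rewrite !hipE ipC ipvC. Qed.

Lemma hip_combl a w z y : H1 Om w -> H1 Om z -> H1 Om y ->
  hip (fun x => a * w x + z x) y = a * hip w y + hip z y.
Proof.
move=> hw hz hy; rewrite !hipE ipDl//; try exact: H1_L2; last first.
  by apply: in_L2Z => //; exact: H1_L2.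
rewrite ipZl//; try exact: H1_L2.
rewrite (ipv_ae (wgrad_comb a hw hz) (H' := wgrad Om y)); last exact: aeW.
rewrite ipvDl//; try exact: H1_wgrad_L2v; last first.
  by apply: in_L2vZ => //; exact: H1_wgrad_L2v.
rewrite ipvZl//; try exact: H1_wgrad_L2v.
by ring.
Qed.

Lemma hip_weak_gradient w G : weak_gradient Om w G ->
  hip w w = ip mu Om w w + ipv mu Om G G.
Proof. by move=> wG; rewrite !hipE (ipv_ae (wgrad_ae wG) (wgrad_ae wG)). Qed.

Lemma hip_expand w z s : H1 Om w -> H1 Om z ->
  hip (fun x => s * z x + w x) (fun x => s * z x + w x) =
  hip w w + 2 * s * hip w z + s ^+ 2 * hip z z.
Proof.
move=> hw hz; have hc := H1_comb s hz hw.
rewrite hip_combl// (hipC z) (hipC w) !hip_combl// (hipC z w); ring.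
Qed.

Lemma hip_sq_le w z : H1 Om w -> H1 Om z -> hip w z ^+ 2 <= hip w w * hip z z.
Proof.
move=> hw hz; apply: discriminant_le => [|s]; first exact: hip_ge0.
by rewrite -hip_expand//; exact: hip_ge0.
Qed.

Lemma hnZ a w : H1 Om w -> hn (fun x => a * w x) = `|a| * hn w.
Proof.
move=> hw; rewrite /hn; have := hip_expand a H1_0 hw.
have -> : (fun x => a * w x + 0) = (fun x => a * w x) by apply/funext => x; rewrite addr0.
have z0 z : H1 Om z -> hip (fun=> 0) z = 0.
  move=> hz; have := hip_combl 0 hz H1_0 hz.
  have -> : (fun x => 0 * z x + 0) = (fun=> 0) by apply/funext => x; rewrite mul0r addr0.
  have := hip_combl 1 H1_0 H1_0 hz.
  have -> : (fun x => 1 * 0 + 0) = (fun=> 0 : R) :> (E -> R) by apply/funext => x; rewrite mul1r addr0.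
  lra.
move=> ->; rewrite !z0//; last exact: H1_0.
by rewrite mulr0 !add0r sqrtrM ?sqr_ge0// sqrtr_sqr.
Qed.

Lemma hn0 : hn (fun=> 0) = 0.
Proof.
have := hnZ 0 H1_0; rewrite normr0 [RHS]mul0r => E0; rewrite -[RHS]E0.
by congr hn; apply/funext => x; rewrite mul0r.
Qed.

Lemma hnD w z : H1 Om w -> H1 Om z -> hn (w \+ z) <= hn w + hn z.
Proof.
move=> hw hz; rewrite /hn; have := hip_expand 1 hw hz.
have -> : (fun x => 1 * z x + w x) = w \+ z by apply/funext => x; rewrite mul1r addrC.
move=> ->; rewrite expr1n mulr1 mul1r; apply: sqrt_triangle; rewrite ?hip_ge0//.
exact: hip_sq_le.
Qed.

Lemma hn_distC w z : H1 Om w -> H1 Om z -> hn (w \- z) = hn (z \- w).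
Proof.
move=> hw hz; have := hnZ (-1) (H1B hz hw); rewrite normrN normr1 mul1r => <-.
by congr hn; apply/funext => x; rewrite mulN1r opprB.
Qed.

Lemma hn_distD y w z : H1 Om w -> H1 Om z -> H1 Om y -> hn (w \- z) <= hn (w \- y) + hn (y \- z).
Proof.
move=> hw hz hy; have := hnD (H1B hw hy) (H1B hy hz).
by congr (hn _ <= _); apply/funext => x /=; rewrite addrA subrK.
Qed.

Lemma ip_le_hn w z : L2 w -> H1 Om z -> `|ip mu Om w z| <= Num.sqrt (ip mu Om w w) * hn z.
Proof.
move=> wl hz; apply: le_trans (ip_le mOm wl (H1_L2 hz)) _.
by rewrite ler_wpM2l ?sqrtr_ge0// ler_sqrt ?hip_ge0// hipE lerDl ipv_ge0.
Qed.

Lemma ipv_le_hn G z : L2v G -> H1 Om z ->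
  `|ipv mu Om G (wgrad Om z)| <= Num.sqrt (ipv mu Om G G) * hn z.
Proof.
move=> Gl hz; apply: le_trans (ipv_le mOm Gl (H1_wgrad_L2v hz)) _.
by rewrite ler_wpM2l ?sqrtr_ge0// ler_sqrt ?hip_ge0// hipE lerDr ip_ge0.
Qed.

Lemma cvg_H1norm (w_ : nat -> E -> R) w : (forall k, H1 Om (w_ k)) -> H1 Om w ->
  ((fun k => H1norm Om (w_ k \- w)) @ \oo --> 0%E) <->
  ((fun k => hn (w_ k \- w)) @ \oo --> 0).
Proof.
move=> hw_ hw; have -> : (fun k => H1norm Om (w_ k \- w)) = EFin \o (fun k => hn (w_ k \- w)).
  by apply/funext => k /=; rewrite H1normE//; exact: H1B.
split=> [/fine_cvg//|H]; apply: cvg_EFin => //; exact: nearW.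
Qed.

Lemma test_H10 psi : test_fun Om psi -> H10 Om psi.
Proof.
move=> tpsi; have hp : H1 Om psi by apply: smooth_H1; case: tpsi.
split => //; exists (fun=> psi); split => //.
apply/cvg_H1norm => //; apply: cvg_near_cst; apply: nearW => k.
have := hnZ 0 hp; rewrite normr0 mul0r => <-; congr hn.
by apply/funext => x; rewrite /= subrr mul0r.
Qed.

Lemma H10_H1 w : H10 Om w -> H1 Om w. Proof. by case. Qed.

Lemma H10_comb a w z : H10 Om w -> H10 Om z -> H10 Om (fun x => a * w x + z x).
Proof.
move=> [hw [p [tp cp]]] [hz [q [tq cq]]].
have hc := H1_comb a hw hz; split => //.
have hp k : H1 Om (p k) by apply: smooth_H1; case: (tp k).
have hq k : H1 Om (q k) by apply: smooth_H1; case: (tq k).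
move: cp cq => /(cvg_H1norm hp hw) cp /(cvg_H1norm hq hz) cq.
exists (fun k x => a * p k x + q k x); split.
  move=> k; have [sp cp'] := tp k; have [sq cq'] := tq k; split.
    by apply: smoothD => //; apply: smoothM => //; exact: smooth_cst.
  have K1 := cp'.1; have K2 := cq'.1.
  apply: (@compactly_supported_sub _ _ _ (closure [set x | p k x != 0] `|` closure [set x | q k x != 0])).
  - exact: norm_hausdorff.
  - exact: compactU.
  - move=> x; case: (eqVneq (p k x) 0) => [-> | px _]; last by left; exact: subset_closure.
    by rewrite mulr0 add0r => qx; right; exact: subset_closure.
  - by rewrite subUset; split; [exact: cp'.2|exact: cq'.2].
apply/cvg_H1norm => //; first by move=> k; exact: H1_comb.
have L : (fun k => `|a| * hn (p k \- w) + hn (q k \- z)) @ \oo --> 0.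
  by rewrite -[0]addr0 -[X in X + _](mulr0 `|a|); apply: cvgD => //; exact: cvgMr.
apply: squeeze_cvgr L; last exact: cvg_cst.
apply: nearW => k; rewrite hn_ge0/= -hnZ; last exact: H1B.
have := hnD (H1Z a (H1B (hp k) hw)) (H1B (hq k) hz).
congr (hn _ <= _); apply/funext => x /=; ring.
Qed.

Lemma H10_0 : H10 Om (fun=> 0). Proof. by apply: test_H10; exact: test_fun0. Qed.

Lemma H10Z a w : H10 Om w -> H10 Om (fun x => a * w x).
Proof.
by move=> hw; have := H10_comb a hw H10_0; congr H10; apply/funext => x; rewrite addr0.
Qed.

Lemma H10B w z : H10 Om w -> H10 Om z -> H10 Om (w \- z).
Proof.
move=> hw hz; have := H10_comb (-1) hz hw; congr H10.
by apply/funext => x; rewrite mulN1r addrC.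
Qed.

Lemma H10D w z : H10 Om w -> H10 Om z -> H10 Om (w \+ z).
Proof.
move=> hw hz; have := H10_comb 1 hw hz; congr H10.
by apply/funext => x; rewrite mul1r.
Qed.

(** [chi] is moved onto the test function: chi psi is again one, and the product rule for its
    gradient yields the extra term. *)
Lemma weak_gradient_mul chi w G : test_fun Om chi -> L2 w -> weak_gradient Om w G ->
  weak_gradient Om (fun x => chi x * w x) (fun x => chi x *: G x + w x *: nabla chi x).
Proof.
move=> tchi wl [Gl Gw]; have schi : smooth chi by case: tchi.
have cchi := smooth_continuous schi.
have cd i := smooth_continuous (smooth_partial i schi).
have l1 i : L2 (fun x => chi x * G x ord0 i) by exact: in_L2_boundedM.
have l2 i : L2 (fun x => w x * nabla chi x ord0 i).
  by apply: eq_in_L2 (in_L2_boundedM (cd i) wl) => // x _; rewrite nablaE mulrC.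
split=> [i|psi tpsi i].
  by apply: eq_in_L2 (in_L2D mOm (l1 i) (l2 i)) => // x _; rewrite !mxE.
have spsi : smooth psi by case: tpsi.
have pl := smooth_in_L2 spsi.
have t2 : test_fun Om (fun x => chi x * psi x) by exact: test_funM.
have E1 : \int[mu]_(x in Om) (w x * nabla (fun x => chi x * psi x) x ord0 i) =
    \int[mu]_(x in Om) (chi x * w x * nabla psi x ord0 i) +
    \int[mu]_(x in Om) (w x * nabla chi x ord0 i * psi x).
  rewrite -RintD//.
  - apply: eq_Rintegral => x _; rewrite !nablaE deriveM; try exact: smooth_derivable.
    by rewrite /GRing.scale /=; ring.
  - apply: (in_L2_aeintM mOm _ (smooth_nabla_L2v spsi i)); exact: in_L2_boundedM.
  - exact: (in_L2_aeintM mOm (l2 i) pl).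
have E2 : \int[mu]_(x in Om) (G x ord0 i * (chi x * psi x)) =
    \int[mu]_(x in Om) (chi x * G x ord0 i * psi x).
  by apply: eq_Rintegral => x _; rewrite mulrA [_ * chi x]mulrC.
have E3 : \int[mu]_(x in Om) ((chi x *: G x + w x *: nabla chi x) ord0 i * psi x) =
    \int[mu]_(x in Om) (chi x * G x ord0 i * psi x) +
    \int[mu]_(x in Om) (w x * nabla chi x ord0 i * psi x).
  rewrite -RintD//.
  - by apply: eq_Rintegral => x _; rewrite !mxE mulrDl.
  - exact: (in_L2_aeintM mOm (l1 i) pl).
  - exact: (in_L2_aeintM mOm (l2 i) pl).
have := Gw _ t2 i; rewrite E1 E2 E3 opprD => <-.
by rewrite addrK.
Qed.

Lemma H1_mul chi w : test_fun Om chi -> H1 Om w -> H1 Om (fun x => chi x * w x).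
Proof.
move=> tchi hw; split.
  by apply: in_L2_boundedM; [case: tchi => /smooth_continuous|exact: H1_L2].
by eexists; apply: weak_gradient_mul => //; [exact: H1_L2|exact: wgradP].
Qed.

(** |grad (chi w)|^2 <= 2 (chi^2 |grad w|^2 + w^2 |grad chi|^2), where [C] and [D] bound |chi| and
    |grad chi|^2 on [Om]. *)
Lemma hn_mul_le chi : test_fun Om chi ->
  exists2 C, 0 <= C & forall w, H1 Om w -> hn (fun x => chi x * w x) <= C * hn w.
Proof.
move=> tchi; have schi : smooth chi by case: tchi.
have cchi := smooth_continuous schi.
have [C C0 HC] := continuous_bounded_Om cchi.
have /choice[Di HDi] : forall i, exists Ci, 0 <= Ci /\ forall x, Om x -> `|'D_(unitv R i) chi x| <= Ci.
  move=> i; have [K K0 HK] := continuous_bounded_Om (smooth_continuous (smooth_partial i schi)).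
  by exists K.
pose D := \sum_i Di i ^+ 2.
have D0 : 0 <= D by apply: sumr_ge0 => i _; exact: sqr_ge0.
have HD x : Om x -> `|dotv (nabla chi x) (nabla chi x)| <= D.
  move=> Ox; rewrite ger0_norm ?dotv_ge0//; apply: ler_sum => i _.
  rewrite !nablaE -expr2 -real_normK ?num_real//.
  by have [h1 h2] := HDi i; rewrite lerXn2r ?nnegrE// h2.
exists (Num.sqrt (2 * (C ^+ 2 + D))); first exact: sqrtr_ge0.
move=> w hw; rewrite /hn -sqrtrM; last by rewrite mulr_ge0// addr_ge0// sqr_ge0.
rewrite ler_sqrt; last first.
  by rewrite mulr_ge0 ?hip_ge0// mulr_ge0// addr_ge0// sqr_ge0.
have wl := H1_L2 hw; have Gl := H1_wgrad_L2v hw.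
have wG := weak_gradient_mul tchi wl (wgradP hw).
rewrite (hip_weak_gradient wG).
have cwl : L2 (fun x => chi x * w x) by exact: in_L2_boundedM.
have i1 := in_L2_aeintM mOm wl wl; have i2 := in_L2v_aeint mOm Gl Gl.
rewrite hipE !ipE !ipvE -!RintD//; try exact: in_L2_aeintM; try exact: in_L2v_aeint; last first.
  by have [GGl _] := wG; exact: in_L2v_aeint.
rewrite -RintZ//; last exact: aeintD.
apply: le_Rint => //.
- by have [GGl _] := wG; apply: aeintD => //; [exact: in_L2_aeintM|exact: in_L2v_aeint].
- by apply: aeintZ => //; exact: aeintD.
apply: aeW => x Ox; set G := wgrad Om w x; set N := nabla chi x.
have h1 : dotv (chi x *: G + w x *: N) (chi x *: G + w x *: N) <=
    2 * (chi x ^+ 2 * dotv G G + w x ^+ 2 * dotv N N).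
  rewrite /dotv !mulr_sumr -big_split mulr_sumr; apply: ler_sum => i _ /=.
  by rewrite !mxE; have := sqr_ge0 (chi x * G ord0 i - w x * 'D_(unitv R i) chi x); nra.
have := HC x Ox; have := HD x Ox; rewrite -/N ger0_norm ?dotv_ge0// => hD hC.
have c2 : chi x ^+ 2 <= C ^+ 2 by rewrite -real_normK ?num_real// lerXn2r ?nnegrE.
have G0 := dotv_ge0 G; have N0 := dotv_ge0 N; have w2 := sqr_ge0 (w x).
have e1 : chi x * w x * (chi x * w x) = chi x ^+ 2 * w x ^+ 2 by ring.
rewrite e1; apply: le_trans (lerD (lexx _) h1) _; rewrite -[w x * w x]expr2.
have k1 : chi x ^+ 2 * w x ^+ 2 <= C ^+ 2 * w x ^+ 2 by rewrite ler_wpM2r.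
have k2 : chi x ^+ 2 * dotv G G <= C ^+ 2 * dotv G G by rewrite ler_wpM2r.
have k3 : w x ^+ 2 * dotv N N <= D * w x ^+ 2 by rewrite mulrC ler_wpM2r.
have k4 : 0 <= C ^+ 2 * w x ^+ 2 by rewrite mulr_ge0 ?sqr_ge0.
have k5 : 0 <= D * dotv G G by rewrite mulr_ge0.
lra.
Qed.

(** The approximants need no compact support, since [chi] supplies it. Hence chi w lies in H10 even
    for a w that does not vanish on the boundary. *)
Lemma H10_mul_lim chi (p : nat -> E -> R) w : test_fun Om chi -> H1 Om w ->
  (forall k, smooth (p k)) -> (fun k => H1norm Om (p k \- w)) @ \oo --> 0%E ->
  H10 Om (fun x => chi x * w x).
Proof.
move=> tchi hw sp cp; have hp k : H1 Om (p k) by exact: smooth_H1.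
split; first exact: H1_mul.
exists (fun k x => chi x * p k x); split; first by move=> k; exact: test_funM.
apply/cvg_H1norm; [by move=> k; exact: H1_mul|exact: H1_mul|].
move: cp => /(cvg_H1norm hp hw) cp; have [C C0 HC] := hn_mul_le tchi.
have L : (fun k => C * hn (p k \- w)) @ \oo --> 0.
  by rewrite -[X in _ --> X](mulr0 C); exact: cvgMr.
apply: squeeze_cvgr L; last exact: cvg_cst.
apply: nearW => k; rewrite hn_ge0/=.
have := HC _ (H1B (hp k) hw); congr (hn _ <= _).
by apply/funext => x /=; rewrite mulrBr.
Qed.

Lemma H10_mul chi w : test_fun Om chi -> H10 Om w -> H10 Om (fun x => chi x * w x).
Proof.
move=> tchi [hw [p [tp cp]]]; apply: H10_mul_lim cp => // k; by case: (tp k).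
Qed.

Lemma H10_approx w e : H10 Om w -> 0 < e ->
  exists2 psi, test_fun Om psi & hn (w \- psi) < e.
Proof.
move=> [hw [p [tp cp]]] e0.
have hp k : H1 Om (p k) by apply: smooth_H1; case: (tp k).
move: cp => /(cvg_H1norm hp hw)/cvgrPdist_lt/(_ e e0)[k _ /(_ k (leqnn k))].
rewrite sub0r normrN ger0_norm ?hn_ge0// => H; exists (p k) => //.
by rewrite hn_distC.
Qed.

(** The difference of the two sides is continuous in [w] for the H1 norm and vanishes on test
    functions, which are dense in H10; [K] is a positive bound for its norm. *)
Lemma divergence_H10 tau g w : L2v tau -> L2 g ->
  (forall psi, test_fun Om psi -> \int[mu]_(x in Om) dotv (tau x) (nabla psi x) =
     - \int[mu]_(x in Om) (g x * psi x)) ->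
  H10 Om w -> ipv mu Om tau (wgrad Om w) = - ip mu Om g w.
Proof.
move=> tl gl H hw; have h1w := H10_H1 hw.
apply/eqP; rewrite -subr_eq0 opprK -normr_le0; apply/ler_addgt0Pl => e e0; rewrite addr0.
set K := Num.sqrt (ip mu Om g g) + Num.sqrt (ipv mu Om tau tau) + 1.
have K0 : 0 < K by rewrite ltr_wpDl// addr_ge0 ?sqrtr_ge0.
have [psi tpsi he] := H10_approx hw (divr_gt0 e0 K0).
have hp : H1 Om psi by apply: smooth_H1; case: tpsi.
have Hp : ipv mu Om tau (wgrad Om psi) + ip mu Om g psi = 0.
  apply/eqP; rewrite addr_eq0 ipE -[X in _ == X]H//; apply/eqP.
  rewrite -ipvE; apply: ipv_ae; first exact: aeW.
  by apply: wgrad_ae; apply: smooth_weak_gradient; case: tpsi.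
have hwp := H1B h1w hp.
have -> : ipv mu Om tau (wgrad Om w) + ip mu Om g w =
    ipv mu Om tau (wgrad Om (w \- psi)) + ip mu Om g (w \- psi).
  rewrite ipBr//; try exact: H1_L2.
  rewrite (ipv_ae (aeW _ (fun x (_ : Om x) => erefl (tau x))) (wgradB h1w hp)).
  rewrite ipvBr//; try exact: H1_wgrad_L2v.
  lra.
have a1 := ipv_le_hn tl hwp; have a2 := ip_le_hn gl hwp.
apply: le_trans (ler_normD _ _) _; apply: le_trans (lerD a1 a2) _.
rewrite -mulrDl; apply: (@le_trans _ _ (K * hn (w \- psi))).
  by rewrite ler_wpM2r ?hn_ge0// /K; lra.
by rewrite mulrC -ler_pdivlMr// ltW.
Qed.

(** * The dual of H10 *)

Section dual.
Variable l : (E -> R) -> R.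
Hypothesis hl : Hm1 Om l.

Lemma Hm1_comb a w z : H10 Om w -> H10 Om z -> l (fun x => a * w x + z x) = a * l w + l z.
Proof. by case: hl => + _; exact. Qed.

Lemma Hm1_0 : l (fun=> 0) = 0.
Proof.
have := Hm1_comb 1 H10_0 H10_0.
have -> : (fun x => 1 * 0 + 0) = (fun=> 0 : R) :> (E -> R) by apply/funext => x; rewrite mul1r addr0.
lra.
Qed.

Lemma Hm1Z a w : H10 Om w -> l (fun x => a * w x) = a * l w.
Proof.
move=> hw; have := Hm1_comb a hw H10_0; rewrite Hm1_0 addr0 => <-.
by congr l; apply/funext => x; rewrite addr0.
Qed.

Lemma Hm1B w z : H10 Om w -> H10 Om z -> l (w \- z) = l w - l z.
Proof.
move=> hw hz; have := Hm1_comb (-1) hz hw; rewrite mulN1r addrC => <-.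
by congr l; apply/funext => x; rewrite mulN1r addrC.
Qed.

Lemma Hm1norm_ge0 : (0 <= Hm1norm Om l)%E.
Proof.
apply: (@le_trans _ _ (`|l (fun=> 0)|%:E)); first by rewrite lee_fin.
apply: ereal_sup_ubound; exists (fun=> 0) => //; split; first exact: H10_0.
rewrite H1normE; last exact: H1_0.
by rewrite hn0 lee_fin.
Qed.

Lemma Hm1norm_fin_num : Hm1norm Om l \is a fin_num.
Proof. by rewrite ge0_fin_numE ?Hm1norm_ge0//; case: hl. Qed.

Lemma Hm1_le w : H10 Om w -> `|l w| <= fine (Hm1norm Om l) * hn w.
Proof.
move=> hw; have h1w := H10_H1 hw.
have base z : H10 Om z -> hn z <= 1 -> `|l z| <= fine (Hm1norm Om l).
  move=> hz z1; rewrite -lee_fin fineK ?Hm1norm_fin_num//.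
  apply: ereal_sup_ubound; exists z => //; split => //.
  by rewrite H1normE ?lee_fin//; exact: H10_H1.
(* A function of norm zero need not be the zero function. All its multiples stay in the unit ball,
   so after scaling a nonzero value of [l] would exceed the dual norm. *)
have [w0|w0] := eqVneq (hn w) 0.
  rewrite w0 mulr0 leNgt; apply/negP => lw.
  have := base (fun x => (fine (Hm1norm Om l) + 1) / `|l w| * w x).
  rewrite hnZ// w0 mulr0 => /(_ (H10Z _ hw) ler01).
  rewrite Hm1Z// normrM normrM normrV ?unitfE ?gt_eqF// normr_id divfK ?gt_eqF//.
  rewrite ger0_norm; first by lra.
  by rewrite addr_ge0// fine_ge0// Hm1norm_ge0.
have wp : 0 < hn w by rewrite lt_neqAle eq_sym w0 hn_ge0.
have := base (fun x => (hn w)^-1 * w x) (H10Z _ hw).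
rewrite hnZ// gtr0_norm ?invr_gt0// mulVf// lexx => /(_ isT).
by rewrite Hm1Z// normrM gtr0_norm ?invr_gt0// ler_pdivrMl// mulrC.
Qed.

End dual.

Lemma Hm1norm_le (l : (E -> R) -> R) C : 0 <= C ->
  (forall w, H10 Om w -> `|l w| <= C * hn w) -> (Hm1norm Om l <= C%:E)%E.
Proof.
move=> C0 H; apply: ge_ereal_sup => _ [w [hw w1] <-]; rewrite lee_fin.
apply: le_trans (H w hw) _; rewrite -[leRHS]mulr1 ler_wpM2l//.
by move: w1; rewrite H1normE ?lee_fin//; exact: H10_H1.
Qed.

Lemma Hm1_comb_Hm1 a l1 l2 : Hm1 Om l1 -> Hm1 Om l2 ->
  Hm1 Om (fun w => a * l1 w + l2 w).
Proof.
move=> h1 h2; split.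
  by move=> b w z hw hz; rewrite !Hm1_comb//; ring.
have f1 : 0 <= fine (Hm1norm Om l1) by rewrite fine_ge0// Hm1norm_ge0.
have f2 : 0 <= fine (Hm1norm Om l2) by rewrite fine_ge0// Hm1norm_ge0.
apply: (@le_lt_trans _ _ (`|a| * fine (Hm1norm Om l1) + fine (Hm1norm Om l2))%:E); last exact: ltry.
apply: Hm1norm_le; first by rewrite addr_ge0// mulr_ge0.
move=> w hw; apply: le_trans (ler_normD _ _) _; rewrite mulrDl lerD ?Hm1_le//.
by rewrite normrM -mulrA ler_wpM2l// Hm1_le.
Qed.

Lemma ip_Hm1 g : L2 g -> Hm1 Om (ip mu Om g).
Proof.
move=> gl; split.
  move=> a w z hw hz; have hw' := H1_L2 (H10_H1 hw); have hz' := H1_L2 (H10_H1 hz).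
  by rewrite ipDr ?ipZr//; exact: in_L2Z.
apply: (@le_lt_trans _ _ (Num.sqrt (ip mu Om g g))%:E); last exact: ltry.
by apply: Hm1norm_le => [|w hw]; [exact: sqrtr_ge0|apply: ip_le_hn => //; exact: H10_H1].
Qed.

End H1_theory.

(** Bookkeeping for [cvg_concentrate]: [I4], [I3], [I2], [I1] are the integrals over four
    consecutive pieces of [s, t], and [A3], [A2], [A1] the values of the cutoff at the inner
    endpoints, all within [d] of 1. On the outer pieces y stays within e / 8 of its end value; on
    the inner ones the cutoff hardly varies. *)
Lemma concentrate_arith (R : realFieldType) (u v Y e d I1 I2 I3 I4 A1 A2 A3 : R) :
  0 <= e -> 0 <= Y -> `|u| <= Y -> `|v| <= Y -> Y * d <= e / 16 ->
  0 <= A1 <= 1 -> 0 <= A2 <= 1 -> 0 <= A3 <= 1 ->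
  `|1 - A1| <= d -> `|1 - A2| <= d -> `|1 - A3| <= d ->
  `|I4 - u * (A3 - 0)| <= e / 8 * `|A3 - 0| ->
  `|I3 - u * (A2 - A3)| <= 2 * Y * `|A2 - A3| ->
  `|I2 - v * (A1 - A2)| <= 2 * Y * `|A1 - A2| ->
  `|I1 - v * (0 - A1)| <= e / 8 * `|0 - A1| ->
  `|u - v - (I4 + I3 + (I2 + I1))| <= e.
Proof.
move=> e0 Y0 uY vY Yd /andP[a1 b1] /andP[a2 b2] /andP[a3 b3] d1 d2 d3 h4 h3 h2 h1.
have small x y : `|1 - x| <= d -> `|1 - y| <= d -> 2 * Y * `|x - y| <= e / 4.
  move=> hx hy; have : `|x - y| <= 2 * d.
    have -> : x - y = (1 - y) - (1 - x) by ring.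
    by apply: le_trans (ler_normB _ _) _; lra.
  by move=> /(ler_wpM2l Y0); lra.
have {}h3 := le_trans h3 (small _ _ d2 d3).
have {}h2 := le_trans h2 (small _ _ d1 d2).
have {}h4 : `|I4 - u * (A3 - 0)| <= e / 8.
  by apply: le_trans h4 _; rewrite subr0 (ger0_norm a3) ler_piMr// divr_ge0.
have {}h1 : `|I1 - v * (0 - A1)| <= e / 8.
  by apply: le_trans h1 _; rewrite sub0r normrN (ger0_norm a1) ler_piMr// divr_ge0.
have h5 : `|(u - v) * (1 - A2)| <= e / 8.
  rewrite normrM; apply: (@le_trans _ _ (2 * Y * d)); last by lra.
  by apply: ler_pM => //; apply: le_trans (ler_normB _ _) _; lra.
move: h1 h2 h3 h4 h5; rewrite !ler_norml => /andP[? ?] /andP[? ?] /andP[? ?] /andP[? ?] /andP[? ?].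
have E : u - v - (I4 + I3 + (I2 + I1)) = (u - v) * (1 - A2) - (I1 - v * (0 - A1)) -
   (I2 - v * (A1 - A2)) - (I3 - u * (A2 - A3)) - (I4 - u * (A3 - 0)) by ring.
by rewrite E; apply/andP; split; lra.
Qed.

(** * Cutoffs in time and the concentration of their derivatives *)

Section time_tests.
Context (R : realType).
Local Notation lam := (@lebesgue_measure R).
Local Notation smooth1 f := (forall k, CkV (fun _ : unit => (1 : R^o)) k f).

Lemma derive1n_smooth1 (f : R -> R) :
  (forall k t, derivable (derive1n k f) t 1) -> smooth1 f.
Proof.
move=> df k; elim: k f df => [|k IH] f df.
  by move=> x; apply/differentiable_continuous/derivable1_diffP; exact: (df 0%N).
split; first by move=> x; apply/differentiable_continuous/derivable1_diffP; exact: (df 0%N).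
move=> _; split; first exact: (df 0%N).
rewrite (_ : 'D_1 f = derive1 f); first by apply: IH => m t; rewrite -derive1Sn; exact: df.
by apply/funext => x; rewrite derive1E.
Qed.

Lemma smooth1_derive1 (f : R -> R) : smooth1 f ->
  (forall x, derivable f x 1) /\ continuous (derive1 f).
Proof.
move=> sf; have [_ /(_ tt)[df]] := sf 1%N.
rewrite (_ : 'D_1 f = derive1 f); last by apply/funext => x; rewrite derive1E.
by move=> cdf; split; [exact: df|exact: cdf].
Qed.

Definition tbump (s t r : R) : R := flat 1 (r - s) * flat 1 (t - r).

(** Tends to the indicator of ]s, t[ while rising up to the midpoint and falling after it. The
    exponent k+1 leaves the power k in the derivative. *)
Definition tapprox (s t : R) (k : nat) (r : R) : R := 1 - (1 - tbump s t r) ^+ k.+1.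

Lemma tbump_itv s t r : 0 <= tbump s t r <= 1.
Proof. by rewrite mulr_ge0 ?flat_ge0//= mulr_ile1 ?flat_ge0 ?flat_le1. Qed.

Lemma tapprox_itv s t k r : 0 <= tapprox s t k r <= 1.
Proof.
have /andP[h1 h2] := tbump_itv s t r.
rewrite /tapprox subr_ge0 lerBlDr lerDl exprn_ge0 ?subr_ge0// exprn_ile1 ?subr_ge0//.
by rewrite lerBlDr lerDl.
Qed.

Lemma flat_le0 p (x : R) : x <= 0 -> flat p x = 0.
Proof. by move=> x0; rewrite /flat ltNge x0. Qed.

Lemma tbump_out s t r : ~~ (s < r < t) -> tbump s t r = 0.
Proof.
rewrite negb_and -!leNgt => /orP[h|h]; rewrite /tbump.
  by rewrite [flat 1 (r - s)]flat_le0 ?mul0r// subr_le0.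
by rewrite [flat 1 (t - r)]flat_le0 ?mulr0// subr_le0.
Qed.

Lemma tapprox_out s t k r : ~~ (s < r < t) -> tapprox s t k r = 0.
Proof. by move=> /tbump_out; rewrite /tapprox => ->; rewrite subr0 expr1n subrr. Qed.

Lemma cvg_tapprox s t r : (fun k => tapprox s t k r) @ \oo --> (((s < r < t)%R : bool)%:R : R).
Proof.
case: (boolP (s < r < t)) => [/andP[sr rt]|nr]; last first.
  by apply: cvg_near_cst; apply: nearW => k; rewrite tapprox_out.
have b0 : 0 < tbump s t r by rewrite mulr_gt0 ?flat_gt0 ?subr_gt0.
have /andP[_ b1] := tbump_itv s t r.
rewrite /= -[X in _ --> X]subr0; apply: cvgB; first exact: cvg_cst.
rewrite (cvg_shiftS (fun k => (1 - tbump s t r) ^+ k)).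
by apply: cvg_expr; rewrite ger0_norm ?subr_ge0// ltrBlDr ltrDl.
Qed.

Lemma smooth_tapprox s t k : smooth1 (tapprox s t k).
Proof.
move=> k'; apply: CkVB; first exact: CkV_cst.
apply: CkVX; apply: CkVB; first exact: CkV_cst.
apply: CkVM.
- apply: (@CkV_flat _ R^o unit (fun=> 1) _ _ (fun r : R^o => r - s) (fun=> 1)).
    by move=> x; exact: (@cvgB R R R (nbhs (x : R)) _ _ _ _ _ cvg_id (cvg_cst _)).
  by move=> _ x h; rewrite mulr1 -addrA; congr (_ + _); exact: mulr1.
- apply: (@CkV_flat _ R^o unit (fun=> 1) _ _ (fun r : R^o => t - r) (fun=> -1)).
    by move=> x; exact: (@cvgB R R R (nbhs (x : R)) _ _ _ _ _ (cvg_cst _) cvg_id).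
  by move=> _ x h; rewrite [h *: 1]mulr1; ring.
Qed.

Lemma time_test_tapprox T s t k : 0 < s -> t < T -> time_test_fun T (tapprox s t k).
Proof.
move=> s0 tT; split; first exact/CkV_derive1n/smooth_tapprox.
apply: (@compactly_supported_sub _ _ _ `[s, t]%classic) => //.
- exact: segment_compact.
- move=> r; apply: contraNP => nr; rewrite tapprox_out//; apply/negP => /andP[h1 h2].
  by apply: nr; rewrite /= in_itv /= !ltW.
- by move=> r /=; rewrite !in_itv /= => /andP[h1 h2]; rewrite (lt_le_trans s0 h1) (le_lt_trans h2 tT).
Qed.

Lemma time_testM T f g : time_test_fun T f -> smooth1 g ->
  time_test_fun T (fun r => f r * g r).
Proof.
move=> [df cf] sg; split; last exact: compactly_supported_mul.
by apply: CkV_derive1n => k; apply: CkVM => //; exact: derive1n_smooth1.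
Qed.

Lemma is_derive_tapprox (s t : R) k (r : R) : is_derive r (1 : R) (tapprox s t k)
  (k.+1%:R * (1 - tbump s t r) ^+ k *
   (flat (flat_step 1) (r - s) * flat 1 (t - r) - flat 1 (r - s) * flat (flat_step 1) (t - r))).
Proof.
have d1 : is_derive r 1 (fun x : R => x - s) 1.
  by apply: is_derive_eq; rewrite subr0.
have d2 : is_derive r 1 (fun x : R => t - x) (-1).
  by have := is_deriveB (is_derive_cst (t : R) r 1) (is_derive_id r (1 : R)); rewrite sub0r.
have e1 := @is_derive1_comp _ (flat 1) (fun x : R => x - s) r _ _ (is_derive_flat 1 _) d1.
have e2 := @is_derive1_comp _ (flat 1) (fun x : R => t - x) r _ _ (is_derive_flat 1 _) d2.
have e3 := is_deriveM e1 e2.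
have e4 : is_derive r 1 (fun x => 1 - tbump s t x) (- (flat (flat_step 1) (r - s) * flat 1 (t - r) -
    flat 1 (r - s) * flat (flat_step 1) (t - r))).
  apply: (@is_derive_eq _ _ _ _ _ _ _ _ (is_deriveB (is_derive_cst (1:R) r 1) e3)).
  by rewrite /= /GRing.scale /=; ring.
have e5 : is_derive r 1 (fun x => (1 - tbump s t x) ^+ k.+1)
   (k.+1%:R * (1 - tbump s t r) ^+ k * - (flat (flat_step 1) (r - s) * flat 1 (t - r) -
    flat 1 (r - s) * flat (flat_step 1) (t - r))).
  rewrite (_ : (fun x => _) = (fun x => 1 - tbump s t x) ^+ k.+1).
    apply: (@is_derive_eq _ _ _ _ _ _ _ _ (is_deriveX k.+1 e4)).
    by rewrite /GRing.scale.
  by apply/funext => x; rewrite exprfctE.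
apply: (@is_derive_eq _ _ _ _ _ _ _ _ (is_deriveB (is_derive_cst (1:R) r 1) e5)).
ring.
Qed.

(** On ]s, t[ the derivative is a nonnegative multiple of (r - s)^-2 - (t - r)^-2, which changes
    sign at the midpoint. This monotonicity lets [concentrate] read the variation off the end
    values. *)
Lemma tapprox_sign s t k r : s < t ->
  (r <= (s + t) / 2 -> 0 <= derive1 (tapprox s t k) r) /\
  ((s + t) / 2 <= r -> derive1 (tapprox s t k) r <= 0).
Proof.
move=> st; have [_ E] := is_derive_tapprox s t k r.
have /andP[b0 b1] := tbump_itv s t r.
rewrite !derive1E E; set c := k.+1%:R * _; have c0 : 0 <= c.
  by rewrite mulr_ge0 ?exprn_ge0 ?subr_ge0.
have X2 : flat_step 1 = 'X^2 :> {poly R} by rewrite /flat_step derivC subr0 mulr1.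
rewrite X2; have [/andP[sr rt]|nr] := boolP (s < r < t); last first.
  have -> : flat 'X^2 (r - s) * flat 1 (t - r) - flat 1 (r - s) * flat 'X^2 (t - r) = 0.
    move: nr; rewrite negb_and -!leNgt => /orP[h|h].
      by rewrite !(@flat_le0 _ (r - s)) ?mul0r ?subrr// subr_le0.
    by rewrite !(@flat_le0 _ (t - r)) ?mulr0 ?subrr// subr_le0.
  by rewrite mulr0.
have a0 : 0 < r - s by rewrite subr_gt0.
have a1 : 0 < t - r by rewrite subr_gt0.
have -> : flat 'X^2 (r - s) * flat 1 (t - r) - flat 1 (r - s) * flat 'X^2 (t - r) =
    expR (- (r - s)^-1) * expR (- (t - r)^-1) * ((r - s) ^- 2 - (t - r) ^- 2).
  rewrite /flat a0 a1 !hornerXn !hornerC !exprVn; ring.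
set d := expR _ * expR _; have d0 : 0 <= d by rewrite mulr_ge0 ?expR_ge0.
split=> h.
  have k1 : 0 <= (r - s) ^- 2 - (t - r) ^- 2.
    rewrite subr_ge0 lef_pV2 ?posrE ?exprn_gt0//.
    by rewrite lerXn2r ?nnegrE ?(ltW a0) ?(ltW a1)//; lra.
  exact: mulr_ge0 c0 (mulr_ge0 d0 k1).
have k1 : (r - s) ^- 2 - (t - r) ^- 2 <= 0.
  rewrite subr_le0 lef_pV2 ?posrE ?exprn_gt0//.
  by rewrite lerXn2r ?nnegrE ?(ltW a0) ?(ltW a1)//; lra.
exact: mulr_ge0_le0 c0 (mulr_ge0_le0 d0 k1).
Qed.

Lemma continuous_integrable_itv (f : R -> R) a b :
  {within `[a, b], continuous f} -> lam.-integrable `[a, b] (EFin \o f).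
Proof.
by move=> cf; apply: continuous_compact_integrable => //; exact: segment_compact.
Qed.

Lemma Rint_itv_split (f : R -> R) a b c : a <= b -> b <= c ->
  lam.-integrable `[a, c] (EFin \o f) ->
  \int[lam]_(x in `[a, c]) f x =
  \int[lam]_(x in `[a, b]) f x + \int[lam]_(x in `[b, c]) f x.
Proof.
move=> ab bc fi.
have := @Rintegral_itvB R f (BLeft a) (BRight c) b fi; rewrite !bnd_simp => /(_ ab bc) E.
have sub : `[b, c] `<=` `[a, c] by move=> x /=; rewrite !in_itv /= => /andP[h ->]; rewrite (le_trans ab h).
rewrite -(@Rintegral_itv_obnd_cbnd R b (BRight c) f); last first.
  apply: integrableS fi => //; apply: subset_trans sub.
  by move=> x /=; rewrite !in_itv /= => /andP[/ltW -> ->].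
by rewrite -E addrC subrK.
Qed.

(** As the derivative of [eta] keeps one sign, the integral of its absolute value is |eta b - eta
    a|, and replacing [y] by [v] costs at most [e] times that. *)
Lemma concentrate (y eta : R -> R) (v e a b : R) : a <= b -> continuous y -> smooth1 eta ->
  (forall r, a <= r <= b -> `|y r - v| <= e) ->
  (forall r, a <= r <= b -> 0 <= derive1 eta r) \/ (forall r, a <= r <= b -> derive1 eta r <= 0) ->
  `|\int[lam]_(r in `[a, b]) (y r * derive1 eta r) - v * (eta b - eta a)| <=
    e * `|eta b - eta a|.
Proof.
move=> ab cy /smooth1_derive1[de ce] yv sg.
have E := Rint_FTC2 ab de ce.
have mI : measurable (`[a, b]%classic : set (measurableTypeR R)) by [].
have ci (f : R -> R) : continuous f -> aeint lam `[a, b]%classic f.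
  by move=> cf; apply: integrable_aeint; apply: continuous_integrable_itv; exact: continuous_subspaceT.
have c1 : continuous (fun r => y r * derive1 eta r).
  by move=> x; exact: cvgM (cy x) (ce x).
have c2 : continuous (fun r => v * derive1 eta r).
  by move=> x; apply: (@cvgMr R _ (nbhs (x:R))); exact: ce.
have i3 := aeintB mI (ci _ c1) (ci _ c2).
rewrite -E -RintZ//; last exact: ci.
rewrite -RintB//; try exact: ci.
apply: le_trans (le_normr_Rint mI i3) _.
have absD : `|\int[lam]_(x in `[a, b]) derive1 eta x| = \int[lam]_(x in `[a, b]) `|derive1 eta x|.
  case: sg => sg.
    rewrite ger0_norm; last by apply: Rint_ge0; apply: aeW => r /=; rewrite in_itv /=; exact: sg.
    by apply: eq_Rintegral => r /[!inE] /=; rewrite in_itv /= => /sg /ger0_norm.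
  rewrite ler0_norm.
    rewrite -RintN//; last exact: ci.
    by apply: eq_Rintegral => r /[!inE] /=; rewrite in_itv /= => /sg /ler0_norm.
  rewrite -oppr_ge0 -RintN//; last exact: ci.
  by apply: Rint_ge0; apply: aeW => r /=; rewrite in_itv /= oppr_ge0; exact: sg.
rewrite absD -RintZ//; last by apply: aeint_abs; exact: ci.
apply: le_Rint => //; first exact: aeint_abs.
  by apply: aeintZ => //; apply: aeint_abs; exact: ci.
apply: aeW => r /=; rewrite in_itv /= => rab; rewrite -mulrBl normrM.
by rewrite ler_wpM2r// yv.
Qed.

(** The derivatives of the cutoffs converge to the difference of the Dirac masses at [s] and [t]. *)
Lemma cvg_concentrate (y : R -> R) s t : s < t -> continuous y ->
  (fun k => \int[lam]_(r in `[s, t]) (y r * derive1 (tapprox s t k) r)) @ \oo --> y s - y t.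
Proof.
move=> st cy; set m := (s + t) / 2.
have sm : s < m by rewrite /m; lra.
have mt : m < t by rewrite /m; lra.
have [Y HY] : exists Y, forall r, s <= r <= t -> `|y r| <= Y.
  have /compact_bounded[K [Kr HK]] : compact (y @` `[s, t]%classic).
    by apply: continuous_compact; [exact: continuous_subspaceT|exact: segment_compact].
  exists (K + 1) => r rst; apply: (HK (K + 1)); first by rewrite ltrDl.
  by exists r.
have Y0 : 0 <= Y by apply: le_trans (HY s _) => //; rewrite lexx ltW.
apply/cvgrPdist_le => e e0.
have e4 : 0 < e / 8 by rewrite divr_gt0.
have [d d0 Hd] : exists2 d : R, 0 < d & forall r p, (p = s \/ p = t) -> `|r - p| <= d -> `|y r - y p| <= e / 8.
  have H p : exists2 d, 0 < d & forall r, `|r - p| <= d -> `|y r - y p| <= e / 8.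
    have := cy p => /cvgrPdist_le/(_ _ e4) /nbhs_ballP[d /= d0 Hd].
    exists (d / 2); first by rewrite divr_gt0.
    move=> r rp; rewrite distrC; apply: Hd; rewrite /ball /= distrC.
    by apply: le_lt_trans rp _; rewrite ltr_pdivrMr// ltr_pMr// ltr1n.
  have [d1 d10 H1] := H s; have [d2 d20 H2] := H t.
  exists (Num.min d1 d2); first by rewrite lt_min d10.
  by move=> r p [->|->]; rewrite le_min => /andP[h1 h2]; [exact: H1|exact: H2].
(* [dl] respects the modulus of continuity at both ends and is small enough for s + dl < m < t -
   dl. *)
pose dl := Num.min d ((m - s) / 2).
have dl0 : 0 < dl by rewrite lt_min d0 divr_gt0 ?subr_gt0.
have dld : dl <= d by rewrite ge_min lexx.
have dlm : dl <= (m - s) / 2 by rewrite ge_min lexx orbT.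
have e1 : 0 < e / (16 * (Y + 1)) by rewrite divr_gt0// mulr_gt0// ltr_wpDl.
have near1 p : s < p < t -> \forall k \near \oo, `|1 - tapprox s t k p| <= e / (16 * (Y + 1)).
  by move=> pst; have := @cvg_tapprox s t p; rewrite pst => /cvgrPdist_le; apply.
have n1 : s < s + dl < t by apply/andP; split; rewrite /m in dlm *; lra.
have n2 : s < m < t by rewrite sm mt.
have n3 : s < t - dl < t by apply/andP; split; rewrite /m in dlm *; lra.
apply: filterS3 (near1 _ n1) (near1 _ n2) (near1 _ n3) => k k1 k2 k3.
have se : smooth1 (tapprox s t k) by exact: smooth_tapprox.
have [de ce] := smooth1_derive1 se.
have c1 : continuous (fun r => y r * derive1 (tapprox s t k) r).
  by move=> x; exact: cvgM (cy x) (ce x).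
have ci a b : lam.-integrable `[a, b] (EFin \o (fun r => y r * derive1 (tapprox s t k) r)).
  by apply: continuous_integrable_itv; exact: continuous_subspaceT.
have o1 : s <= s + dl by lra.
have o2 : s + dl <= m by rewrite /m in dlm *; lra.
have o3 : m <= t - dl by rewrite /m in dlm *; lra.
have o4 : t - dl <= t by lra.
rewrite (@Rint_itv_split _ s m t (ltW sm) (ltW mt))//.
rewrite (@Rint_itv_split _ s (s + dl) m)// (@Rint_itv_split _ m (t - dl) t)//.
have q1 := @concentrate y (tapprox s t k) (y s) (e / 8) s (s + dl) o1 cy se.
have q2 := @concentrate y (tapprox s t k) (y s) (2 * Y) (s + dl) m o2 cy se.
have q3 := @concentrate y (tapprox s t k) (y t) (2 * Y) m (t - dl) o3 cy se.
have q4 := @concentrate y (tapprox s t k) (y t) (e / 8) (t - dl) t o4 cy se.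
have bnd r p : s <= r <= t -> s <= p <= t -> `|y r - y p| <= 2 * Y.
  move=> rst pst; apply: le_trans (ler_normB _ _) _.
  by rewrite mulr_natl mulr2n lerD ?HY.
have stm : s <= s <= t by rewrite lexx ltW.
have tst : s <= t <= t by rewrite lexx ltW.
have {}q1 : `|\int[lam]_(r in `[s, (s + dl)]) (y r * derive1 (tapprox s t k) r) -
    y s * (tapprox s t k (s + dl) - tapprox s t k s)| <= e / 8 * `|tapprox s t k (s + dl) - tapprox s t k s|.
  apply: q1.
    move=> r /andP[h1 h2]; apply: Hd; first by left.
    by rewrite ger0_norm ?subr_ge0// lerBlDl (le_trans h2)// lerD2l.
  by left=> r /andP[h1 h2]; apply: (tapprox_sign _ _ st).1; exact: le_trans h2 o2.
have {}q2 : `|\int[lam]_(r in `[(s + dl), m]) (y r * derive1 (tapprox s t k) r) -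
    y s * (tapprox s t k m - tapprox s t k (s + dl))| <= 2 * Y * `|tapprox s t k m - tapprox s t k (s + dl)|.
  apply: q2.
    move=> r /andP[h1 h2]; apply: bnd => //.
    by rewrite (le_trans o1 h1) (le_trans h2 (ltW mt)).
  by left=> r /andP[h1 h2]; apply: (tapprox_sign _ _ st).1.
have {}q3 : `|\int[lam]_(r in `[m, (t - dl)]) (y r * derive1 (tapprox s t k) r) -
    y t * (tapprox s t k (t - dl) - tapprox s t k m)| <= 2 * Y * `|tapprox s t k (t - dl) - tapprox s t k m|.
  apply: q3.
    move=> r /andP[h1 h2]; apply: bnd => //.
    by rewrite (le_trans (ltW sm) h1) (le_trans h2 o4).
  by right=> r /andP[h1 h2]; apply: (tapprox_sign _ _ st).2.
have {}q4 : `|\int[lam]_(r in `[(t - dl), t]) (y r * derive1 (tapprox s t k) r) -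
    y t * (tapprox s t k t - tapprox s t k (t - dl))| <= e / 8 * `|tapprox s t k t - tapprox s t k (t - dl)|.
  apply: q4.
    move=> r /andP[h1 h2]; apply: Hd; first by right.
    rewrite ler0_norm ?subr_le0// opprB lerBlDl -lerBlDr.
    by apply: le_trans h1; rewrite lerD2l lerN2.
  by right=> r /andP[h1 h2]; apply: (tapprox_sign _ _ st).2; exact: le_trans o3 h1.
have z1 : tapprox s t k s = 0 by rewrite tapprox_out// ltxx.
have z2 : tapprox s t k t = 0 by rewrite tapprox_out// ltxx andbF.
rewrite z1 in q1; rewrite z2 in q4.
apply: (concentrate_arith (ltW e0) Y0 (HY s stm) (HY t tst) _ _ _ _ k3 k2 k1 q1 q2 q3 q4);
  rewrite ?tapprox_itv//.
rewrite mulrA ler_pdivrMr ?mulr_gt0// ?ltr_wpDl//.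
have -> : e / 16 * (16 * (Y + 1)) = (Y + 1) * e by field.
by apply: ler_wpM2r; [exact: ltW|rewrite lerDl].
Qed.

End time_tests.

(** * Time primitives and averages *)

Section time_primitives.
Context (R : realType) (T : R).
Hypothesis T0 : 0 < T.
Local Notation lam := (@lebesgue_measure R).
Local Notation I := (`]0, T[%classic : set (measurableTypeR R)).

Let mI : measurable I. Proof. exact: measurable_itv. Qed.

Lemma I_fin : (lam I < +oo)%E.
Proof. by rewrite lebesgue_measure_itv /=; case: ifP => _; rewrite -?EFinB ltry. Qed.

Lemma aeint_cst_I (c : R) : aeint lam I (fun=> c).
Proof.
apply: integrable_aeint; apply: measurable_bounded_integrable => //.
  exact: I_fin.
by exists `|c|; split; [exact: num_real|move=> M M1 x _ /=; exact: ltW].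
Qed.

Lemma continuous_aemeas (f : R -> R) : continuous f -> aemeas lam I f.
Proof.
by move=> cf; apply: measurable_aemeas; exact: measurable_funS (continuous_measurable_fun cf).
Qed.

(* Du Bois-Reymond: test against approximations of the indicator of ]s, t[. *)
Lemma weak_derivative_FTC (y q : R -> R) : continuous y -> aeint lam I q ->
  (forall eta, time_test_fun T eta -> \int[lam]_(r in I) (q r * eta r) =
     - \int[lam]_(r in I) (y r * derive1 eta r)) ->
  forall s t, 0 < s -> s < t -> t < T ->
  y t - y s = \int[lam]_(r in I) (q r * ((s < r < t)%R : bool)%:R).
Proof.
move=> cy qi H s t s0 st tT.
have tt k := @time_test_tapprox R T s t k s0 tT.
have E k : \int[lam]_(r in I) (y r * derive1 (tapprox s t k) r) =
    \int[lam]_(r in `[s, t]) (y r * derive1 (tapprox s t k) r).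
  rewrite Rintegral_mkcond [RHS]Rintegral_mkcond; apply: eq_Rintegral => r _.
  rewrite /patch; case: ifPn; rewrite ?inE ?notin_setE /= in_itv /= => rI; case: ifPn => //.
    rewrite notin_setE /= in_itv /= => nr.
    have -> : derive1 (tapprox s t k) r = 0; last by rewrite mulr0.
    rewrite derive1E; have [_ ->] := is_derive_tapprox s t k r.
    have [rs|sr] := leP r s.
      by rewrite !(@flat_le0 _ _ (r - s)) ?subr_le0// !mul0r subrr mulr0.
    have tr : t <= r by rewrite leNgt; apply/negP => h; apply: nr; rewrite !ltW.
    by rewrite !(@flat_le0 _ _ (t - r)) ?subr_le0// !mulr0 subrr mulr0.
  rewrite inE /= in_itv /= => /andP[h1 h2]; exfalso; apply: rI.
  by rewrite (lt_le_trans s0 h1) (le_lt_trans h2 tT).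
have L1 : (fun k => \int[lam]_(r in I) (q r * tapprox s t k r)) @ \oo --> y t - y s.
  have EE : (fun k : nat => \int[lam]_(r in I) (q r * tapprox s t k r)) =
      (fun k => - \int[lam]_(r in `[s, t]) (y r * derive1 (tapprox s t k) r)).
    by apply/funext => k; rewrite H// E.
  by rewrite EE -opprB; exact: cvgN (cvg_concentrate st cy).
have [_ L2] : aeint lam I (fun r => q r * ((s < r < t)%R : bool)%:R) /\
   (fun k => \int[lam]_(r in I) (q r * tapprox s t k r)) @ \oo -->
     \int[lam]_(r in I) (q r * ((s < r < t)%R : bool)%:R).
  apply: (@dominated_cvg_Rint _ _ _ lam I mI _ _ (fun r => `|q r|)).
  - move=> k; apply: aemeasM => //; first exact: aeint_aemeas.
    apply: continuous_aemeas; exact: (smooth_tapprox s t k 0%N).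
  - exact: aeint_abs.
  - move=> k; apply: aeW => r _; rewrite normrM ler_piMr//.
    by have /andP[? ?] := tapprox_itv s t k r; rewrite ger0_norm.
  - apply: aeW => r _; apply: cvgMr; exact: cvg_tapprox.
exact: (cvg_unique _ L1 L2).
Qed.

Section primitive.
Variable q : R -> R.
Hypothesis qi : lam.-integrable setT (EFin \o q).
Hypothesis q0 : forall t, ~ I t -> q t = 0.

(* Based at -2, so that shifts of [[0, T]] by at most 1 stay in range. *)
Definition prim t := \int[lam]_(r in `[-2, t]) q r.

Let qS (a b : R) : lam.-integrable `[a, b] (EFin \o q).
Proof. exact: integrableS qi. Qed.

Lemma prim_le0 t : t <= 0 -> prim t = 0.
Proof.
move=> t0; rewrite /prim -(@Rint0 _ _ _ lam `[-2, t]%classic)//.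
apply: eq_Rintegral => r; rewrite inE /= in_itv /= => /andP[_ rt].
by apply: q0; rewrite /= in_itv /= => /andP[]; rewrite ltNge (le_trans rt t0).
Qed.

Lemma primB s t : -2 <= s -> s <= t -> prim t - prim s = \int[lam]_(r in `[s, t]) q r.
Proof. by move=> h1 h2; rewrite /prim (Rint_itv_split h1 h2)// addrC addKr. Qed.

Lemma primBI s t : -2 <= s -> s <= t ->
  prim t - prim s = \int[lam]_(r in I) (q r * ((s < r < t)%R : bool)%:R).
Proof.
move=> h1 h2; rewrite primB// -Rintegral_itv_obnd_cbnd; last by apply: integrableS qi.
rewrite -Rintegral_itv_bndo_bndc; last by apply: integrableS qi.
rewrite Rintegral_mkcond [RHS]Rintegral_mkcond; apply: eq_Rintegral => r _.
rewrite /patch; case: ifPn; rewrite ?inE ?notin_setE /= in_itv /= => rI; case: ifPn;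
  rewrite ?inE ?notin_setE /= ?in_itv /= => rI'.
- by rewrite rI mulr1.
- by rewrite q0.
- by move/negP : rI => /negbTE ->; rewrite mulr0.
- by [].
Qed.

Lemma prim_geT t : T <= t -> prim t = \int[lam]_(r in I) q r.
Proof.
move=> tT; have := @primBI 0 t _ (le_trans (ltW T0) tT).
rewrite (prim_le0 (lexx 0)) subr0 => -> //.
apply: eq_Rintegral => r; rewrite inE /= in_itv /= => /andP[h1 h2].
by rewrite h1 (lt_le_trans h2 tT) mulr1.
Qed.

Lemma continuous_prim x : -2 < x -> {for x, continuous prim}.
Proof.
move=> x2; have ax : -2 <= x + 1 by lra.
have := parameterized_integral_continuous ax (qS (-2) (x + 1)).
rewrite continuous_within_itvP; last by lra.
by case=> + _ _; apply; rewrite in_itv /= x2 /=; lra.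
Qed.

Lemma derivable_prim : {ae lam, forall x, -2 < x -> derivable prim x 1 /\ derive1 prim x = q x}.
Proof.
have loc : locally_integrable [set: R] q.
  by apply: open_integrable_locally => //; exact: openT.
have := @FTC1 R q (BLeft (-2)) (fun y => qS (-2) y) loc.
apply: filterS; first exact: (ae_filter_ringOfSetsType lam).
move=> x H x2.
by apply: H; rewrite /= lte_fin.
Qed.

End primitive.

(** With [G] a primitive of [F], the integral of the increments is (G(T) - G(T - h)) - (G(0) -
    G(-h)); divided by h, the two terms tend to F(T) and F(0). *)
Lemma shift_avg (F : R -> R) : (forall x, -2 < x -> {for x, continuous F}) ->
  (fun k => k.+1%:R * \int[lam]_(t in I) (F t - F (t - k.+1%:R^-1))) @ \oo --> F T - F 0.
Proof.
(* [F] is continuous only beyond -2, and shifts by at most 1 lead from [0, T] down to -1; the base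
   -3/2 leaves room on both sides. *)
move=> cF; pose G x := \int[lam]_(r in `[-3/2, x]) F r.
have Fi u : lam.-integrable `[-3/2, u] (EFin \o F).
  apply: continuous_integrable_itv; apply: continuous_in_subspaceT => x.
  by rewrite inE /= in_itv /= => /andP[h _]; apply: cF; lra.
have dG x : -3/2 < x -> derivable G x 1 /\ derive1 G x = F x.
  move=> x2; apply: (@continuous_FTC1_closed _ F (-3/2) x (x + 1)) => //; first lra.
  by apply: cF; lra.
pose h k : R := k.+1%:R^-1.
have h0 k : 0 < h k by rewrite invr_gt0.
have h1 k : h k <= 1 by rewrite invf_le1// ler1n.
have cG x : -3/2 < x -> {for x, continuous G}.
  by move=> x2; apply/differentiable_continuous/derivable1_diffP; have [] := dG x x2.
have E k : \int[lam]_(t in I) (F t - F (t - h k)) = (G T - G (T - h k)) - (G 0 - G (0 - h k)).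
  have dK x : -2^-1 < x -> derivable (fun t => G t - G (t - h k)) x 1 /\
      derive1 (fun t => G t - G (t - h k)) x = F x - F (x - h k).
    move=> x2; have b1 : -3/2 < x by lra.
    have b2 : -3/2 < x - h k by have := h1 k; lra.
    have [e1 e1'] := dG _ b1; have [e2 e2'] := dG _ b2.
    have i1 : is_derive x (1 : R) G (F x).
      by apply: DeriveDef; [exact: e1|rewrite -derive1E; exact: e1'].
    have i2 : is_derive (x - h k) (1 : R) G (F (x - h k)).
      by apply: DeriveDef; [exact: e2|rewrite -derive1E; exact: e2'].
    have i3 : is_derive x (1 : R) (fun t : R => t - h k) 1.
      by have := is_deriveB (is_derive_id x (1 : R)) (is_derive_cst (h k) x (1 : R)); rewrite subr0.
    have i4 := @is_derive1_comp _ G (fun t : R => t - h k) x _ _ i2 i3.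
    have [j1 j2] := is_deriveB i1 i4; split; first exact: j1.
    by rewrite derive1E; rewrite mulr1 in j2; exact: j2.
  have cK x : -2^-1 < x -> {for x, continuous (fun t => G t - G (t - h k))}.
    by move=> x2; apply/differentiable_continuous/derivable1_diffP; have [] := dK x x2.
  have cFF x : -1 < x -> {for x, continuous (fun t => F t - F (t - h k))}.
    move=> x2; apply: (@cvgB R R R (nbhs (x : R))); first by apply: cF; lra.
    apply: (@cvg_comp _ _ _ (fun t => t - h k) F _ (nbhs (x - h k))).
      exact: (@cvgB R R R (nbhs (x : R)) _ _ _ _ _ cvg_id (cvg_cst _)).
    by apply: cF; have := h1 k; lra.
  transitivity (\int[lam]_(t in `[0, T]) (F t - F (t - h k))).
    have ii : lam.-integrable `[0, T] (EFin \o (fun t => F t - F (t - h k))).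
      apply: continuous_integrable_itv; apply: continuous_in_subspaceT => x.
      by rewrite inE /= in_itv /= => /andP[x2 _]; apply: cFF; lra.
    rewrite -Rintegral_itv_obnd_cbnd; last first.
      by apply: integrableS ii => // x /=; rewrite !in_itv /= => /andP[/ltW -> ->].
    rewrite -Rintegral_itv_bndo_bndc//.
    by apply: integrableS ii => // x /=; rewrite !in_itv /= => /andP[/ltW -> /ltW ->].
  rewrite /Rintegral (@continuous_FTC2 _ _ (fun t => G t - G (t - h k)))//.
  - apply: continuous_in_subspaceT => x.
    by rewrite inE /= in_itv /= => /andP[x2 _]; apply: cFF; lra.
  - split.
    + by move=> x; rewrite in_itv /= => /andP[x2 _]; apply: (dK x _).1; lra.
    + by apply: cvg_at_right_filter; apply: cK; lra.
    + by apply: cvg_at_left_filter; apply: cK; move: T0; lra.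
  - by move=> x; rewrite in_itv /= => /andP[x2 _]; apply: (dK x _).2; lra.
have hcvg : (- h k) @[k --> \oo] --> (0 : R)^'.
  move=> A /nbhs_ballP[e /= e0 eA].
  have : \forall k \near \oo, h k < e by apply: near_infty_natSinv_lt (PosNum e0).
  apply: filterS => k hk; apply: eA; last by rewrite oppr_eq0 gt_eqF.
  by rewrite /ball /= sub0r opprK gtr0_norm.
have lim x : -3/2 < x -> (fun k => k.+1%:R * (G x - G (x - h k))) @ \oo --> F x.
  move=> x2; have [dx Dx] := dG x x2.
  have : (fun t => t^-1 *: ((G \o shift x) (t *: 1) - G x)) @ 0^' --> F x.
    by rewrite -Dx derive1E; exact: dx.
  move=> /(cvg_comp _ _ hcvg); apply: cvg_trans; apply: near_eq_cvg; apply: nearW => k /=.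
  rewrite invrN invrK scaleNr -scalerN opprB; congr (_ * (_ - G _)).
  by rewrite [_ *: 1]mulr1 addrC.
have l0 : -3/2 < 0 :> R by lra.
have lT : -3/2 < T by move: T0; lra.
have EE : (fun k : nat => k.+1%:R * \int[lam]_(t in I) (F t - F (t - k.+1%:R^-1))) =
    (fun k => k.+1%:R * (G T - G (T - h k)) - k.+1%:R * (G 0 - G (0 - h k))).
  by apply/funext => k; rewrite E mulrBr.
by rewrite EE; exact: cvgB (lim T lT) (lim 0 l0).
Qed.

(** Boundedness gives the difference quotients the common bound [M], Lebesgue differentiation gives
    their pointwise limit, and dominated convergence concludes. *)
Lemma steklov_bounded (q : R -> R) (M : R) (A : set R) :
  measurable (A : set (measurableTypeR R)) -> lam.-integrable setT (EFin \o q) -> (forall t, ~ I t -> q t = 0) ->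
  (forall t, `|q t| <= M) ->
  (fun k => \int[lam]_(t in I) (\1_A t * (k.+1%:R * (prim q t - prim q (t - k.+1%:R^-1))))) @ \oo -->
  \int[lam]_(t in I) (\1_A t * q t).
Proof.
move=> mA qi q0 qM.
pose h k : R := k.+1%:R^-1.
have h0 k : 0 < h k by rewrite invr_gt0.
have h1 k : h k <= 1 by rewrite invf_le1// ler1n.
have M0 : 0 <= M by apply: le_trans (qM 0).
have qS (a b : R) : lam.-integrable `[a, b] (EFin \o q) by exact: integrableS qi.
have [] := @dominated_cvg_Rint _ _ _ lam I mI
  (fun k t => \1_A t * (k.+1%:R * (prim q t - prim q (t - h k)))) (fun t => \1_A t * q t) (fun=> M).
- move=> k; apply: measurable_aemeas; apply: measurable_funM; first exact: measurable_indic.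
  apply: measurable_funM; first exact: measurable_cst.
  apply: open_continuous_measurable_fun; first exact: interval_open.
  move=> t; rewrite inE /= in_itv /= => /andP[t0 tT].
  apply: (@cvgB R R R (nbhs (t : R))); first by apply: continuous_prim => //; lra.
  apply: (@cvg_comp _ _ _ (fun t => t - h k) (prim q) _ (nbhs (t - h k))).
    exact: (@cvgB R R R (nbhs (t : R)) _ _ _ _ _ cvg_id (cvg_cst _)).
  by apply: continuous_prim => //; have := h1 k; lra.
- exact: aeint_cst_I.
- move=> k; apply: aeW => t; rewrite /= in_itv /= => /andP[t0 tT].
  rewrite normrM; apply: (@le_trans _ _ (1 * M)); last by rewrite mul1r.
  apply: ler_pM => //; first by rewrite indicE; case: (_ \in _); rewrite ?normr1 ?normr0.
  rewrite primB//; last 2 first.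
  + by have := h1 k; lra.
  + by have := h0 k; lra.
  rewrite normrM ger0_norm// mulrC -ler_pdivlMr//.
  apply: le_trans (le_normr_Rint _ (integrable_aeint (qS _ _))) _ => //.
  apply: le_trans (le_Rint (g := fun=> M) _ _ _ _) _ => //.
  + by apply: aeint_abs; apply: integrable_aeint.
  + by apply: integrable_aeint; apply: continuous_integrable_itv; apply: continuous_subspaceT => ?; exact: cvg_cst.
  + exact: aeW.
  rewrite Rintegral_cst//= lebesgue_measure_itv /= lte_fin.
  by rewrite ifT ?ltrBlDr ?ltrDl//= opprB addrC subrK.
- have := derivable_prim qi; apply: filterS; first exact: (ae_filter_ringOfSetsType lam).
  move=> t H; rewrite /= in_itv /= => /andP[t0 tT].
  have [dt Dt] : derivable (prim q) t 1 /\ derive1 (prim q) t = q t by apply: H; lra.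
  apply: cvgMr.
  have hcvg : (- h k) @[k --> \oo] --> (0 : R)^'.
    move=> B /nbhs_ballP[e /= e0 eB].
    have : \forall k \near \oo, h k < e by apply: near_infty_natSinv_lt (PosNum e0).
    apply: filterS => k hk; apply: eB; last by rewrite oppr_eq0 gt_eqF.
    by rewrite /ball /= sub0r opprK gtr0_norm.
  have : (fun s => s^-1 *: ((prim q \o shift t) (s *: 1) - prim q t)) @ 0^' --> q t.
    by rewrite -Dt derive1E; exact: dt.
  move=> /(cvg_comp _ _ hcvg); apply: cvg_trans; apply: near_eq_cvg; apply: nearW => k /=.
  rewrite invrN invrK scaleNr -scalerN opprB; congr (_ * (_ - prim q _)).
  by rewrite [_ *: 1]mulr1 addrC.
by [].
Qed.

End time_primitives.

Lemma cvg_sum_seq (R : realType) (J : Type) (s : seq J) (f : J -> nat -> R) (l : J -> R) :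
  (forall j, f j @ \oo --> l j) ->
  (fun k => \sum_(j <- s) f j k) @ \oo --> \sum_(j <- s) l j.
Proof.
move=> fl; elim: s => [|j s IH].
  by rewrite big_nil; under eq_fun do rewrite big_nil; exact: cvg_cst.
by rewrite big_cons; under eq_fun do rewrite big_cons; exact: cvgD.
Qed.

(** * Convergence of the averages for integrable functions *)

Section steklov_averages.
Context (R : realType) (T : R).
Hypothesis T0 : 0 < T.
Local Notation lam := (@lebesgue_measure R).
Local Notation I := (`]0, T[%classic : set (measurableTypeR R)).

Let mI : measurable I. Proof. exact: measurable_itv. Qed.

Let h k : R := k.+1%:R^-1.
Let h0 k : 0 < h k. Proof. by rewrite invr_gt0. Qed.
Let h1 k : h k <= 1. Proof. by rewrite invf_le1// ler1n. Qed.

Lemma integrable_setT_aeint (f : R -> R) : lam.-integrable setT (EFin \o f) -> aeint lam I f.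
Proof. by move=> fi; apply: integrable_aeint; exact: integrableS fi. Qed.

Lemma aeint_continuous_I (f : R -> R) : (forall x, -1 < x -> {for x, continuous f}) ->
  aeint lam I f.
Proof.
move=> cf; have ii : lam.-integrable `[0, T] (EFin \o f).
  apply: continuous_integrable_itv; apply: continuous_in_subspaceT => x.
  by rewrite inE /= in_itv /= => /andP[x2 _]; apply: cf; lra.
apply: integrable_aeint; apply: integrableS ii => //.
by move=> x /=; rewrite !in_itv /= => /andP[/ltW -> /ltW ->].
Qed.

Lemma aeint_prim_incr (q : R -> R) k : lam.-integrable setT (EFin \o q) ->
  aeint lam I (fun t => prim q t - prim q (t - h k)).
Proof.
move=> qi; have cp x : -1 < x -> {for x, continuous (fun t => prim q t - prim q (t - h k))}.
  move=> x1; apply: (@cvgB R R R (nbhs (x : R))); first by apply: continuous_prim => //; lra.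
  apply: (@cvg_comp _ _ _ (fun t => t - h k) (prim q) _ (nbhs (x - h k))).
    exact: (@cvgB R R R (nbhs (x : R)) _ _ _ _ _ cvg_id (cvg_cst _)).
  by apply: continuous_prim => //; have := h1 k; lra.
exact: aeint_continuous_I.
Qed.

Lemma norm_prim_incr (q : R -> R) t k : lam.-integrable setT (EFin \o q) -> -1 <= t ->
  `|prim q t - prim q (t - h k)| <=
  prim (fun r => `|q r|) t - prim (fun r => `|q r|) (t - h k).
Proof.
move=> qi t1; have b1 : -2 <= t - h k by have := h1 k; lra.
have b2 : t - h k <= t by rewrite lerBlDr lerDl ltW.
have qa : lam.-integrable setT (EFin \o (fun r => `|q r|)) by exact: integrable_norm.
rewrite !primB//; apply: le_normr_Rint => //.
by apply: integrable_aeint; exact: integrableS qi.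
Qed.

Lemma aeint_indicM (A : set R) (f : R -> R) : measurable (A : set (measurableTypeR R)) ->
  aeint lam I f -> aeint lam I (fun t => \1_A t * f t).
Proof.
move=> mA fi; apply: aeint_dominated (aeint_abs fi) _ => //.
  apply: aemeasM => //; last exact: aeint_aemeas.
  by apply: measurable_aemeas; exact: measurable_indic.
apply: aeW => t _; rewrite normrM ler_piMl// indicE.
by case: (_ \in _); rewrite ?normr1 ?normr0.
Qed.

(** Truncation at height M reduces to [steklov_bounded]. The averages of the tail are dominated by
    those of its absolute value, whose integrals converge by [shift_avg] to the small L1 norm of the
    tail. *)
Lemma steklov (q : R -> R) (A : set R) :
  measurable (A : set (measurableTypeR R)) -> lam.-integrable setT (EFin \o q) ->
  (forall t, ~ I t -> q t = 0) ->
  (fun k => \int[lam]_(t in I) (\1_A t * (k.+1%:R * (prim q t - prim q (t - k.+1%:R^-1))))) @ \oo -->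
  \int[lam]_(t in I) (\1_A t * q t).
Proof.
move=> mA qi q0.
have mq : measurable_fun setT q by apply/measurable_EFinP; exact: measurable_int qi.
pose b (M : nat) (t : R) : bool := `|q t| <= M%:R.
have mb M : measurable_fun [set: measurableTypeR R] (b M).
  apply: measurable_fun_ler; last exact: measurable_cst.
  exact: measurableT_comp.
pose q1 M t := if b M t then q t else 0.
pose q2 M t := if b M t then 0 else q t.
have qE M t : q t = q1 M t + q2 M t by rewrite /q1 /q2; case: ifP; rewrite ?addr0 ?add0r.
have mq1 M : measurable_fun [set: measurableTypeR R] (q1 M) by apply: measurable_fun_ifT.
have mq2 M : measurable_fun [set: measurableTypeR R] (q2 M) by apply: measurable_fun_ifT.
have q1i M : lam.-integrable setT (EFin \o q1 M).
  apply: le_integrable qi => //; first exact/measurable_EFinP.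
  by move=> x _ /=; rewrite lee_fin /q1; case: ifP => // _; rewrite normr0.
have q2i M : lam.-integrable setT (EFin \o q2 M).
  apply: le_integrable qi => //; first exact/measurable_EFinP.
  by move=> x _ /=; rewrite lee_fin /q2; case: ifP => // _; rewrite normr0.
have q10 M t : ~ I t -> q1 M t = 0 by move=> /q0 qt; rewrite /q1 qt if_same.
have q20 M t : ~ I t -> q2 M t = 0 by move=> /q0 qt; rewrite /q2 qt if_same.
have q1M M t : `|q1 M t| <= M%:R by rewrite /q1; case: ifP => //; rewrite normr0.
have tail : (fun M => \int[lam]_(t in I) `|q2 M t|) @ \oo --> (0 : R).
  have [] := @dominated_cvg_Rint _ _ _ lam I mI (fun M t => `|q2 M t|) (fun=> 0) (fun t => `|q t|).
  - move=> M; apply: measurable_aemeas; apply: measurableT_comp => //.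
    exact: measurable_funTS (mq2 M).
  - by apply: aeint_abs; exact: integrable_setT_aeint.
  - by move=> M; apply: aeW => t _; rewrite normr_id /q2; case: ifP; rewrite ?normr0.
  - apply: aeW => t _; apply: cvg_near_cst.
    near=> M; rewrite /q2 ifT ?normr0// /b.
    by near: M; exact: nbhs_infty_ger.
  by rewrite Rint0.
apply/cvgrPdist_le => e e0.
have e4 : 0 < e / 4 by rewrite divr_gt0.
have [M HM] : exists M, \int[lam]_(t in I) `|q2 M t| <= e / 4.
  have /cvgrPdist_le/(_ _ e4)[M _ /(_ M (leqnn M))] := tail.
  by rewrite sub0r normrN => /(le_trans (ler_norm _)) ?; exists M.
pose q2a t := `|q2 M t|.
have q2ai : lam.-integrable setT (EFin \o q2a) by exact: integrable_norm.
have q2a0 t : ~ I t -> q2a t = 0 by move=> /(q20 M) qt; rewrite /q2a qt normr0.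
have S1 := @steklov_bounded R T (q1 M) M%:R A mA (q1i M) (q10 M) (q1M M).
have S2 := @shift_avg R T T0 (prim q2a) (@continuous_prim _ _ q2ai).
rewrite (prim_geT T0 q2ai q2a0 (lexx _)) (prim_le0 q2a0 (lexx 0)) subr0 in S2.
move: S1 S2 => /cvgrPdist_le/(_ _ e4) S1 /cvgrPdist_le/(_ _ e4) S2.
apply: filterS2 S1 S2 => k.
have E1 : \int[lam]_(t in I) (\1_A t * q t) = \int[lam]_(t in I) (\1_A t * q1 M t) +
    \int[lam]_(t in I) (\1_A t * q2 M t).
  rewrite -RintD//; try by apply: aeint_indicM => //; exact: integrable_setT_aeint.
  by apply: eq_Rintegral => t _; rewrite -mulrDr -qE.
have iq p : lam.-integrable setT (EFin \o p) ->
    aeint lam I (fun t => \1_A t * (k.+1%:R * (prim p t - prim p (t - k.+1%:R^-1)))).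
  by move=> pi; apply: aeint_indicM => //; apply: aeintZ => //; exact: (aeint_prim_incr k pi).
have E2 : \int[lam]_(t in I) (\1_A t * (k.+1%:R * (prim q t - prim q (t - k.+1%:R^-1)))) =
    \int[lam]_(t in I) (\1_A t * (k.+1%:R * (prim (q1 M) t - prim (q1 M) (t - k.+1%:R^-1)))) +
    \int[lam]_(t in I) (\1_A t * (k.+1%:R * (prim (q2 M) t - prim (q2 M) (t - k.+1%:R^-1)))).
  rewrite -RintD//; [|exact: iq|exact: iq].
  apply: eq_Rintegral => t _.
  have pE s : prim q s = prim (q1 M) s + prim (q2 M) s.
    rewrite /prim -RintD//; try by apply: integrable_aeint; exact: integrableS (q1i M).
      by apply: eq_Rintegral => r _; exact: qE.
    by apply: integrable_aeint; exact: integrableS (q2i M).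
  by rewrite !pE; ring.
have B1 : `|\int[lam]_(t in I) (\1_A t * q2 M t)| <= e / 4.
  apply: le_trans HM; apply: le_trans (le_normr_Rint mI _) _.
    by apply: aeint_indicM => //; exact: integrable_setT_aeint.
  apply: le_Rint => //.
  - by apply: aeint_abs; apply: aeint_indicM => //; exact: integrable_setT_aeint.
  - exact: integrable_setT_aeint.
  - apply: aeW => t _; rewrite normrM ler_piMl// indicE.
    by case: (_ \in _); rewrite ?normr1 ?normr0.
have B2 : `|\int[lam]_(t in I) (\1_A t * (k.+1%:R * (prim (q2 M) t - prim (q2 M) (t - k.+1%:R^-1))))| <=
    k.+1%:R * \int[lam]_(t in I) (prim q2a t - prim q2a (t - k.+1%:R^-1)).
  apply: le_trans (le_normr_Rint mI (iq _ (q2i M))) _.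
  rewrite -RintZ//; last exact: (aeint_prim_incr k q2ai).
  apply: le_Rint => //.
  - by apply: aeint_abs; exact: iq.
  - by apply: aeintZ => //; exact: (aeint_prim_incr k q2ai).
  - apply: aeW => t; rewrite /= in_itv /= => /andP[t0 _].
    rewrite normrM (normrM k.+1%:R) (ger0_norm (ler0n _ _)).
    apply: (@le_trans _ _ (1 * (k.+1%:R * `|prim (q2 M) t - prim (q2 M) (t - k.+1%:R^-1)|))).
      by apply: ler_wpM2r; [rewrite mulr_ge0|rewrite indicE; case: (_ \in _); rewrite ?normr1 ?normr0].
    rewrite mul1r ler_wpM2l//; apply: (norm_prim_incr _ (q2i M)).
    by apply: le_trans (ltW t0); rewrite lerN10.
(* Four quarters of [e]: one for the bounded part, one for the tail, and two for the averaged tail,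
   whose bound is within e / 4 of a limit that is at most e / 4. *)
rewrite E1 E2; move: B1 B2 HM.
move: (\int[lam]_(t in I) (\1_A t * q1 M t)) => K1.
move: (\int[lam]_(t in I) (\1_A t * q2 M t)) => K2.
move: (\int[lam]_(t in I) (\1_A t * (k.+1%:R * (prim (q1 M) t - prim (q1 M) (t - k.+1%:R^-1))))) => J2.
move: (\int[lam]_(t in I) (\1_A t * (k.+1%:R * (prim (q2 M) t - prim (q2 M) (t - k.+1%:R^-1))))) => J3.
move: (_ * \int[lam]_(t in I) (prim q2a t - prim q2a (t - k.+1%:R^-1))) => J1.
move: (\int[lam]_(t in I) q2a t) => J.
clear; rewrite !ler_norml => /andP[? ?] /andP[? ?] ? /andP[? ?] /andP[? ?].
by apply/andP; split; lra.
Unshelve. all: by end_near. Qed.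

(* Averaging the increments over windows of width 1/(k+1) replaces the chain
   rule for the square norm; [d2] is the error made by approximating the solution
   by a simple curve, [n2] the squared dual norm of its time derivative. *)
Lemma averaged_energy (N : R -> R) (m : nat) (A : 'I_m -> set R) (q : 'I_m -> R -> R)
    (d2 n2 : R -> R) (c : R) : 0 < c ->
  (forall x, -2 < x -> {for x, continuous N}) ->
  (forall i, measurable (A i : set (measurableTypeR R))) ->
  (forall i, lam.-integrable setT (EFin \o q i)) ->
  (forall i t, ~ I t -> q i t = 0) ->
  aeint lam I d2 -> lam.-integrable setT (EFin \o n2) -> (forall t, ~ I t -> n2 t = 0) ->
  (forall k, {ae lam, forall t, I t -> N t - N (t - k.+1%:R^-1) <=
     2 * \sum_i \1_(A i) t * (prim (q i) t - prim (q i) (t - k.+1%:R^-1)) +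
     (c * k.+1%:R^-1 * d2 t + c^-1 * (prim n2 t - prim n2 (t - k.+1%:R^-1)))}) ->
  N T - N 0 <= 2 * \sum_i \int[lam]_(t in I) (\1_(A i) t * q i t) +
    (c * \int[lam]_(t in I) d2 t + c^-1 * \int[lam]_(t in I) n2 t).
Proof.
move=> c0 cN mA qi q0 d2i n2i n20 H.
have LN := @shift_avg R T T0 N cN.
have LP := @shift_avg R T T0 (prim n2) (@continuous_prim _ _ n2i).
rewrite (prim_geT T0 n2i n20 (lexx _)) (prim_le0 n20 (lexx 0)) subr0 in LP.
have LS : (fun k => \sum_i \int[lam]_(t in I) (\1_(A i) t * (k.+1%:R *
    (prim (q i) t - prim (q i) (t - k.+1%:R^-1))))) @ \oo -->
    \sum_i \int[lam]_(t in I) (\1_(A i) t * q i t).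
  apply: cvg_sum_seq => i; exact: steklov (mA i) (qi i) (q0 i).
have LR : (fun k => 2 * (\sum_i \int[lam]_(t in I) (\1_(A i) t * (k.+1%:R *
    (prim (q i) t - prim (q i) (t - h k))))) + (c * \int[lam]_(t in I) d2 t +
    c^-1 * (k.+1%:R * \int[lam]_(t in I) (prim n2 t - prim n2 (t - h k))))) @ \oo -->
  2 * (\sum_i \int[lam]_(t in I) (\1_(A i) t * q i t)) +
    (c * \int[lam]_(t in I) d2 t + c^-1 * \int[lam]_(t in I) n2 t).
  exact: (cvgD (cvgMr (a := 2) LS) (cvgD (cvg_cst (c * \int[lam]_(t in I) d2 t)) (cvgMr (a := c^-1) LP))).
have LK : \forall k \near \oo, k.+1%:R * \int[lam]_(t in I) (N t - N (t - h k)) <=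
   2 * (\sum_i \int[lam]_(t in I) (\1_(A i) t * (k.+1%:R *
    (prim (q i) t - prim (q i) (t - h k))))) + (c * \int[lam]_(t in I) d2 t +
    c^-1 * (k.+1%:R * \int[lam]_(t in I) (prim n2 t - prim n2 (t - h k)))); last first.
  exact: (ler_cvg_to LN LR LK).
apply: nearW => k.
have NI : aeint lam I (fun t => N t - N (t - h k)).
  have cp x : -1 < x -> {for x, continuous (fun t => N t - N (t - h k))}.
    move=> x1; apply: (@cvgB R R R (nbhs (x : R))); first by apply: cN; lra.
    apply: (@cvg_comp _ _ _ (fun t => t - h k) N _ (nbhs (x - h k))).
      exact: (@cvgB R R R (nbhs (x : R)) _ _ _ _ _ cvg_id (cvg_cst _)).
    by apply: cN; have := h1 k; lra.
  exact: aeint_continuous_I.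
have si i : aeint lam I (fun t => \1_(A i) t * (prim (q i) t - prim (q i) (t - h k))).
  by apply: aeint_indicM => //; exact: aeint_prim_incr.
have ni := aeint_prim_incr k n2i.
have := le_Rint mI NI _ (H k).
rewrite -/(h k) => /(_ (aeintD mI (aeintZ mI 2 (aeint_sum mI (index_enum 'I_m) si))
   (aeintD mI (aeintZ mI (c * h k) d2i) (aeintZ mI c^-1 ni)))).
have E1 : \int[lam]_(t in I) (2 * \sum_i \1_(A i) t * (prim (q i) t - prim (q i) (t - h k)) +
     (c * h k * d2 t + c^-1 * (prim n2 t - prim n2 (t - h k)))) =
   2 * \sum_i \int[lam]_(t in I) (\1_(A i) t * (prim (q i) t - prim (q i) (t - h k))) +
   (c * h k * \int[lam]_(t in I) d2 t + c^-1 * \int[lam]_(t in I) (prim n2 t - prim n2 (t - h k))).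
  rewrite (RintD mI (aeintZ mI 2 (aeint_sum mI (index_enum 'I_m) si))
    (aeintD mI (aeintZ mI (c * h k) d2i) (aeintZ mI c^-1 ni))).
  rewrite (RintZ mI 2 (aeint_sum mI (index_enum 'I_m) si)) (Rint_sum mI _ si).
  by rewrite (RintD mI (aeintZ mI (c * h k) d2i) (aeintZ mI c^-1 ni)) (RintZ mI _ d2i) (RintZ mI _ ni).
rewrite E1 {E1}.
have -> : \sum_i \int[lam]_(t in I) (\1_(A i) t * (k.+1%:R * (prim (q i) t - prim (q i) (t - h k)))) =
   k.+1%:R * \sum_i \int[lam]_(t in I) (\1_(A i) t * (prim (q i) t - prim (q i) (t - h k))).
  rewrite mulr_sumr; apply: eq_bigr => i _; rewrite -RintZ//.
  by apply: eq_Rintegral => t _; rewrite mulrCA.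
have k0 : 0 < k.+1%:R :> R by rewrite ltr0n.
(* Multiplying by k+1 turns increments into difference quotients and cancels the width 1/(k+1) in
   front of [d2]. *)
move=> /(ler_wpM2l (ltW k0)) /le_trans; apply.
rewrite le_eqVlt; apply/orP; left; apply/eqP; rewrite /h.
move: (\sum_i _) (Rintegral _ _ _) (Rintegral _ _ _) => a b d.
by field; rewrite gt_eqF// -natr1 addrC in k0 *; rewrite gt_eqF.
Qed.

End steklov_averages.

(** * Space-time slices and curves *)

Section product_slices.
Context d1 d2 (X : measurableType d1) (Y : measurableType d2) (R : realType).
Variables (m1 : {sigma_finite_measure set X -> \bar R}) (m2 : {sigma_finite_measure set Y -> \bar R}).
Local Notation m12 := (m1 \x m2)%E.

Lemma product_measure_ysection N : measurable N -> m12 N = (\int[m2]_y m1 (ysection N y))%E.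
Proof.
move=> mN; have := @fubini_tonelli2 _ _ _ _ _ m1 m2 (EFin \o \1_N).
rewrite integral_indic// setIT => ->.
- apply: eq_integral => y _; rewrite -[ysection N y]setIT -integral_indic//; last exact: measurable_ysection.
  apply: eq_integral => x _ /=; congr (_%:E); rewrite !indicE; congr (_%:R : R).
  by congr nat_of_bool; apply/idP/idP; rewrite !inE /ysection /= inE.
- by apply/measurable_EFinP; exact: measurable_indic.
- by move=> p; rewrite lee_fin.
Qed.

Lemma ae_slice (P : X * Y -> Prop) : {ae m12, forall p, P p} ->
  {ae m2, forall y, {ae m1, forall x, P (x, y)}}.
Proof.
move=> [N [mN N0 PN]].
have mS : measurable_fun setT (fun y => m1 (ysection N y)) by exact: measurable_fun_ysection.
have S0 : (\int[m2]_y `|m1 (ysection N y)| = 0)%E.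
  rewrite -[RHS]N0 product_measure_ysection//.
  by apply: eq_integral => y _; rewrite gee0_abs.
have := (ae_eq_integral_abs m2 measurableT mS).1 S0.
apply: filterS => y /(_ I) y0; exists (ysection N y); split => //.
  exact: measurable_ysection.
by move=> x /= nP; rewrite /ysection /= inE; apply: PN.
Qed.

(** The converse of [ae_slice] asks for a measurable exceptional set, whose measure Tonelli computes
    from its slices. *)
Lemma slice_ae (P : X * Y -> Prop) : measurable [set p | ~ P p] ->
  {ae m2, forall y, {ae m1, forall x, P (x, y)}} -> {ae m12, forall p, P p}.
Proof.
move=> mP H; exists [set p | ~ P p]; split => //.
rewrite product_measure_ysection//.
rewrite -(integral0 m2 setT); apply: ae_eq_integral => //; first exact: measurable_fun_ysection.
apply: filterS H => y [N [mN N0 PN]] _; apply/eqP; rewrite eq_le measure_ge0 andbT -N0.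
apply: le_measure; rewrite ?inE//; first exact: measurable_ysection.
by move=> x; rewrite /ysection /= inE /= => nP; apply: PN.
Qed.

Variables (D1 : set X) (D2 : set Y).
Hypotheses (mD1 : measurable D1) (mD2 : measurable D2).
Local Notation D := (D1 `*` D2).

Let mD : measurable D. Proof. exact: measurableX. Qed.

Lemma ae_sliceX (P : X * Y -> Prop) : {ae m12, forall p, D p -> P p} ->
  {ae m2, forall y, D2 y -> {ae m1, forall x, D1 x -> P (x, y)}}.
Proof.
move=> /ae_slice; apply: filterS => y H D2y; apply: filterS H => x H D1x.
exact: H.
Qed.

Lemma measurable_slice (f : X * Y -> R) y : measurable_fun D f -> D2 y ->
  measurable_fun D1 (fun x => f (x, y)).
Proof.
move=> mf D2y; have := measurable_restrictT f mD => -[/(_ mf) mfD _].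
apply: (eq_measurable_fun ((f \_ D) \o (pair^~ y))).
  by move=> x /set_mem D1x /=; rewrite patchE mem_set.
apply: measurable_funTS; apply: measurableT_comp => //; exact: pair2_measurable.
Qed.

Lemma slice_aeX0 (f : X * Y -> R) : measurable_fun D f ->
  {ae m2, forall y, D2 y -> {ae m1, forall x, D1 x -> f (x, y) = 0}} ->
  {ae m12, forall p, D p -> f p = 0}.
Proof.
move=> mf H; apply: slice_ae.
  have -> : [set p | ~ (D p -> f p = 0)] = D `&` f @^-1` (~` [set 0]).
    apply/seteqP; split=> p /=; first by move=> /not_implyP.
    by move=> [Dp fp] /(_ Dp).
  by apply: mf => //; exact: measurableC.
apply: filterS H => y; have [D2y /(_ D2y)|nD2 _] := pselect (D2 y).
  by apply: filterS => x H [D1x _]; exact: H.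
by apply: aeW => x [].
Qed.

Lemma integrable_slice (f : X * Y -> R) : m12.-integrable D (EFin \o f) ->
  {ae m2, forall y, D2 y -> m1.-integrable D1 (EFin \o (fun x => f (x, y)))}.
Proof.
move=> /(integrable_mkcond _ mD) fi; have := ae_integrable2 fi.
apply: filterS => y H D2y; apply/(integrable_mkcond _ mD1).
apply: eq_integrable H => // x _; rewrite /= !patchE.
by rewrite in_setX/= (mem_set D2y) andbT.
Qed.

(** [fubini_G] takes extended real values; it agrees with the real inner integral on the integrable
    slices, hence almost everywhere, which is why integrability in y is stated with [aeint]. *)
Lemma integral_slice (f : X * Y -> R) : m12.-integrable D (EFin \o f) ->
  aeint m2 D2 (fun y => \int[m1]_(x in D1) f (x, y)) /\
  \int[m12]_(p in D) f p = \int[m2]_(y in D2) \int[m1]_(x in D1) f (x, y).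
Proof.
move=> fi; have fiT := (integrable_mkcond _ mD).1 fi.
have E y : fubini_G m1 ((EFin \o f) \_ D) y =
   (if y \in D2 then \int[m1]_(x in D1) (f (x, y))%:E else 0)%E.
  rewrite /fubini_G; case: ifPn => yD.
    rewrite [RHS]integral_mkcond; apply: eq_integral => x _; rewrite /= !patchE.
    by rewrite in_setX/= yD andbT.
  rewrite -(integral0 m1 setT); apply: eq_integral => x _; rewrite patchE.
  by rewrite in_setX/= (negbTE yD) andbF.
have Gi : m2.-integrable setT (fubini_G m1 ((EFin \o f) \_ D)).
  have mf := measurable_int _ fiT; apply/integrableP; split; first exact: (measurable_fubini_G fiT).
  apply: le_lt_trans ((integrable21ltyP m1 m2 mf).1 fiT).
  apply: ge0_le_integral => //.
  - by apply: measurableT_comp => //; exact: (measurable_fubini_G fiT).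
  - apply: (@measurable_fun_fubini_tonelli_G _ _ _ _ _ m1 (fun p => `|((EFin \o f) \_ D) p|%E)) => //.
    exact: measurableT_comp.
  - move=> y _; apply: le_abse_integral => //.
    by apply: measurableT_comp => //; exact: pair2_measurable.
have Ei := integral21_prod_meas1 fiT.
have sl := integrable_slice fi.
have fin : {ae m2, forall y, D2 y -> fubini_G m1 ((EFin \o f) \_ D) y =
    (\int[m1]_(x in D1) f (x, y))%:E}.
  apply: filterS sl => y H D2y; rewrite E mem_set// /Rintegral fineK//.
  by apply: integrable_fin_num => //; exact: H.
have GiD : m2.-integrable D2 (fubini_G m1 ((EFin \o f) \_ D)) by exact: integrableS Gi.
have ai : aeint m2 D2 (fun y => \int[m1]_(x in D1) f (x, y)).
  exists (fine \o fubini_G m1 ((EFin \o f) \_ D)).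
    apply: (le_integrable mD2 _ _ GiD).
      apply/measurable_EFinP; apply: measurableT_comp; first exact: fine_measurable.
      exact: measurable_int GiD.
    by move=> y _ /=; case: (fubini_G _ _ y) => [r||] /=; rewrite ?normr0 ?leey.
  by apply: filterS fin => y H D2y /=; rewrite H.
split => //; rewrite /Rintegral [in LHS]integral_mkcond -Ei.
congr fine; rewrite [RHS](_ : _ = \int[m2]_(y in D2) fubini_G m1 ((EFin \o f) \_ D) y)%E.
  rewrite [RHS]integral_mkcond; apply: eq_integral => y _; rewrite patchE E.
  by case: ifP.
by apply: ae_eq_integral' => //; apply: filterS fin => y H D2y; rewrite H.
Qed.

End product_slices.

Section simple_curves.
Context (R : realType) (I : set (measurableTypeR R)).
Hypothesis mI : measurable I.

Definition simple_on (V : Type) (s : R -> V) :=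
  finite_set (s @` I) /\ forall c, measurable (I `&` (s @^-1` [set c]) : set (measurableTypeR R)).

Lemma simple_on_preimage (V : Type) (s : R -> V) (A : set V) : simple_on s ->
  measurable (I `&` (s @^-1` A) : set (measurableTypeR R)).
Proof.
move=> [fs ms].
have -> : I `&` (s @^-1` A) = \bigcup_(c in (s @` I) `&` A) (I `&` (s @^-1` [set c])).
  apply/seteqP; split=> t /=.
    by move=> [It At]; exists (s t); [split => //; exists t|].
  by move=> [c [_ Ac] [It ->]].
by apply: fin_bigcup_measurable => [|c _]; [exact: finite_setIl|exact: ms].
Qed.

Lemma simple_on_comp (V W : Type) (F : V -> W) (s : R -> V) : simple_on s ->
  simple_on (fun t => F (s t)).
Proof.
move=> ss; split; first by have := finite_image F ss.1; rewrite image_comp.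
by move=> c; exact: (@simple_on_preimage _ s (F @^-1` [set c]) ss).
Qed.

Lemma simple_on_pair (V W : Type) (s : R -> V) (s' : R -> W) : simple_on s -> simple_on s' ->
  simple_on (fun t => (s t, s' t)).
Proof.
move=> [fs ms] [fs' ms']; split.
  apply: sub_finite_set (finite_setX fs fs') => _ [t It <-].
  by split; exists t.
move=> [c c'].
have -> : I `&` ((fun t => (s t, s' t)) @^-1` [set (c, c')]) =
    (I `&` (s @^-1` [set c])) `&` (I `&` (s' @^-1` [set c'])).
  by apply/seteqP; split => t /=; [move=> [It [-> ->]]|move=> [[It ->] [_ ->]]].
exact: measurableI.
Qed.

Lemma simple_on_comp2 (V W Z : Type) (F : V -> W -> Z) (s : R -> V) (s' : R -> W) :
  simple_on s -> simple_on s' -> simple_on (fun t => F (s t) (s' t)).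
Proof.
by move=> ss ss'; exact: (simple_on_comp (fun p => F p.1 p.2) (simple_on_pair ss ss')).
Qed.

Lemma simple_on_measurable (s : R -> R) : simple_on s -> measurable_fun I s.
Proof. by move=> ss _ A mA; exact: simple_on_preimage. Qed.

Lemma simple_on_cst (V : Type) (c : V) : simple_on (fun=> c).
Proof.
split; first by apply: sub_finite_set (finite_set1 c) => _ [t _ <-].
move=> d; have [<-|nd] := pselect (c = d).
  by rewrite (_ : _ @^-1` _ = setT) ?setIT//; apply/seteqP; split.
by rewrite (_ : _ `&` _ = set0)//; apply/seteqP; split => // t [].
Qed.

Lemma simple_on_bool (A : set (measurableTypeR R)) : measurable A ->
  simple_on (fun t => t \in A).
Proof.
move=> mA; split; first exact: finite_finset.
move=> b; have -> : (fun t : R => t \in A) @^-1` [set b] = if b then A else ~` A.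
  apply/seteqP; case: b; split=> t /=.
  - exact: set_mem.
  - exact: mem_set.
  - by move/negbT; rewrite notin_setE.
  - by move=> nA; apply/negbTE; rewrite notin_setE.
by apply: measurableI => //; case: b => //; exact: measurableC.
Qed.

(** The values may be functions, without decidable equality; a bijection of the finite image with
    ['I_m] numbers them, and any real function of the curve becomes a finite sum of indicators. *)
Lemma simple_on_decomp (V : Type) (s : R -> V) : simple_on s ->
  exists (m : nat) (A : 'I_m -> set R) (c : 'I_m -> V),
    [/\ forall i, measurable (A i : set (measurableTypeR R)),
        forall i, exists2 t, I t & s t = c i &
        forall (G : V -> R) t, I t -> G (s t) = \sum_i \1_(A i) t * G (c i)].
Proof.
move=> ss; have [fs ms] := ss; have [m] := (finite_setP _).1 fs.
move=> /card_set_bijP[f bf].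
have inj t t' : I t -> I t' -> f (s t) = f (s t') -> s t = s t'.
  by case: bf => _ bi _ It It' ff; apply: bi => //; rewrite inE; [exists t|exists t'].
have /choice[c Hc] : forall i : 'I_m, exists v, (exists2 t, I t & s t = v) /\ f v = i.
  move=> i; case: bf => _ _ /(_ i (ltn_ord i))[_ [t It <-] fi].
  by exists (s t); split => //; exists t.
exists m, (fun i => I `&` (s @^-1` [set c i])), c; split.
- by move=> i; exact: ms.
- by move=> i; case: (Hc i).
move=> G t It; have fm : (f (s t) < m)%N by case: bf => + _ _; apply; exists t.
rewrite (bigD1 (Ordinal fm))//= big1 ?addr0.
  have [[t' It' st'] fc] := Hc (Ordinal fm).
  have E : s t = c (Ordinal fm) by rewrite -st'; apply: inj => //; rewrite st' fc.
  by rewrite indicE mem_set// mul1r -E.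
move=> i ni; rewrite indicE memNset ?mul0r// => -[_ /= E].
move/negP : ni; apply; apply/eqP/val_inj => /=.
by rewrite E (Hc i).2.
Qed.

Lemma simple_on_approx (eta : R -> R) : measurable_fun I eta ->
  exists s : nat -> R -> R, (forall k, simple_on (s k)) /\
    forall t, I t -> (fun k => s k t) @ \oo --> eta t.
Proof.
move=> me; have /(approximation_sfun mI)[g Hg] : measurable_fun I (EFin \o eta).
  exact/measurable_EFinP.
exists (fun k : nat => g k : R -> R); split.
  move=> k; split; last first.
    move=> c; have mg : measurable_fun I (g k).
      by apply: measurable_funTS; exact: measurable_funPT.
    exact: (mg mI _ (measurable_set1 c)).
  have : finite_set (range (g k)) by exact: fimfunP.
  by apply: sub_finite_set => _ [t _ <-]; exists t.
by move=> t /Hg /fine_cvg.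
Qed.

End simple_curves.

Lemma squeeze_norm0 (R : realType) (f g : nat -> R) :
  (forall k, `|f k| <= g k) -> g @ \oo --> 0 -> f @ \oo --> 0.
Proof.
move=> fg g0; apply/cvgrPdist_le => e e0; have /cvgrPdist_le/(_ e e0) := g0.
apply: filterS => k; rewrite !sub0r !normrN => /(le_trans (ler_norm _)).
exact: le_trans.
Qed.

(** * Square-integrable curves in a seminormed space of functions *)

Section curves.
Context (R : realType) (T : R) (A : Type) (P : set (A -> R)) (N : (A -> R) -> R).
Local Notation lam := (@lebesgue_measure R).
Local Notation I := (`]0, T[%classic : set (measurableTypeR R)).
Hypotheses (P0 : P (fun=> 0))
  (Pcomb : forall a v w, P v -> P w -> P (fun x => a * v x + w x))
  (N0 : forall v, 0 <= N v)
  (Ncomb : forall a v w, P v -> P w -> N (fun x => a * v x + w x) <= `|a| * N v + N w)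
  (N00 : N (fun=> 0) = 0).

Let mI : measurable I. Proof. exact: measurable_itv. Qed.

Lemma curveB_in v w : P v -> P w -> P (v \- w).
Proof.
move=> pv pw; have := Pcomb (-1) pw pv; congr P.
by apply/funext => x; rewrite mulN1r addrC.
Qed.

Lemma curveZ_le a v : P v -> N (fun x => a * v x) <= `|a| * N v.
Proof.
move=> pv; have := Ncomb a pv P0; rewrite N00 addr0; congr (N _ <= _).
by apply/funext => x; rewrite addr0.
Qed.

Lemma curveD_le v w : P v -> P w -> N (v \+ w) <= N v + N w.
Proof.
move=> pv pw; have := Ncomb 1 pv pw; rewrite normr1 mul1r; congr (N _ <= _).
by apply/funext => x; rewrite mul1r.
Qed.

Lemma curve_distC v w : P v -> P w -> N (v \- w) = N (w \- v).
Proof.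
have le a b : P a -> P b -> N (a \- b) <= N (b \- a).
  move=> pa pb; have := curveZ_le (-1) (curveB_in pb pa); rewrite normrN1 mul1r.
  by congr (N _ <= _); apply/funext => x /=; rewrite mulN1r opprB.
by move=> pv pw; apply/eqP; rewrite eq_le !le.
Qed.

Lemma curve_le_dist v w : P v -> P w -> N v <= N w + N (v \- w).
Proof.
move=> pv pw; have := curveD_le pw (curveB_in pv pw); congr (N _ <= _).
by apply/funext => x /=; rewrite addrC subrK.
Qed.

Lemma curve_dist_le v w : P v -> P w -> `|N v - N w| <= N (v \- w).
Proof.
move=> pv pw; rewrite ler_norml; have := curve_le_dist pv pw; have := curve_le_dist pw pv.
by rewrite (curve_distC pw pv) => ? ?; apply/andP; split; lra.
Qed.

(* To be used with [P] and [N] either H10 and its norm, or H^-1 and its norm. *)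
Definition simple_approx (w : R -> A -> R) (s : nat -> R -> A -> R) :=
  (forall k, (forall t, I t -> P (s k t)) /\ simple_on I (s k)) /\
  {ae lam, forall t, I t -> (fun k => N (s k t \- w t)) @ \oo --> 0}.

Definition L2curve (w : R -> A -> R) :=
  [/\ {ae lam, forall t, I t -> P (w t)}, exists s, simple_approx w s &
      aeint lam I (fun t => N (w t) ^+ 2)].

Lemma aemeas_dist w g : {ae lam, forall t, I t -> P (w t)} -> (exists s, simple_approx w s) ->
  (forall t, I t -> P (g t)) -> simple_on I g -> aemeas lam I (fun t => N (g t \- w t)).
Proof.
move=> pw [s [ps cs]] pg sg; apply: (@aemeas_lim _ _ _ lam I (fun k t => N (g t \- s k t))).
  move=> k; apply: measurable_aemeas; apply: simple_on_measurable => //.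
  exact: (simple_on_comp2 (fun a b => N (a \- b)) sg (ps k).2).
apply: filterS2 pw cs => t pw cs It.
apply/cvgrPdist_le => e e0; have /cvgrPdist_le/(_ e e0) := cs It.
apply: filterS => k; rewrite sub0r normrN => /(le_trans (ler_norm _)) h.
have [pg' ps' pw'] := And3 (pg t It) ((ps k).1 t It) (pw It).
apply: le_trans (curve_dist_le (curveB_in pg' pw') (curveB_in pg' ps')) _.
apply: le_trans h; rewrite le_eqVlt; apply/orP; left; apply/eqP; congr N.
by apply/funext => x /=; ring.
Qed.

Lemma aemeas_curve w : {ae lam, forall t, I t -> P (w t)} -> (exists s, simple_approx w s) ->
  aemeas lam I (fun t => N (w t)).
Proof.
move=> pw hs; have := aemeas_dist pw hs (fun _ _ => P0) (simple_on_cst mI (fun=> 0)).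
apply: aemeas_ae; apply: filterS pw => t pw It.
rewrite (curve_distC P0 (pw It)); congr N.
by apply/funext => x /=; rewrite subr0.
Qed.

Lemma aeint_sqr (F G : R -> R) : aemeas lam I F -> aeint lam I G ->
  {ae lam, forall t, I t -> F t ^+ 2 <= G t} -> aeint lam I (fun t => F t ^+ 2).
Proof.
move=> mF iG H; apply: aeint_dominated iG _ => //; first exact: aemeasM.
by apply: filterS H => t H It; rewrite normrX real_normK ?num_real// H.
Qed.

Lemma L2curve_comb a v w : L2curve v -> L2curve w -> L2curve (fun t x => a * v t x + w t x).
Proof.
move=> [pv [sv [psv cv]] iv] [pw [sw [psw cw]] iw].
have pc : {ae lam, forall t, I t -> P (fun x => a * v t x + w t x)}.
  by apply: filterS2 pv pw => t pv pw It; apply: Pcomb; [exact: pv|exact: pw].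
have hs : exists s, simple_approx (fun t x => a * v t x + w t x) s.
  exists (fun k t x => a * sv k t x + sw k t x); split.
    move=> k; split; last first.
      by apply: (simple_on_comp2 (fun b c x => a * b x + c x) (psv k).2 (psw k).2).
    by move=> t It; apply: Pcomb; [exact: (psv k).1|exact: (psw k).1].
  have pvw : {ae lam, forall t, I t -> P (v t) /\ P (w t)}.
    by apply: filterS2 pv pw => t pv pw It; split; [exact: pv|exact: pw].
  apply: filterS3 pvw cv cw => t pvw cv cw It; have [pv' pw'] := pvw It.
  apply: (@squeeze_norm0 _ _ (fun k => `|a| * N (sv k t \- v t) + N (sw k t \- w t))).
    move=> k; rewrite ger0_norm ?N0//.
    have := Ncomb a (curveB_in ((psv k).1 t It) pv') (curveB_in ((psw k).1 t It) pw').
    by apply: le_trans; rewrite le_eqVlt; apply/orP; left; apply/eqP; congr N;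
      apply/funext => x /=; ring.
  have -> : 0 = `|a| * 0 + 0 by rewrite mulr0 addr0.
  by apply: cvgD; [apply: cvgMr; exact: cv|exact: cw].
split => //; apply: (@aeint_sqr _ (fun t => 2 * (a ^+ 2 * N (v t) ^+ 2) + 2 * N (w t) ^+ 2)).
- exact: aemeas_curve.
- by apply: aeintD => //; apply: aeintZ => //; exact: aeintZ.
- apply: filterS2 pv pw => t pv pw It.
  have := Ncomb a (pv It) (pw It); have := N0 (fun x => a * v t x + w t x).
  move=> h1 h2; apply: (@le_trans _ _ ((`|a| * N (v t) + N (w t)) ^+ 2)).
    by rewrite ler_pXn2r ?nnegrE// (le_trans h1).
  by apply: le_trans (sqrD_le _ _) _; rewrite exprMn real_normK ?num_real.
Qed.

Lemma L2curve_cst c : P c -> L2curve (fun=> c).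
Proof.
move=> pc; split; [exact: aeW| |exact: aeint_cst_I].
exists (fun _ _ => c); split => [k|]; first by split => //; exact: simple_on_cst.
apply: aeW => t _; apply: cvg_near_cst; apply: nearW => k.
by rewrite -[RHS]N00; congr N; apply/funext => x /=; rewrite subrr.
Qed.

(** [eta] is approximated by simple functions as well, and the errors separate as h s - eta w = h (s
    - w) + (h - eta) w. *)
Lemma L2curve_mul (eta : R -> R) (C : R) w : measurable_fun I eta ->
  (forall t, I t -> `|eta t| <= C) -> L2curve w -> L2curve (fun t x => eta t * w t x).
Proof.
move=> me eC [pw [s [ps cs]] iw].
have PZ a v : P v -> P (fun x => a * v x).
  move=> pv; have := Pcomb a pv P0; congr P; apply/funext => x; exact: addr0.
have pc : {ae lam, forall t, I t -> P (fun x => eta t * w t x)}.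
  by apply: filterS pw => t pw It; apply: PZ; exact: pw.
have [h [sh ch]] := simple_on_approx mI me.
have hs : exists s, simple_approx (fun t x => eta t * w t x) s.
  exists (fun k t x => h k t * s k t x); split.
    move=> k; split; first by move=> t It; apply: PZ; exact: (ps k).1.
    exact: (simple_on_comp2 (fun a b x => a * b x) (sh k) (ps k).2).
  apply: filterS2 pw cs => t pw cs It; have pw' := pw It.
  apply: (@squeeze_norm0 _ _ (fun k => `|h k t| * N (s k t \- w t) + `|h k t - eta t| * N (w t))).
    move=> k; rewrite ger0_norm ?N0//; have ps' := (ps k).1 t It.
    have := Ncomb (h k t) (curveB_in ps' pw') (PZ (h k t - eta t) _ pw').
    move=> /le_trans/(_ (lerD (lexx _) (curveZ_le (h k t - eta t) pw'))).
    by apply: le_trans; rewrite le_eqVlt; apply/orP; left; apply/eqP; congr N;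
      apply/funext => x /=; ring.
  have -> : 0 = `|eta t| * 0 + `|eta t - eta t| * N (w t) :> R.
    by rewrite mulr0 subrr normr0 mul0r addr0.
  apply: cvgD; first by apply: cvgM; [apply: cvg_norm; exact: ch|exact: cs].
  apply: cvgMl; apply: cvg_norm; apply: cvgB; [exact: ch|exact: cvg_cst].
split => //; apply: (@aeint_sqr _ (fun t => C ^+ 2 * N (w t) ^+ 2)).
- exact: aemeas_curve.
- exact: aeintZ.
- apply: filterS pw => t pw It; rewrite -exprMn ler_pXn2r ?nnegrE//.
    by apply: le_trans (curveZ_le (eta t) (pw It)) _; rewrite ler_wpM2r// eC.
  by rewrite mulr_ge0// (le_trans _ (eC t It)).
Qed.

(* The approximants are cut off where they are farther from [w] than [0] is,
   which makes dominated convergence applicable. *)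
Lemma L2curve_approx w e : L2curve w -> 0 < e ->
  exists g, [/\ forall t, I t -> P (g t), simple_on I g,
    aeint lam I (fun t => N (g t \- w t) ^+ 2) &
    \int[lam]_(t in I) (N (g t \- w t) ^+ 2) < e].
Proof.
move=> [pw [s [ps cs]] iw] e0.
have [b mb wb] := aemeas_curve pw (ex_intro _ s (conj ps cs)).
have /choice[a Ha] : forall k, exists a : R -> R, measurable_fun I a /\
    {ae lam, forall t, I t -> N (s k t \- w t) = a t}.
  move=> k; have [a ma sa] := aemeas_dist pw (ex_intro _ s (conj ps cs)) (ps k).1 (ps k).2.
  by exists a.
pose B k : set (measurableTypeR R) := I `&` [set t | a k t <= b t].
have mB k : measurable (B k).
  have mab : measurable_fun I (fun t => a k t <= b t) by apply: measurable_fun_ler => //; exact: (Ha k).1.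
  by apply: (mab mI [set true]).
pose g k t := if t \in B k then s k t else (fun=> 0).
have pg k t : I t -> P (g k t) by move=> It; rewrite /g; case: ifP => // _; exact: (ps k).1.
have sg k : simple_on I (g k).
  exact: (simple_on_comp2 (fun (c : bool) v => if c then v else (fun=> 0)) (simple_on_bool mI (mB k)) (ps k).2).
have mg k := aemeas_dist pw (ex_intro _ s (conj ps cs)) (pg k) (sg k).
have dom k : {ae lam, forall t, I t -> N (g k t \- w t) <= N (w t) /\
    (N (s k t \- w t) <= N (w t) -> g k t = s k t)}.
  apply: filterS3 pw wb (Ha k).2 => t pw wb sa It; rewrite /g.
  case: ifPn => [/set_mem[_ /=]|]; first by rewrite -sa// -wb.
  rewrite notin_setE => nB; split.
    by rewrite (curve_distC P0 (pw It)) le_eqVlt; apply/orP; left; apply/eqP; congr N;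
      apply/funext => x /=; rewrite subr0.
  by rewrite sa// wb// => h; case: nB; split.
have domk : {ae lam, forall t, I t -> forall k, N (g k t \- w t) <= N (w t) /\
    (N (s k t \- w t) <= N (w t) -> g k t = s k t)}.
  have := ae_foralln dom; apply: filterS => t H It k; exact: H.
have lim : {ae lam, forall t, I t -> (fun k => N (g k t \- w t) ^+ 2) @ \oo --> 0}.
  apply: filterS3 pw cs domk => t pw cs domk It; have pw' := pw It.
  have -> : 0 = 0 * 0 :> R by rewrite mulr0.
  suff c0 : (fun k => N (g k t \- w t)) @ \oo --> 0 by exact: cvgM.
  apply: (@squeeze_norm0 _ _ (fun k => N (s k t \- w t))); last exact: cs.
  move=> k; rewrite ger0_norm//; have [h1 h2] := domk It k.
  by have [/h2 ->//|/ltW] := leP (N (s k t \- w t)) (N (w t)); exact: le_trans.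
have [] := @dominated_cvg_Rint _ _ _ lam I mI (fun k t => N (g k t \- w t) ^+ 2) (fun=> 0) _ _ iw.
- by move=> k; apply: aemeasM.
- move=> k; apply: filterS (dom k) => t H It; rewrite normrX ger0_norm//.
  by rewrite ler_pXn2r ?nnegrE//; have [] := H It.
- exact: lim.
rewrite Rint0// => _ /cvgrPdist_lt/(_ e e0)[k _ /(_ k (leqnn k))].
rewrite sub0r normrN => /(le_lt_trans (ler_norm _)) ke.
exists (g k); split; [exact: pg|exact: sg| |exact: ke].
apply: (@aeint_sqr (fun t => N (g k t \- w t)) (fun t => N (w t) ^+ 2)) => //.
by apply: filterS (dom k) => t H It; rewrite ler_pXn2r ?nnegrE//; have [] := H It.
Qed.
End curves.

(** * Curves with values in H10 and in its dual *)

Section parabolic_spaces.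
Context (R : realType) (n : nat).
Local Notation E := 'rV[R]_n.
Variables (Om : set E) (T : R).
Hypotheses (oOm : open Om) (bOm : bounded_set Om).
Local Notation mu := (leb R n).
Local Notation lam := (@lebesgue_measure R).
Local Notation st := (leb_st R n).
Local Notation I := (`]0, T[%classic : set (measurableTypeR R)).
Local Notation L2 := (in_L2 mu Om).
Local Notation L2v := (in_L2v mu Om).
Local Notation hn := (hn Om).

Let mI : measurable I. Proof. exact: measurable_itv. Qed.
Let mOm : measurable Om. Proof. exact: open_rV_measurable. Qed.

(** The dual norm as a real number; [fine] sends an infinite norm to 0, so it is meaningful on [Hm1]
    only. *)
Definition dn (l : (E -> R) -> R) : R := fine (Hm1norm Om l).

Lemma dn_ge0 l : 0 <= dn l. Proof. by rewrite fine_ge0// Hm1norm_ge0. Qed.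

Lemma Hm1_zero : Hm1 Om (fun=> 0).
Proof.
split; first by move=> *; rewrite mulr0 addr0.
apply: (@le_lt_trans _ _ 0%:E); last exact: ltry.
by apply: Hm1norm_le => // w hw; rewrite normr0 mul0r.
Qed.

Lemma dn_le l C : 0 <= C -> (forall w, H10 Om w -> `|l w| <= C * hn w) -> dn l <= C.
Proof.
move=> C0 H; have := Hm1norm_le oOm C0 H; have := Hm1norm_ge0 oOm bOm l.
by rewrite /dn; case: (Hm1norm Om l).
Qed.

Lemma dn0 : dn (fun=> 0) = 0.
Proof.
apply/eqP; rewrite eq_le dn_ge0 andbT; apply: dn_le => // w hw.
by rewrite normr0 mul0r.
Qed.

Lemma dn_comb a l1 l2 : Hm1 Om l1 -> Hm1 Om l2 ->
  dn (fun w => a * l1 w + l2 w) <= `|a| * dn l1 + dn l2.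
Proof.
move=> h1 h2; apply: dn_le; first by rewrite addr_ge0 ?mulr_ge0 ?dn_ge0.
move=> w hw; apply: le_trans (ler_normD _ _) _; rewrite mulrDl lerD ?Hm1_le//.
by rewrite normrM -mulrA ler_wpM2l// Hm1_le.
Qed.

Lemma hn_comb a v w : H10 Om v -> H10 Om w -> hn (fun x => a * v x + w x) <= `|a| * hn v + hn w.
Proof.
move=> hv hw; rewrite -hnZ//; last exact: H10_H1.
by apply: hnD => //; [exact: H1Z oOm bOm _ _ (H10_H1 hv)|exact: H10_H1].
Qed.

Definition H10curve := L2curve T (H10 Om) hn.
Definition Hm1curve := L2curve T (Hm1 Om) dn.

Lemma H10curve_comb a v w : H10curve v -> H10curve w -> H10curve (fun t x => a * v t x + w t x).
Proof.
apply: L2curve_comb; [exact: H10_0|exact: H10_comb|by move=> ?; exact: hn_ge0|exact: hn_comb|exact: hn0].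
Qed.

Lemma H10curve_cst c : H10 Om c -> H10curve (fun=> c).
Proof. by apply: L2curve_cst; [exact: hn0]. Qed.

Lemma H10curve_mul (eta : R -> R) (C : R) w : measurable_fun I eta ->
  (forall t, I t -> `|eta t| <= C) -> H10curve w -> H10curve (fun t x => eta t * w t x).
Proof.
apply: L2curve_mul; [exact: H10_0|exact: H10_comb|by move=> ?; exact: hn_ge0|exact: hn_comb|exact: hn0].
Qed.

Lemma H10curve_approx w e : H10curve w -> 0 < e ->
  exists g, [/\ forall t, I t -> H10 Om (g t), simple_on I g,
    aeint lam I (fun t => hn (g t \- w t) ^+ 2) &
    \int[lam]_(t in I) (hn (g t \- w t) ^+ 2) < e].
Proof.
apply: L2curve_approx; [exact: H10_0|exact: H10_comb|by move=> ?; exact: hn_ge0|exact: hn_comb|exact: hn0].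
Qed.

Lemma Hm1curve_comb a v w : Hm1curve v -> Hm1curve w -> Hm1curve (fun t x => a * v t x + w t x).
Proof.
apply: L2curve_comb; [exact: Hm1_zero| |exact: dn_ge0|exact: dn_comb|exact: dn0].
by move=> b l1 l2; exact: Hm1_comb_Hm1.
Qed.

Lemma Hm1curve_mul (eta : R -> R) (C : R) w : measurable_fun I eta ->
  (forall t, I t -> `|eta t| <= C) -> Hm1curve w -> Hm1curve (fun t x => eta t * w t x).
Proof.
apply: L2curve_mul; [exact: Hm1_zero| |exact: dn_ge0|exact: dn_comb|exact: dn0].
by move=> b l1 l2; exact: Hm1_comb_Hm1.
Qed.

Lemma Hm1_sub l1 l2 : Hm1 Om l1 -> Hm1 Om l2 -> Hm1 Om (l1 \- l2).
Proof.
move=> h1 h2; have := Hm1_comb_Hm1 oOm bOm (-1) h2 h1; congr Hm1.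
by apply/funext => x; rewrite mulN1r addrC.
Qed.

Lemma H10curve_strong w : (exists s, simple_approx T (H10 Om) hn w s) ->
  {ae lam, forall t, I t -> H10 Om (w t)} ->
  strongly_measurable (H10 Om) (fun a b => H1norm Om (a \- b)) I w.
Proof.
move=> [s [ps cs]] pw; exists s; split.
  by move=> k; have [p1 [p2 p3]] := ps k; split.
apply: filterS2 pw cs => t pw cs It.
by apply/cvg_H1norm => //; [move=> k; apply: H10_H1; exact: (ps k).1|exact: H10_H1 (pw It)|exact: cs].
Qed.

Lemma strong_H10curve w : strongly_measurable (H10 Om) (fun a b => H1norm Om (a \- b)) I w ->
  {ae lam, forall t, I t -> H10 Om (w t)} -> exists s, simple_approx T (H10 Om) hn w s.
Proof.
move=> [s [ps cs]] pw; exists s; split.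
  by move=> k; have [p1 p2 p3] := ps k.
apply: filterS2 pw cs => t pw cs It.
apply/cvg_H1norm => //; [|exact: H10_H1 (pw It)|exact: cs].
by move=> k; apply: H10_H1; have [p1 _ _] := ps k; exact: p1.
Qed.

Lemma cvg_Hm1norm (x_ : nat -> (E -> R) -> R) l : (forall k, Hm1 Om (x_ k)) -> Hm1 Om l ->
  ((fun k => Hm1norm Om (x_ k \- l)) @ \oo --> 0%E) <-> ((fun k => dn (x_ k \- l)) @ \oo --> 0).
Proof.
move=> hx hl; have -> : (fun k => Hm1norm Om (x_ k \- l)) = EFin \o (fun k => dn (x_ k \- l)).
  apply/funext => k /=; rewrite /dn fineK// Hm1norm_fin_num//; exact: Hm1_sub.
split=> [/fine_cvg//|H]; apply: cvg_EFin => //; exact: nearW.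
Qed.

Lemma L2Hm1P xi : L2Hm1 Om T xi <-> Hm1curve xi.
Proof.
split=> [[px [s [ps cs]] ix]|[px [s [ps cs]] ix]].
  have hs : exists s, simple_approx T (Hm1 Om) dn xi s.
    exists s; split; first by move=> k; have [p1 p2 p3] := ps k.
    apply: filterS2 px cs => t px cs It; apply/cvg_Hm1norm; [|exact: px|exact: cs].
    by move=> k; have [p1 _ _] := ps k; exact: p1.
  have mn : aemeas lam I (fun t => dn (xi t)).
    apply: (@aemeas_curve R T _ (Hm1 Om) dn) => //; try by [exact: Hm1_zero|exact: dn_ge0|exact: dn_comb|exact: dn0].
    by move=> b l1 l2; exact: Hm1_comb_Hm1.
  split => //; have [g mg xg] := aemeasM mn mn.
  exists g; last first. by apply: filterS xg => t H It; rewrite expr2 H.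
  apply/integrableP; split; first exact/measurable_EFinP.
  apply: le_lt_trans ix; rewrite le_eqVlt; apply/orP; left; apply/eqP.
  apply: ae_eq_integral' => //; apply: filterS2 xg px => t H px It /=.
  rewrite -H// ger0_norm ?mulr_ge0 ?dn_ge0// EFinM /dn fineK ?expe2//.
  by apply: Hm1norm_fin_num => //; exact: px.
split => //.
  exists s; split; first by move=> k; have [p1 [p2 p3]] := ps k; split.
  apply: filterS2 px cs => t px cs It; apply/cvg_Hm1norm; [|exact: px|exact: cs].
  by move=> k; exact: (ps k).1.
have [g gi xg] := ix.
rewrite (@ae_eq_integral' _ _ _ _ _ _ (fun t => `|(g t)%:E|%E)).
  by case/integrableP : gi.
apply: filterS2 xg px => t H px It /=.
rewrite -H// ger0_norm ?sqr_ge0// expr2 EFinM /dn fineK ?expe2//.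
by apply: Hm1norm_fin_num => //; exact: px.
Qed.

(** Pairings of simple curves are simple, and they converge pointwise: the difference of x_k(s_k)
    and xi(w) is (x_k - xi)(s_k) + xi(s_k - w). *)
Lemma pairing_aemeas xi w : Hm1curve xi -> H10curve w -> aemeas lam I (fun t => xi t (w t)).
Proof.
move=> [px [x [hx cx]] ix] [pw [s [ps cs]] iw].
apply: (@aemeas_lim _ _ _ lam I (fun k t => x k t (s k t))).
  move=> k; apply: measurable_aemeas; apply: simple_on_measurable.
  exact: (simple_on_comp2 (fun l v => l v) (hx k).2 (ps k).2).
have pxw : {ae lam, forall t, I t -> Hm1 Om (xi t) /\ H10 Om (w t)}.
  by apply: filterS2 px pw => t px pw It; split; [exact: px|exact: pw].
apply: filterS3 pxw cx cs => t pxw cx cs It; have [px' pw'] := pxw It.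
apply/cvgrPdist_le => e e0.
suff : (fun k => xi t (w t) - x k t (s k t)) @ \oo --> 0.
  move=> /cvgrPdist_le/(_ e e0); apply: filterS => k.
  by rewrite sub0r normrN.
apply: (@squeeze_norm0 _ _ (fun k => dn (x k t \- xi t) * (hn (w t) + hn (s k t \- w t)) +
   dn (xi t) * hn (s k t \- w t))).
  move=> k; have ps' := (ps k).1 t It; have hx' := (hx k).1 t It.
  have pd : H10 Om (s k t \- w t) by exact: H10B.
  have -> : xi t (w t) - x k t (s k t) = - (((x k t \- xi t) (s k t)) + xi t (s k t \- w t)).
    by rewrite (Hm1B px' ps' pw') /=; ring.
  rewrite normrN; apply: le_trans (ler_normD _ _) _; apply: lerD; last exact: Hm1_le.
  apply: le_trans (Hm1_le oOm bOm (Hm1_sub hx' px') ps') _.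
  rewrite ler_wpM2l ?dn_ge0//.
  have := hnD oOm bOm (H10_H1 pw') (H10_H1 pd); congr (hn _ <= _).
  by apply/funext => y /=; rewrite addrC subrK.
have -> : 0 = 0 * (hn (w t) + 0) + dn (xi t) * 0 by rewrite mul0r mulr0 addr0.
apply: cvgD; last by apply: cvgMr; exact: cs.
by apply: cvgM; [exact: cx|apply: cvgD; [exact: cvg_cst|exact: cs]].
Qed.

Lemma pairing_aeint xi w : Hm1curve xi -> H10curve w -> aeint lam I (fun t => xi t (w t)).
Proof.
move=> hx hw; apply: aeint_dominated (pairing_aemeas hx hw) _ _ => //.
  by case: hx => _ _ ix; case: hw => _ _ iw; exact: (aeintD mI ix iw).
case: hx hw => px _ _ [pw _ _]; apply: filterS2 px pw => t px pw It.
apply: le_trans (Hm1_le oOm bOm (px It) (pw It)) _.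
have := sqr_ge0 (dn (xi t) - hn (w t)); have := sqr_ge0 (dn (xi t)); have := sqr_ge0 (hn (w t)).
rewrite -/(dn (xi t)); move: (dn _) (hn _) => a b; rewrite sqrrB; lra.
Qed.

End parabolic_spaces.

Section parabolic_functions.
Context (R : realType) (n : nat).
Local Notation E := 'rV[R]_n.
Variables (Om : set E) (T : R).
Hypotheses (oOm : open Om) (bOm : bounded_set Om).
Local Notation mu := (leb R n).
Local Notation lam := (@lebesgue_measure R).
Local Notation st := (leb_st R n).
Local Notation I := (`]0, T[%classic : set (measurableTypeR R)).
Local Notation Q := (QT Om T).
Local Notation L2 := (in_L2 mu Om).
Local Notation L2v := (in_L2v mu Om).
Local Notation hn := (hn Om).
Local Notation H10curve := (H10curve Om T).
Local Notation Hm1curve := (Hm1curve Om T).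

Implicit Types (w z u v : spacetime R n -> R) (G H tau : spacetime R n -> E) (psi : E -> R).

Let mI : measurable I. Proof. exact: measurable_itv. Qed.
Let mOm : measurable Om. Proof. exact: open_rV_measurable. Qed.

Lemma measurable_QT : measurable Q. Proof. exact: measurableX. Qed.

Lemma measurable_const_in_time psi : measurable_fun Om psi ->
  measurable_fun Q (fun p : spacetime R n => psi p.1).
Proof.
move=> /(measurable_restrictT psi mOm).1 mpsi.
apply: (eq_measurable_fun ((psi \_ Om) \o fst)).
  by move=> p /set_mem[Op _] /=; rewrite patchE mem_set.
by apply: measurable_funTS; apply: measurableT_comp.
Qed.

Lemma in_L2_slice w : in_L2 st Q w -> {ae lam, forall t, I t -> L2 (slice w t)}.
Proof.
move=> /in_L2P[mw wi].
have := integrable_slice mOm mI wi; apply: filterS => t H It.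
apply/in_L2P; split; last exact: H.
exact: (measurable_slice mOm mI mw It).
Qed.

Lemma in_L2v_slice G : in_L2v st Q G -> {ae lam, forall t, I t -> L2v (slice G t)}.
Proof.
move=> gl; have : {ae lam, forall t, forall i, I t -> L2 (slice (fun p => G p ord0 i) t)}.
  by apply: ae_forall_count => i; exact: in_L2_slice.
by apply: filterS => t H It i; exact: H.
Qed.

Lemma ip_slice w z : in_L2 st Q w -> in_L2 st Q z ->
  aeint lam I (fun t => ip mu Om (slice w t) (slice z t)) /\
  ip st Q w z = \int[lam]_(t in I) ip mu Om (slice w t) (slice z t).
Proof.
move=> wl zl; have := integral_slice mOm mI (in_L2_integrableM measurable_QT wl zl).
rewrite ipE; have -> : (fun t => ip mu Om (slice w t) (slice z t)) =
    (fun t => \int[mu]_(x in Om) (w (x, t) * z (x, t))) by apply/funext => t; rewrite ipE.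
by [].
Qed.

Lemma ipv_slice G H : in_L2v st Q G -> in_L2v st Q H ->
  aeint lam I (fun t => ipv mu Om (slice G t) (slice H t)) /\
  ipv st Q G H = \int[lam]_(t in I) ipv mu Om (slice G t) (slice H t).
Proof.
move=> gl hl.
have E1 : {ae lam, forall t, I t -> \sum_i ip mu Om (slice (fun p => G p ord0 i) t) (slice (fun p => H p ord0 i) t) =
    ipv mu Om (slice G t) (slice H t)}.
  apply: filterS2 (in_L2v_slice gl) (in_L2v_slice hl) => t g h It.
  by rewrite ipv_sum//; [exact: g|exact: h].
have ii i := (ip_slice (gl i) (hl i)).1.
split; first by apply: aeint_ae E1 _; exact: aeint_sum.
rewrite (ipv_sum measurable_QT gl hl) -(ae_eq_Rintegral E1) Rint_sum//.
by apply: eq_bigr => i _; rewrite (ip_slice (gl i) (hl i)).2.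
Qed.

Lemma gradxP w : (exists G, is_gradx Om T w G) -> is_gradx Om T w (gradx Om T w).
Proof. by move=> wG; apply: (@xgetPex _ (fun=> 0) [set G | is_gradx Om T w G]). Qed.

Lemma is_gradx_ae w z G : {ae st, forall p, Q p -> w p = z p} -> is_gradx Om T w G -> is_gradx Om T z G.
Proof.
move=> wz [gl wG]; split => //; have := ae_sliceX wz.
by apply: filterS2 wG => t wG h It; apply: weak_gradient_ae (h It) (wG It).
Qed.

(** A genuine equality, not one up to null sets: both functions have the same set of gradients, from
    which the same element is chosen. *)
Lemma gradx_ae w z : {ae st, forall p, Q p -> w p = z p} -> gradx Om T w = gradx Om T z.
Proof.
move=> wz; rewrite /gradx; congr (xget _ _); apply/seteqP; split=> G /=; apply: is_gradx_ae => //.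
by apply: filterS wz => p H Qp; rewrite H.
Qed.

(** Uniqueness holds on almost every slice; as the gradients are measurable on [Q], null slices make
    a null set. *)
Lemma is_gradx_unique w G H : is_gradx Om T w G -> is_gradx Om T w H ->
  {ae st, forall p, Q p -> G p = H p}.
Proof.
move=> [gl wG] [hl wH].
have K : {ae st, forall p, forall i, Q p -> G p ord0 i - H p ord0 i = 0}.
  apply: ae_forall_count => i; apply: slice_aeX0 => //.
    by apply: measurable_funB; [case: (gl i)|case: (hl i)].
  apply: filterS2 wG wH => t wG wH It.
  have := weak_gradient_unique oOm bOm (wG It) (wH It).
  by apply: filterS => x h Ox; have := h Ox; rewrite /slice => ->; rewrite subrr.
by apply: filterS K => p K Qp; apply/rowP => i; apply/eqP; rewrite -subr_eq0 K.
Qed.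

Lemma is_gradx_comb a w z G H : in_L2 st Q w -> in_L2 st Q z ->
  is_gradx Om T w G -> is_gradx Om T z H ->
  is_gradx Om T (fun p => a * w p + z p) (fun p => a *: G p + H p).
Proof.
move=> wl zl [gl wG] [hl zH]; split.
  by apply: in_L2vD; [exact: measurable_QT|exact: (in_L2vZ measurable_QT a gl)|exact: hl].
have wzl : {ae lam, forall t, I t -> L2 (slice w t) /\ L2 (slice z t)}.
  by apply: filterS2 (in_L2_slice wl) (in_L2_slice zl) => t h1 h2 It; split; [exact: h1|exact: h2].
apply: filterS3 wzl wG zH => t wzl wG zH It; have [h1 h2] := wzl It.
exact: (weak_gradient_comb oOm bOm a h1 h2 (wG It) (zH It)).
Qed.

Lemma L2H10_L2 w : L2H10 Om T w -> in_L2 st Q w. Proof. by case. Qed.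

Lemma L2H10_gradx w : L2H10 Om T w -> is_gradx Om T w (gradx Om T w).
Proof. by case=> _ wG _ _; exact: gradxP. Qed.

Lemma L2H10_H10 w : L2H10 Om T w -> {ae lam, forall t, I t -> H10 Om (slice w t)}.
Proof. by case. Qed.

Lemma L2H10_slice_gradx w : L2H10 Om T w -> {ae lam, forall t, I t ->
  weak_gradient Om (slice w t) (slice (gradx Om T w) t)}.
Proof. by case/L2H10_gradx. Qed.

(** The slices of [gradx] are weak gradients of the slices of [w], so the squared H1 norm is, at
    almost every time, a sum of inner integrals of functions integrable on [Q]. *)
Lemma L2H10_curve w : L2H10 Om T w -> H10curve (slice w).
Proof.
move=> hw; have [wl _ pw sw] := hw; split => //; first exact: strong_H10curve.
have [gl wG] := L2H10_gradx hw.
apply: aeint_ae (aeintD mI (ip_slice wl wl).1 (ipv_slice gl gl).1).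
apply: filterS wG => t wG It; rewrite hn_sq.
by rewrite (hip_weak_gradient oOm bOm (wG It)).
Qed.

Lemma curve_L2H10 w G : in_L2 st Q w -> is_gradx Om T w G -> H10curve (slice w) -> L2H10 Om T w.
Proof.
move=> wl wG [pw sw _]; split => //; first by exists G.
exact: H10curve_strong.
Qed.

Lemma L2H10_comb a w z : L2H10 Om T w -> L2H10 Om T z -> L2H10 Om T (fun p => a * w p + z p).
Proof.
move=> hw hz; apply: curve_L2H10.
- by apply: in_L2D; [exact: measurable_QT|exact: (in_L2Z measurable_QT a (L2H10_L2 hw))|exact: L2H10_L2].
- apply: (is_gradx_comb _ _ _ (L2H10_gradx hw) (L2H10_gradx hz)); exact: L2H10_L2.
- exact: (H10curve_comb oOm bOm a (L2H10_curve hw) (L2H10_curve hz)).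
Qed.

Lemma L2H10B v u : L2H10 Om T v -> L2H10 Om T u -> L2H10 Om T (v \- u).
Proof.
move=> hv hu; have := L2H10_comb (-1) hu hv; congr L2H10.
by apply/funext => p; rewrite mulN1r addrC.
Qed.

Lemma gradxB v u : L2H10 Om T v -> L2H10 Om T u ->
  {ae st, forall p, Q p -> gradx Om T (v \- u) p = gradx Om T v p - gradx Om T u p}.
Proof.
move=> hv hu; have := is_gradx_comb (-1) (L2H10_L2 hu) (L2H10_L2 hv) (L2H10_gradx hu) (L2H10_gradx hv).
have -> : (fun p => -1 * u p + v p) = v \- u by apply/funext => p; rewrite mulN1r addrC.
move=> /(is_gradx_unique (L2H10_gradx (L2H10B hv hu))); apply: filterS => p H Qp.
by rewrite H// scaleN1r addrC.
Qed.

Lemma time_test_continuous eta : time_test_fun T eta -> continuous eta /\ continuous (derive1 eta).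
Proof.
move=> [de _]; split=> x; apply/differentiable_continuous/derivable1_diffP.
  exact: (de 0%N x).
exact: (de 1%N x).
Qed.

Lemma continuous_bounded_I (g : R -> R) : continuous g -> exists C, forall t, I t -> `|g t| <= C.
Proof.
move=> cg; have cK : compact (g @` `[0, T]).
  by apply: continuous_compact; [exact: continuous_subspaceT|exact: segment_compact].
have /compact_bounded[M [_ HM]] := cK; exists (M + 1) => t.
rewrite /= in_itv /= => /andP[t0 tT]; apply: HM; first by rewrite ltrDl.
by exists t => //; rewrite /= in_itv /= !ltW.
Qed.

Lemma aeint_mulC (f g : R -> R) : aeint lam I f -> continuous g -> aeint lam I (fun t => f t * g t).
Proof.
move=> fi cg; have [C HC] := continuous_bounded_I cg.
apply: aeint_dominated (aeintZ mI C (aeint_abs fi)) _ => //.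
  by apply: aemeasM => //; [exact: aeint_aemeas|exact: continuous_aemeas].
by apply: aeW => t It; rewrite normrM mulrC ler_wpM2r// HC.
Qed.

Lemma ip_slice_cst w psi : L2H10 Om T w -> H10 Om psi ->
  aeint lam I (fun t => ip mu Om (slice w t) psi).
Proof.
Abort.

End parabolic_functions.

(** * Weak time derivatives *)

Section time_derivative.
Context (R : realType) (n : nat).
Local Notation E := 'rV[R]_n.
Variables (Om : set E) (T : R).
Hypotheses (oOm : open Om) (bOm : bounded_set Om) (T0 : 0 < T).
Local Notation mu := (leb R n).
Local Notation lam := (@lebesgue_measure R).
Local Notation st := (leb_st R n).
Local Notation I := (`]0, T[%classic : set (measurableTypeR R)).
Local Notation Q := (QT Om T).
Local Notation L2 := (in_L2 mu Om).
Local Notation hn := (hn Om).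
Local Notation H10curve := (H10curve Om T).
Local Notation Hm1curve := (Hm1curve Om T).
Implicit Types (w z u v V : spacetime R n -> R) (G H tau : spacetime R n -> E) (psi : E -> R).
Implicit Types (xi zeta : R -> (E -> R) -> R).

Let mI : measurable I. Proof. exact: measurable_itv. Qed.
Let mOm : measurable Om. Proof. exact: open_rV_measurable. Qed.

Lemma Hm1curve_cst l : Hm1 Om l -> Hm1curve (fun=> l).
Proof. by move=> hl; apply: L2curve_cst => //; exact: dn0. Qed.

Lemma ip_slice_cst w psi : L2H10 Om T w -> L2 psi ->
  aeint lam I (fun t => ip mu Om (slice w t) psi).
Proof.
move=> hw pl; have := pairing_aeint oOm bOm (Hm1curve_cst (ip_Hm1 oOm pl)) (L2H10_curve oOm bOm hw).
by apply: aeint_ae; apply: aeW => t _; rewrite ipC.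
Qed.

Lemma is_dtP w xi : is_dt Om T w xi <-> Hm1curve xi /\
  forall psi eta, H10 Om psi -> time_test_fun T eta ->
    \int[lam]_(t in I) (xi t psi * eta t) =
    - \int[lam]_(t in I) (ip mu Om (slice w t) psi * derive1 eta t).
Proof.
rewrite /is_dt; split=> -[hx H]; (split; first exact/(L2Hm1P T oOm bOm)) => psi eta hp te.
  by rewrite (H psi eta hp te); congr (- _); apply: eq_Rintegral => t _; rewrite ipE.
by rewrite (H psi eta hp te); congr (- _); apply: eq_Rintegral => t _; rewrite ipE.
Qed.

Lemma dtP w : (exists xi, is_dt Om T w xi) -> is_dt Om T w (dt Om T w).
Proof. by move=> wx; apply: (@xgetPex _ (fun _ _ => 0) [set xi | is_dt Om T w xi]). Qed.

Lemma is_dt_ae w z xi : {ae st, forall p, Q p -> w p = z p} -> is_dt Om T w xi -> is_dt Om T z xi.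
Proof.
move=> wz /is_dtP[hx H]; apply/is_dtP; split => // psi eta hp te.
rewrite H//; congr (- _); apply: ae_eq_Rintegral.
have := ae_sliceX wz; apply: filterS => t h It; congr (_ * _).
by apply: ip_ae; [exact: (h It)|exact: aeW].
Qed.

Lemma dt_ae w z : {ae st, forall p, Q p -> w p = z p} -> dt Om T w = dt Om T z.
Proof.
move=> wz; rewrite /dt; congr (xget _ _); apply/seteqP; split=> xi /=; apply: is_dt_ae => //.
by apply: filterS wz => p H Qp; rewrite H.
Qed.

Lemma Hm1curve_pair_aeint xi psi : Hm1curve xi -> H10 Om psi -> aeint lam I (fun t => xi t psi).
Proof. by move=> hx hp; apply: (pairing_aeint oOm bOm hx); exact: H10curve_cst. Qed.

Lemma is_dt_comb a w z xi zeta : L2H10 Om T w -> L2H10 Om T z ->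
  is_dt Om T w xi -> is_dt Om T z zeta ->
  is_dt Om T (fun p => a * w p + z p) (fun t psi => a * xi t psi + zeta t psi).
Proof.
move=> hw hz /is_dtP[hx Hx] /is_dtP[hy Hy]; apply/is_dtP; split.
  exact: (Hm1curve_comb oOm bOm a hx hy).
move=> psi eta hp te; have [ce ce'] := time_test_continuous te.
have hpl := H1_L2 (H10_H1 hp).
have i1 := aeint_mulC (Hm1curve_pair_aeint hx hp) ce.
have i2 := aeint_mulC (Hm1curve_pair_aeint hy hp) ce.
have j1 := aeint_mulC (ip_slice_cst hw hpl) ce'.
have j2 := aeint_mulC (ip_slice_cst hz hpl) ce'.
transitivity (a * \int[lam]_(t in I) (xi t psi * eta t) + \int[lam]_(t in I) (zeta t psi * eta t)).
  rewrite -(RintZ mI a i1) -(RintD mI (aeintZ mI a i1) i2).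
  by apply: eq_Rintegral => t _; rewrite mulrDl mulrA.
rewrite (Hx psi eta hp te) (Hy psi eta hp te) mulrN -opprD; congr (- _).
rewrite -(RintZ mI a j1) -(RintD mI (aeintZ mI a j1) j2).
apply: ae_eq_Rintegral.
apply: filterS2 (in_L2_slice oOm (L2H10_L2 hw)) (in_L2_slice oOm (L2H10_L2 hz)) => t wl zl It.
have -> : slice (fun p => a * w p + z p) t = (fun x => a * slice w t x + slice z t x) by [].
rewrite ipDl ?ipZl//; try by [exact: wl|exact: zl].
  by rewrite mulrDl mulrA.
by apply: in_L2Z => //; exact: wl.
Qed.

End time_derivative.

Lemma squeeze_continuous (R : realType) (f g : R -> R) (x : R) :
  (forall t, `|f t - f x| <= g t) -> g @ x --> 0 -> {for x, continuous f}.
Proof.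
move=> fg g0; apply/cvgrPdist_le => e e0; have /cvgrPdist_le/(_ e e0) := g0.
apply: filterS => t; rewrite sub0r normrN distrC => /(le_trans (ler_norm _)).
exact: le_trans.
Qed.

Definition clamp (R : realType) (T t : R) : R := Num.max 0 (Num.min t T).

Lemma clamp_itv (R : realType) (T t : R) : 0 < T -> 0 <= clamp T t <= T.
Proof.
by move=> T0; rewrite le_max lexx /= ge_max (ltW T0) ge_min lexx orbT.
Qed.

Lemma clamp_id (R : realType) (T t : R) : 0 <= t <= T -> clamp T t = t.
Proof. by move=> /andP[t0 tT]; rewrite /clamp (min_idPl tT) (max_idPr t0). Qed.

Lemma clamp_le0 (R : realType) (T t : R) : t <= 0 -> clamp T t = 0.
Proof. by move=> t0; apply/max_idPl; rewrite ge_min t0. Qed.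

Lemma continuous_clamp (R : realType) (T : R) : continuous (clamp T).
Proof.
move=> t; apply: (@continuous_max R R (fun=> 0) (fun s => Num.min s T)); first exact: cvg_cst.
by apply: (@continuous_min R R id (fun=> T)); [exact: cvg_id|exact: cvg_cst].
Qed.

(** * The energy inequality *)

Lemma weighted_young (R : realFieldType) (c b d e : R) : 0 < c -> b <= d * e ->
  2 * b <= c * e ^+ 2 + c^-1 * d ^+ 2.
Proof.
move=> c0; have := young d e (k := c^-1); rewrite invr_gt0 invrK => /(_ c0).
lra.
Qed.

(** Supplies the integrable extension by zero to the whole line on which [prim] and the window
    averages are built. *)
Lemma aeint_extend (R : realType) (T : R) (F : R -> R) :
  aeint (@lebesgue_measure R) (`]0, T[%classic : set (measurableTypeR R)) F ->
  exists q : R -> R, [/\ (@lebesgue_measure R).-integrable setT (EFin \o q),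
    forall t, ~ `]0, T[%classic t -> q t = 0 &
    {ae @lebesgue_measure R, forall t, `]0, T[%classic t -> F t = q t}].
Proof.
move=> [g gi Fg]; exists (g \_ `]0, T[); split.
- have mI : measurable (`]0, T[%classic : set (measurableTypeR R)) by exact: measurable_itv.
  by have := (integrable_mkcond _ mI).1 gi; rewrite restrict_EFin.
- by move=> t nI; rewrite patchE memNset.
- by apply: filterS Fg => t H It; rewrite patchE mem_set// H.
Qed.

Section energy.
Context (R : realType) (n : nat).
Local Notation E := 'rV[R]_n.
Variables (Om : set E) (T : R).
Hypotheses (oOm : open Om) (bOm : bounded_set Om) (T0 : 0 < T).
Local Notation mu := (leb R n).
Local Notation lam := (@lebesgue_measure R).
Local Notation st := (leb_st R n).
Local Notation I := (`]0, T[%classic : set (measurableTypeR R)).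
Local Notation L2 := (in_L2 mu Om).
Local Notation ip := (ip mu Om).
Local Notation hn := (hn Om).
Local Notation dn := (dn Om).
Variables (w V : spacetime R n -> R) (xi : R -> (E -> R) -> R).
Hypotheses (hw : L2H10 Om T w) (hxi : is_dt Om T w xi) (hV : time_continuous_version Om T w V).

Let mI : measurable I. Proof. exact: measurable_itv. Qed.
Let mOm : measurable Om. Proof. exact: open_rV_measurable. Qed.

#[local] Instance ae_filter_energy : Filter (nbhs (almost_everywhere lam)) := ae_filter_ringOfSetsType lam.

(* [V] is only controlled on [[0, T]]; this extension makes backward increments
   meaningful for every time. *)
Definition clamped t : E -> R := slice V (clamp T t).

Lemma clamped_L2 t : L2 (clamped t).
Proof. by case: hV => + _ _; apply; exact: clamp_itv. Qed.

Lemma clamped_dist_cvg t0 :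
  (fun t => Num.sqrt (ip (clamped t \- clamped t0) (clamped t \- clamped t0))) @ t0 --> 0.
Proof.
case: hV => _ /(_ (clamp T t0) (clamp_itv t0 T0)) cV _.
(* Clamping turns continuity relative to [0, T] into continuity on the whole line. *)
have cc : clamp T t @[t --> t0] --> within `[0, T]%classic (nbhs (clamp T t0)).
  move=> A wA; have H : nbhs t0 (clamp T @^-1` [set x | `[0, T]%classic x -> A x]) by exact: (@continuous_clamp R T t0 _ wA).
  by apply: filterS H => t /= H; apply: H; rewrite in_itv /=; exact: clamp_itv.
have := cvg_comp _ _ cc cV.
have -> : (fun s => L2norm mu Om (slice V s \- slice V (clamp T t0))) \o clamp T =
    EFin \o (fun t => Num.sqrt (ip (clamped t \- clamped t0) (clamped t \- clamped t0))).
  apply/funext => t /=; rewrite L2norm_ip//.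
  exact: (in_L2B mOm (clamped_L2 t) (clamped_L2 t0)).
by move=> /fine_cvg.
Qed.

Lemma continuous_ip_clamped psi : L2 psi -> continuous (fun t => ip (clamped t) psi).
Proof.
move=> pl t0; apply: (@squeeze_continuous _ _ (fun t => Num.sqrt (ip (clamped t \- clamped t0)
  (clamped t \- clamped t0)) * Num.sqrt (ip psi psi))).
  move=> t; rewrite -ipBl//; try exact: clamped_L2.
  by apply: ip_le => //; exact: (in_L2B mOm (clamped_L2 t) (clamped_L2 t0)).
have -> : 0 = 0 * Num.sqrt (ip psi psi) by rewrite mul0r.
by apply: cvgMl; exact: clamped_dist_cvg.
Qed.

Lemma ip_sqB f g : L2 f -> L2 g ->
  ip f f - ip g g = ip (f \- g) (f \- g) + 2 * ip (f \- g) g.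
Proof.
move=> fl gl; have dl := in_L2B mOm fl gl.
rewrite (ipBl mOm fl gl dl) (ipBl mOm fl gl gl) !(ipBr mOm fl gl) // (ipC mu Om g f); ring.
Qed.

Definition energy t := ip (clamped t) (clamped t).

Lemma continuous_energy : continuous energy.
Proof.
move=> t0; apply: (@squeeze_continuous _ _ (fun t =>
  Num.sqrt (ip (clamped t \- clamped t0) (clamped t \- clamped t0)) *
  (Num.sqrt (ip (clamped t \- clamped t0) (clamped t \- clamped t0)) +
    2 * Num.sqrt (energy t0)))).
  move=> t; rewrite /energy ip_sqB; try exact: clamped_L2.
  have dl := in_L2B mOm (clamped_L2 t) (clamped_L2 t0).
  rewrite mulrDr -expr2 sqr_sqrtr ?ip_ge0//; apply: le_trans (ler_normD _ _) _.
  rewrite ger0_norm ?ip_ge0// lerD2l mulrCA normrM ger0_norm// ler_wpM2l//.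
  by apply: ip_le => //; exact: clamped_L2.
have -> : 0 = 0 * (0 + 2 * Num.sqrt (energy t0)) by rewrite mul0r.
by apply: cvgM; [exact: clamped_dist_cvg|apply: cvgD; [exact: clamped_dist_cvg|exact: cvg_cst]].
Qed.

(* The weak formulation gives this for [0 < s], the case [s <= 0] follows by
   continuity; both sides are constant for negative times. *)
Lemma clamped_increment psi (q : R -> R) : H10 Om psi -> lam.-integrable setT (EFin \o q) ->
  (forall t, ~ I t -> q t = 0) -> {ae lam, forall t, I t -> xi t psi = q t} ->
  forall s t, -2 < s -> s <= t -> t < T ->
  ip (clamped t) psi - ip (clamped s) psi = prim q t - prim q s.
Proof.
move=> hp qi q0 xq; have pl := H1_L2 (H10_H1 hp).
pose y t := ip (clamped t) psi; have cy : continuous y by exact: continuous_ip_clamped.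
have qI : aeint lam I q by exact: integrable_setT_aeint.
have key s t : 0 < s -> s < t -> t < T -> y t - y s = prim q t - prim q s.
  move=> s0 st tT; rewrite (primBI qi q0) ?ltW//; last by move: s0; lra.
  apply: (@weak_derivative_FTC R T y q cy qI) => // eta te.
  case/(is_dtP T oOm bOm): hxi => _ /(_ psi eta hp te).
  have -> : \int[lam]_(t in I) (xi t psi * eta t) = \int[lam]_(t in I) (q t * eta t).
    by apply: ae_eq_Rintegral; apply: filterS xq => r H Ir; rewrite H.
  move=> ->; congr (- _); apply: ae_eq_Rintegral.
  case: hV => _ _; apply: filterS => r H Ir; congr (_ * _).
  rewrite /y; have -> : clamped r = slice V r.
    rewrite /clamped clamp_id//; move: Ir; rewrite /= in_itv /= => /andP[h1 h2].
    by rewrite !ltW.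
  apply: ip_ae; last exact: aeW.
  by apply: filterS (H Ir) => x K Ox; rewrite /slice K.
pose D t := y t - prim q t.
have cD x : -2 < x -> {for x, continuous D}.
  move=> x2; apply: (@cvgB R R R (nbhs (x : R))); first exact: cy.
  exact: (continuous_prim qi x2).
(* T / 2 serves as the reference point for showing that [D] is constant on ]0, T[. *)
have [T2 T2'] : 0 < T / 2 /\ T / 2 < T by move: T0; split; lra.
have DT t : 0 < t -> t < T -> D t = D (T / 2).
  move=> t0 tT; case: (ltgtP t (T / 2)) => [h|h|->] //.
    have := key _ _ t0 h T2'; rewrite /D; move: (y _) (y _) (prim _ _) (prim _ _) => ? ? ? ?; lra.
  have := key _ _ T2 h tT; rewrite /D; move: (y _) (y _) (prim _ _) (prim _ _) => ? ? ? ?; lra.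
have D0 : D 0 = D (T / 2).
  have c1 : D x @[x --> 0^'+] --> D 0 by apply: cvg_at_right_filter; apply: cD; lra.
  have c2 : D x @[x --> 0^'+] --> D (T / 2).
    apply: cvg_near_cst; near=> x; apply: DT.
      by near: x; exact: nbhs_right_gt.
    by near: x; exact: nbhs_right_lt.
  exact: (cvg_unique _ c1 c2).
have DD t : t < T -> D t = D (T / 2).
  move=> tT; have [t0|t0] := leP t 0; last exact: DT.
  rewrite -D0 /D /y /clamped !clamp_le0// !(prim_le0 q0)//.
move=> s t s2 st tT; have := DD t tT; rewrite -(DD s (le_lt_trans st tT)) /D /y.
by move: (ip _ _) (ip _ _) (prim _ _) (prim _ _) => ? ? ? ?; lra.
Unshelve. all: by end_near. Qed.

Lemma energy_step t s : energy t - energy s <= 2 * (ip (clamped t) (clamped t) - ip (clamped s) (clamped t)).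
Proof.
have vt := clamped_L2 t; have vs := clamped_L2 s.
have := ip_ge0 mu Om (clamped t \- clamped s).
rewrite ipBl ?ipBr//; try exact: (in_L2B mOm vt vs).
rewrite /energy (ipC mu Om (clamped t) (clamped s)).
by move: (ip _ _) (ip _ _) (ip _ _) => a b d; lra.
Qed.

(** Young's inequality under the time integral: -2 xi(r)(rho) <= c |rho|^2 + |xi(r)|^2 / c. As [rho]
    does not depend on r, the first term contributes c (t - s) |rho|^2. *)
Lemma increment_bound c rho s t (n2 : R -> R) : 0 < c -> H10 Om rho -> -2 < s -> s <= t -> t < T ->
  lam.-integrable setT (EFin \o n2) -> (forall t, ~ I t -> n2 t = 0) ->
  {ae lam, forall t, I t -> dn (xi t) ^+ 2 = n2 t} ->
  - (2 * (ip (clamped t) rho - ip (clamped s) rho)) <=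
  c * (t - s) * hn rho ^+ 2 + c^-1 * (prim n2 t - prim n2 s).
Proof.
move=> c0 hr s2 st tT n2i n20 dn2; have [hx _] := (is_dtP T oOm bOm w xi).1 hxi.
have [q [qi q0 xq]] := aeint_extend (Hm1curve_pair_aeint oOm bOm hx hr).
rewrite (clamped_increment hr qi q0 xq s2 st tT) (primB qi (ltW s2) st) (primB n2i (ltW s2) st).
have qI : aeint lam `[s, t] q by apply: integrable_aeint; exact: integrableS qi.
have n2I : aeint lam `[s, t] n2 by apply: integrable_aeint; exact: integrableS n2i.
have cI : aeint lam `[s, t] (fun=> c * hn rho ^+ 2).
  apply: integrable_aeint; apply: continuous_integrable_itv.
  by apply: continuous_subspaceT => ?; exact: cvg_cst.
have mst : measurable (`[s, t]%classic : set (measurableTypeR R)) by exact: measurable_itv.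
have bound : {ae lam, forall r : measurableTypeR R, (`[s, t]%classic : set (measurableTypeR R)) r -> - 2 * q r <= c * hn rho ^+ 2 + c^-1 * n2 r}.
  case: hx => px _ _; apply: filterS3 xq dn2 px => r xq dn2 px _.
  have [Ir|nI] := pselect (I r); last first.
    by rewrite q0// n20// !mulr0 addr0 mulr_ge0 ?sqr_ge0// ltW.
  rewrite -(xq Ir) -(dn2 Ir).
  have := Hm1_le oOm bOm (px Ir) hr; rewrite -/(dn (xi r)) => /ler_normlP[h _].
  have := young (dn (xi r)) (hn rho) (k := c^-1); rewrite invr_gt0 invrK => /(_ c0).
  by move: (xi r rho) (dn _) (hn _) h => a b d; rewrite expr2; lra.
have := le_Rint mst (aeintZ mst (- 2) qI) (aeintD mst cI (aeintZ mst c^-1 n2I)) bound.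
rewrite (RintZ mst _ qI) (RintD mst cI (aeintZ mst c^-1 n2I)) (RintZ mst _ n2I).
rewrite Rintegral_cst//= lebesgue_measure_itv /= lte_fin.
have -> : fine (if s < t then (t%:E - s%:E)%E else 0%E) = t - s.
  by case: ltgtP st => // -> _; rewrite subrr.
by rewrite mulNr [c * (t - s) * _]mulrAC.
Qed.

Lemma energy_le : energy T - energy 0 <= 2 * \int[lam]_(t in I) xi t (slice w t).
Proof.
have [hx _] := (is_dtP T oOm bOm w xi).1 hxi.
have [px _ dni] := hx; have [n2 [n2i n20 dn2]] := aeint_extend dni.
have hcw := L2H10_curve oOm bOm hw; have [pw _ _] := hcw.
have n2I := integrable_setT_aeint T n2i.
have K0 : 0 <= \int[lam]_(t in I) n2 t.
  by apply: Rint_ge0; apply: filterS dn2 => t H It; rewrite -H// sqr_ge0.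
(* The factor 2 counts the error twice: once in the windows, where w(t) is replaced by the simple
   curve, and once when the limit is turned back into a pairing with w(t). *)
have main c d : 0 < c -> 0 < d -> energy T - energy 0 <=
    2 * \int[lam]_(t in I) xi t (slice w t) + 2 * (c * d + c^-1 * \int[lam]_(t in I) n2 t).
  move=> c0 d0; have [g [pg sg d2i d2d]] := H10curve_approx oOm bOm hcw d0.
  have [m [A [ci [mA cg dec]]]] := simple_on_decomp sg.
  have hc i : H10 Om (ci i) by have [t It <-] := cg i; exact: pg.
  have /choice[q Hq] : forall i, exists q : R -> R, [/\ lam.-integrable setT (EFin \o q),
      forall t, ~ I t -> q t = 0 & {ae lam, forall t, I t -> xi t (ci i) = q t}].
    by move=> i; apply: aeint_extend; exact: (Hm1curve_pair_aeint oOm bOm hx (hc i)).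
  have qi i : lam.-integrable setT (EFin \o q i) by have [] := Hq i.
  have q0 i t : ~ I t -> q i t = 0 by have [_ q0 _] := Hq i; exact: q0.
  have xq : {ae lam, forall t, forall i, I t -> xi t (ci i) = q i t}.
    by apply: ae_forall_count => i; have [] := Hq i.
  have step k : {ae lam, forall t, I t -> energy t - energy (t - k.+1%:R^-1) <=
     2 * \sum_i \1_(A i) t * (prim (q i) t - prim (q i) (t - k.+1%:R^-1)) +
     (c * k.+1%:R^-1 * hn (g t \- slice w t) ^+ 2 +
      c^-1 * (prim n2 t - prim n2 (t - k.+1%:R^-1)))}.
    case: hV => _ _ Vw; apply: filterS2 Vw pw => t Vw pw It.
    have [t0 tT] : 0 < t /\ t < T by move: It; rewrite /= in_itv /= => /andP.
    have h0 : 0 < k.+1%:R^-1 :> R by rewrite invr_gt0.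
    have h1 : k.+1%:R^-1 <= 1 :> R by rewrite invf_le1// ler1n.
    set s := t - k.+1%:R^-1.
    have s2 : -2 < s by rewrite /s; move: h1; move: (k.+1%:R^-1) => h h1; lra.
    have st : s <= t by rewrite /s; move: h0; move: (k.+1%:R^-1) => h ?; lra.
    apply: le_trans (energy_step t s) _.
    have E1 r : ip (clamped r) (clamped t) = ip (clamped r) (slice w t).
      apply: ip_ae; first exact: aeW.
      rewrite /clamped [clamp T t]clamp_id; last by rewrite !ltW.
      by apply: filterS (Vw It) => x K Ox; rewrite /slice K.
    rewrite !E1; pose rho := g t \- slice w t.
    have hr : H10 Om rho by apply: H10B => //; [exact: pg|exact: pw].
    have gl := H1_L2 (H10_H1 (pg t It)); have wl := H1_L2 (H10_H1 (pw It)).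
    have E2 r : ip (clamped r) (slice w t) = ip (clamped r) (g t) - ip (clamped r) rho.
      rewrite -ipBr//; [|exact: (H1_L2 (H10_H1 hr))|exact: clamped_L2].
      by congr (ip _ _); apply/funext => x; rewrite /rho /=; ring.
    (* Each value of the simple curve is a fixed element of H10, against which the increment of V is
       the increment of a primitive. *)
    have := dec (fun v => ip (clamped t) v - ip (clamped s) v) t It; rewrite /=.
    under eq_bigr => i _ do rewrite (clamped_increment (hc i) (qi i) (@q0 i) (let: And3 _ _ x := Hq i in x) s2 st tT).
    have := increment_bound c0 hr s2 st tT n2i n20 dn2.
    rewrite [t - s]subKr -/rho !E2; move: (ip _ _) (ip _ _) (ip _ _) (ip _ _) (\sum_i _) (_ * hn _ ^+ 2) (c^-1 * _).
    by move=> a1 a2 a3 a4 a5 a6 a7; lra.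
  have cE x : -2 < x -> {for x, continuous energy} by move=> _; exact: continuous_energy.
  have := averaged_energy T0 c0 cE mA qi q0 d2i n2i n20 step.
  have qI i : aeint lam I (fun t => \1_(A i) t * q i t).
    by apply: aeint_indicM => //; exact: integrable_setT_aeint.
  have wI := pairing_aeint oOm bOm hx hcw.
  have := le_Rint mI (aeintZ mI 2 (aeint_sum mI (index_enum 'I_m) qI))
    (aeintD mI (aeintZ mI 2 wI) (aeintD mI (aeintZ mI c d2i) (aeintZ mI c^-1 n2I))).
  rewrite (RintZ mI 2 (aeint_sum mI (index_enum 'I_m) qI)) (Rint_sum mI _ qI).
  rewrite (RintD mI (aeintZ mI 2 wI) (aeintD mI (aeintZ mI c d2i) (aeintZ mI c^-1 n2I))).
  rewrite (RintD mI (aeintZ mI c d2i) (aeintZ mI c^-1 n2I)) (RintZ mI 2 wI) (RintZ mI c d2i) (RintZ mI _ n2I).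
  move=> H1 H2.
  have cd : c * \int[lam]_(t in I) hn (g t \- slice w t) ^+ 2 <= c * d by rewrite ler_wpM2l ?ltW.
  suff : 2 * (\sum_i \int[lam]_(t in I) (\1_(A i) t * q i t)) <= 2 * \int[lam]_(t in I) xi t (slice w t) +
      (c * \int[lam]_(t in I) hn (g t \- slice w t) ^+ 2 + c^-1 * \int[lam]_(t in I) n2 t).
    move=> H3; apply: le_trans H2 _; apply: le_trans (lerD H3 (lexx _)) _.
    by rewrite -addrA lerD2l mulr_natl mulr2n; apply: lerD; rewrite lerD2r.
  apply: H1; apply: filterS3 xq (filterI dn2 px) pw => t xqt [dnt pxt] pwt It.
  under eq_bigr => i _ do rewrite -xqt//.
  rewrite -(dec (xi t) t It) -dnt//; have hg := pg t It; have hw' := pwt It.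
  have -> : xi t (g t) = xi t (slice w t) + xi t (g t \- slice w t).
    by rewrite (Hm1B (pxt It) hg hw') addrC subrK.
  have := Hm1_le oOm bOm (pxt It) (H10B oOm bOm hg hw'); rewrite -/(dn (xi t)) => /ler_normlP[_ h].
  by rewrite mulrDr lerD2l; exact: weighted_young.
apply/ler_addgt0Pr => e e0; move: main K0.
move: (\int[lam]_(t in I) n2 t) (\int[lam]_(t in I) xi t (slice w t)) (energy T) (energy 0) => K X a b main K0.
(* [c] makes K / c at most e / 4, and then d = e / (4 c) makes c d equal to e / 4; the factor 2 in
   [main] brings the total to [e]. *)
pose c := 4 * K / e + 1; have c0 : 0 < c by rewrite ltr_wpDl// divr_ge0 ?mulr_ge0// ltW.
have d0 : 0 < e / (4 * c) by rewrite divr_gt0// mulr_gt0.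
apply: le_trans (main c _ c0 d0) _; rewrite lerD2l.
have -> : c * (e / (4 * c)) = e / 4 by field; rewrite gt_eqF.
suff : c^-1 * K <= e / 4 by move: (c^-1 * K) => x; lra.
rewrite mulrC ler_pdivrMr// /c; have -> : e / 4 * (4 * K / e + 1) = K + e / 4 by field; rewrite gt_eqF.
by rewrite lerDl; lra.
Qed.

End energy.

(** * The majorant *)

(** With e = v - u: [gg] is |grad e|^2; [gv], [gu], [tg] pair grad v, grad u and tau with grad e;
    [xv], [xu], [fd] pair v_t, u_t and f with e; [a], [b], [g] are the norms of tau - grad v, of F
    and of grad e. The hypotheses are, in order, linearity, Cauchy-Schwarz, the residual bound, the
    variational inequality and the energy inequality. *)
Lemma pre_young_arith (R : realFieldType) (eT e0 gg gv gu tg xv xu fd a b C g : R) :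
  gg = gv - gu -> - (tg - gv) <= a * g -> xv - fd + tg <= b * (C * g) -> fd <= xu + gu ->
  eT - e0 <= 2 * (- 1 * xu + xv) -> eT + 2 * gg <= e0 + 2 * ((a + C * b) * g).
Proof.
move=> -> h1 h2 h3 h4; have -> : (a + C * b) * g = a * g + b * (C * g) by ring.
by move: (a * g) (b * (C * g)) h1 h2 h3 h4 => x y; lra.
Qed.

Lemma ae_and d (X : measurableType d) (R : realType) (mu : {measure set X -> \bar R})
    (P P' : X -> Prop) : {ae mu, forall x, P x} -> {ae mu, forall x, P' x} ->
  {ae mu, forall x, P x /\ P' x}.
Proof. by move=> h1 h2; apply: filterS2 h1 h2. Qed.

Section majorant.
Context (R : realType) (n : nat).
Local Notation E := 'rV[R]_n.
Variables (Om : set E) (T : R) (phi : E -> R) (f : spacetime R n -> R).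
Hypotheses (oOm : open Om) (bOm : bounded_set Om) (T0 : 0 < T).
Local Notation mu := (leb R n).
Local Notation lam := (@lebesgue_measure R).
Local Notation st := (leb_st R n).
Local Notation I := (`]0, T[%classic : set (measurableTypeR R)).
Local Notation Q := (QT Om T).
Local Notation L2 := (in_L2 mu Om).
Local Notation grad := (gradx Om T).
Hypotheses (phil : L2 phi) (fl : in_L2 st Q f).

Let mI : measurable I. Proof. exact: measurable_itv. Qed.
Let mOm : measurable Om. Proof. exact: open_rV_measurable. Qed.
Let mQ : measurable Q. Proof. exact: measurable_QT. Qed.

Section residuals.
Variables (v : spacetime R n -> R) (tau : spacetime R n -> E).
Hypotheses (hv : L2H10 Om T v) (hdt : exists g, is_dt_fun Om T v g) (htau : Hdiv Om T tau).
Local Notation res := (residual Om T f v tau).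

Lemma dt_funP : is_dt_fun Om T v (dt_fun Om T v).
Proof. exact: (@xgetPex _ (fun=> 0) [set g | is_dt_fun Om T v g]). Qed.

Lemma divxP : is_divx Om T tau (divx Om T tau).
Proof. by case: htau => _ h; apply: (@xgetPex _ (fun=> 0) [set g | is_divx Om T tau g]). Qed.

Lemma measurable_residual : measurable_fun Q res.
Proof.
apply: measurable_funB; last by case: dt_funP.
by apply: measurable_funD; [case: fl|case: divxP].
Qed.

Lemma measurable_obstacle_residual : measurable_fun Q (obstacle_residual Om T phi f v tau).
Proof.
apply: measurable_fun_ifD => //.
- by apply: measurable_fun_ltr; [exact: (measurable_const_in_time oOm (in_L2_measurable phil))|exact: in_L2_measurable (L2H10_L2 hv)].
- exact: measurable_residual.
- by apply: measurable_maxr; [exact: measurable_cst|exact: measurable_residual].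
Qed.

(** On almost every slice v_t and div tau are functions in L2; integrating div tau by parts against
    H10 collects all terms into the residual. *)
Lemma residual_slice : {ae lam, forall t, I t -> L2 (slice res t) /\
  forall psi, H10 Om psi ->
    dt Om T v t psi - ip mu Om (slice f t) psi + ipv mu Om (slice tau t) (wgrad Om psi) =
    - ip mu Om (slice res t) psi}.
Proof.
case: htau => tl _; have [_ dtf] := dt_funP; have [_ dvf] := divxP.
have ftl : {ae lam, forall t, I t -> L2 (slice f t) /\ in_L2v mu Om (slice tau t)}.
  by apply: filterS2 (in_L2_slice oOm fl) (in_L2v_slice oOm tl) => t h1 h2 It; split; [exact: h1|exact: h2].
apply: filterS3 dtf dvf ftl => t dtf dvf ftl It.
have [dl dH] := dtf It; have [vl vH] := dvf It; have [ftl' tl'] := ftl It.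
have rl : L2 (slice res t) by exact: (in_L2B mOm (in_L2D mOm ftl' vl) dl).
split => // psi hp; have pl := H1_L2 (H10_H1 hp).
rewrite dH// (divergence_H10 oOm bOm tl' vl vH hp) -ipE.
have -> : ip mu Om (slice res t) psi = ip mu Om (slice f t) psi + ip mu Om (slice (divx Om T tau) t) psi -
    ip mu Om (slice (dt_fun Om T v) t) psi.
  by rewrite -ipDl// -ipBl//; exact: in_L2D.
rewrite /slice; move: (ip _ _ _ _) (ip _ _ _ _) (ip _ _ _ _) => a b c; ring.
Qed.

End residuals.

Variables (u v : spacetime R n -> R) (tau : spacetime R n -> E) (e : spacetime R n -> R) (C : R).
Hypotheses (hu : admissible Om T phi u) (hv : admissible Om T phi v).
Hypothesis (VI : \int[st]_(p in Q) (f p * (v p - u p)) <=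
        \int[lam]_(t in I) dt Om T u t (slice v t \- slice u t) +
        \int[st]_(p in Q) dotv (grad u p) (grad (v \- u) p)).
Hypotheses (hdt : exists g, is_dt_fun Om T v g) (htau : Hdiv Om T tau).
Hypotheses (he : time_continuous_version Om T (v \- u) e) (hC : friedrichs_constant Om C).
Local Notation obs := (obstacle_residual Om T phi f v tau).
Hypothesis (Fl : in_L2 st Q obs).

(** The squared Friedrichs inequality on almost every slice, integrated in time. *)
Lemma friedrichs_QT w : L2H10 Om T w -> ip st Q w w <= C ^+ 2 * ipv st Q (grad w) (grad w).
Proof.
move=> hw; have [C0 FC] := hC; have [gl _] := L2H10_gradx hw; have wl := L2H10_L2 hw.
have [i1 ->] := ip_slice oOm wl wl; have [i2 ->] := ipv_slice oOm gl gl.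
rewrite -(RintZ mI _ i2); apply: le_Rint => //; first exact: aeintZ.
apply: filterS2 (L2H10_H10 hw) (L2H10_slice_gradx hw) => t hwt wG It.
have h := hwt It; have g := wG It; have h1 := H10_H1 h.
have := FC _ h; rewrite (L2norm_ip mOm (H1_L2 h1)) (L2normv_ipv mOm (H1_wgrad_L2v h1)).
rewrite (ipv_ae (wgrad_ae oOm bOm g) (wgrad_ae oOm bOm g)) -EFinM lee_fin => k.
rewrite -(sqr_sqrtr (ip_ge0 mu Om (slice w t))) -(sqr_sqrtr (ipv_ge0 mu Om _)) -exprMn.
by rewrite ler_pXn2r ?nnegrE ?sqrtr_ge0// mulr_ge0 ?sqrtr_ge0 ?ltW.
Qed.

Lemma gradxB_ipv G : in_L2v st Q G -> ipv st Q G (grad (v \- u)) = ipv st Q G (grad v) - ipv st Q G (grad u).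
Proof.
move=> gl; have [[hv1 _ _] [hu1 _ _]] := (hv, hu).
have [gvl _] := L2H10_gradx hv1; have [gul _] := L2H10_gradx hu1.
rewrite -(ipvBr mQ gvl gul gl); apply: ipv_ae; first exact: aeW.
exact: gradxB.
Qed.

(* Where [v = phi] one has [v - u <= 0], so that only the positive part of the
   residual matters. *)
Lemma obstacle_sign : {ae lam, forall t, I t -> {ae mu, forall x, Om x ->
  - (residual Om T f v tau (x, t) * (v (x, t) - u (x, t))) <=
  `|obs (x, t)| * `|v (x, t) - u (x, t)|}}.
Proof.
have [[_ _ pv] [_ _ pu]] := (hv, hu).
apply: filterS2 (ae_sliceX pv) (ae_sliceX pu) => t hvt hut It; apply: filterS2 (hvt It) (hut It) => x vx ux Ox.
rewrite /obstacle_residual /=; case: ifPn => [_|].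
  by rewrite -normrM ler_normr lexx orbT.
rewrite -leNgt => v1; have vphi : v (x, t) = phi x by apply/eqP; rewrite eq_le v1 vx.
have d0 : v (x, t) - u (x, t) <= 0 by rewrite vphi subr_le0 ux.
rewrite -mulrN (ler0_norm d0) ler_wpM2r ?oppr_ge0//.
by rewrite ger0_norm ?le_max ?lexx// orbT.
Qed.

Local Notation D := (v \- u).
Let hD : L2H10 Om T D. Proof. by case: hv => h1 _ _; case: hu => h2 _ _; exact: L2H10B. Qed.
Local Notation G := (grad D).
Local Notation rt := Num.sqrt.

Lemma pairing_residual_le :
  \int[lam]_(t in I) dt Om T v t (slice D t) - ip st Q f D + ipv st Q tau G <=
  rt (ip st Q obs obs) * (C * rt (ipv st Q G G)).
Proof.
have [gl _] := L2H10_gradx hD; have dl := L2H10_L2 hD; have [tl _] := htau.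
have hcD := L2H10_curve oOm bOm hD.
have [_ hdtv _] := hv; have [hxi _] := (is_dtP T oOm bOm v _).1 (dtP hdtv).
have i1 := pairing_aeint oOm bOm hxi hcD.
have [i2 ->] := ip_slice oOm fl dl; have [i3 ->] := ipv_slice oOm tl gl.
rewrite -(RintB mI i1 i2) -(RintD mI (aeintB mI i1 i2) i3).
have al : in_L2 st Q (fun p => `|obs p|).
  apply: (in_L2_le mQ _ _ Fl); last by move=> p _; rewrite normr_id.
  by apply: measurableT_comp => //; exact: (in_L2_measurable Fl).
have bl : in_L2 st Q (fun p => `|D p|).
  apply: (in_L2_le mQ _ _ dl); last by move=> p _; rewrite normr_id.
  by apply: measurableT_comp => //; exact: (in_L2_measurable dl).
have nsq g : ip st Q (fun p => `|g p|) (fun p => `|g p|) = ip st Q g g.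
  by rewrite !ipE; apply: eq_Rintegral => p _; rewrite -!expr2 real_normK ?num_real.
have [i4 E4] := ip_slice oOm al bl.
apply: (@le_trans _ _ (ip st Q (fun p => `|obs p|) (fun p => `|D p|))).
  rewrite E4; apply: le_Rint => //; first exact: (aeintD mI (aeintB mI i1 i2) i3).
  have ab : {ae lam, forall t, I t -> L2 (slice (fun p => `|obs p|) t) /\ L2 (slice (fun p => `|D p|) t)}.
    by apply: filterS2 (in_L2_slice oOm al) (in_L2_slice oOm bl) => t h1 h2 It; split; [exact: h1|exact: h2].
  have rs := ae_and (residual_slice hdt htau) obstacle_sign.
  have hg := ae_and (L2H10_H10 hD) (L2H10_slice_gradx hD).
  apply: filterS3 rs hg ab => t [rs sg] [hDt wG] ab It.
  have [rl rH] := rs It; have h := hDt It; have hl := H1_L2 (H10_H1 h); have [a1 b1] := ab It.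
  have E : ipv mu Om (slice tau t) (slice G t) = ipv mu Om (slice tau t) (wgrad Om (slice D t)).
    apply: ipv_ae; first exact: aeW.
    by have := wgrad_ae oOm bOm (wG It); apply: filterS => x K Ox; rewrite K.
  rewrite E rH// !ipE -(RintN mOm (in_L2_aeintM mOm rl hl)).
  apply: le_Rint => //; [|exact: in_L2_aeintM|exact: (sg It)].
  exact: (aeintN mOm (in_L2_aeintM mOm rl hl)).
have := ip_le mQ al bl; move=> /(le_trans (ler_norm _)) /le_trans; apply.
rewrite !nsq ler_wpM2l ?sqrtr_ge0//.
have [C0 _] := hC; apply: le_trans (ler_wsqrtr (friedrichs_QT hD)) _.
by rewrite sqrtrM ?sqr_ge0// sqrtr_sqr ger0_norm// ltW.
Qed.

Lemma pre_young : ip mu Om (slice e T) (slice e T) + 2 * ipv st Q G G <=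
  ip mu Om (slice e 0) (slice e 0) +
  2 * ((rt (ipv st Q (tau \- grad v) (tau \- grad v)) + C * rt (ip st Q obs obs)) * rt (ipv st Q G G)).
Proof.
have [gl _] := L2H10_gradx hD; have dl := L2H10_L2 hD; have [tl _] := htau.
have [hv1 hdtv _] := hv; have [hu1 hdtu _] := hu.
have [gvl _] := L2H10_gradx hv1; have [gul _] := L2H10_gradx hu1.
have hcD := L2H10_curve oOm bOm hD.
have [hxi _] := (is_dtP T oOm bOm v _).1 (dtP hdtv).
have [hzeta _] := (is_dtP T oOm bOm u _).1 (dtP hdtu).
have hd : is_dt Om T D (fun t psi => - 1 * dt Om T u t psi + dt Om T v t psi).
  have := is_dt_comb oOm bOm (-1) hu1 hv1 (dtP hdtu) (dtP hdtv).
  by congr (is_dt _ _ _ _); apply/funext => p; rewrite mulN1r addrC.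
have hE := energy_le oOm bOm T0 hD hd he.
have i1 := pairing_aeint oOm bOm hxi hcD; have i2 := pairing_aeint oOm bOm hzeta hcD.
rewrite (RintD mI (aeintZ mI (-1) i2) i1) (RintZ mI _ i2) in hE.
have cT : clamped T e T = slice e T by rewrite /clamped clamp_id// lexx ltW.
have c0 : clamped T e 0 = slice e 0 by rewrite /clamped clamp_id// lexx ltW.
rewrite /energy cT c0 in hE.
have hVI : ip st Q f D <= \int[lam]_(t in I) dt Om T u t (slice D t) + ipv st Q (grad u) G.
  by rewrite ipE ipvE; exact: VI.
have tvl : in_L2v st Q (tau \- grad v) by exact: (in_L2vB mQ tl gvl).
have hP := pairing_residual_le.
have hB : ipv st Q G G = ipv st Q (grad v) G - ipv st Q (grad u) G.
  by rewrite {1}(gradxB_ipv gl) (ipvC st Q G (grad v)) (ipvC st Q G (grad u)).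
have hCS := ipv_le mQ tvl gl; rewrite {1}(ipvBl mQ tl gvl gl) in hCS.
have /ler_normlP[hCS' _] := hCS.
exact: (pre_young_arith hB hCS' hP hVI hE).
Qed.

End majorant.

(** * Complementarity of the residual *)

Section cutoffs.
Context (R : realType) (n : nat).
Local Notation E := 'rV[R]_n.
Variables (Om : set E) (T : R).
Hypotheses (oOm : open Om) (bOm : bounded_set Om) (T0 : 0 < T).
Local Notation mu := (leb R n).
Local Notation lam := (@lebesgue_measure R).
Local Notation st := (leb_st R n).
Local Notation I := (`]0, T[%classic : set (measurableTypeR R)).
Local Notation Q := (QT Om T).
Local Notation L2 := (in_L2 mu Om).
Local Notation H10curve := (H10curve Om T).
Local Notation Hm1curve := (Hm1curve Om T).
Implicit Types (w z : spacetime R n -> R) (G : spacetime R n -> E) (psi : E -> R).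
Implicit Types (xi : R -> (E -> R) -> R) (eta : R -> R).

Let mI : measurable I. Proof. exact: measurable_itv. Qed.
Let mOm : measurable Om. Proof. exact: open_rV_measurable. Qed.
Let mQ : measurable Q. Proof. exact: measurable_QT. Qed.

Lemma in_L2_const psi : L2 psi -> in_L2 st Q (fun p => psi p.1).
Proof.
move=> pl; have mp := measurable_const_in_time oOm (T := T) (in_L2_measurable pl).
split => //; rewrite L2norm_lty integral_mkcond.
have mF : measurable_fun setT ((fun p : spacetime R n => ((psi p.1) ^+ 2)%:E) \_ Q).
  apply/(measurable_restrictT _ mQ)/measurable_EFinP.
  exact: measurable_funX.
have -> := @fubini_tonelli2 _ _ _ _ _ mu lam _ mF.
  have [_] := pl; rewrite L2norm_lty => K.
  rewrite (eq_integral (fun y => ((\int[mu]_(x in Om) ((psi x) ^+ 2)%:E) * (\1_I y)%:E)%E)).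
    rewrite ge0_integralZl//.
    - rewrite integral_indic// setIT lte_mul_pinfty//.
      + by apply: integral_ge0 => x _; rewrite lee_fin sqr_ge0.
      + by rewrite ge0_fin_numE// integral_ge0// => x _; rewrite lee_fin sqr_ge0.
      + exact: I_fin.
    - by apply/measurable_EFinP; exact: measurable_indic.
    - by apply: integral_ge0 => x _; rewrite lee_fin sqr_ge0.
  move=> y _; rewrite /fubini_G indicE; case: (boolP (y \in I)) => yI.
    rewrite mule1 [RHS]integral_mkcond; apply: eq_integral => x _; rewrite !patchE.
    by rewrite in_setX /= yI andbT.
  rewrite mule0 -(integral0 mu setT); apply: eq_integral => x _; rewrite patchE.
  by rewrite in_setX /= (negbTE yI) andbF.
by move=> p; rewrite patchE; case: ifP => // _; rewrite lee_fin sqr_ge0.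
Qed.

Lemma in_L2_eta eta w : continuous eta -> in_L2 st Q w -> in_L2 st Q (fun p => eta p.2 * w p).
Proof.
move=> ce wl; have [C HC] := continuous_bounded_I T ce.
apply: (in_L2_le mQ _ _ (in_L2Z mQ C wl)).
  apply: measurable_funM; last exact: in_L2_measurable wl.
  apply: measurable_funTS; apply: measurableT_comp => //; exact: continuous_measurable_fun.
move=> p [_ Ip]; rewrite !normrM ler_wpM2r//.
by apply: le_trans (HC _ Ip) _; exact: ler_norm.
Qed.

Lemma is_gradx_const psi : H1 Om psi ->
  is_gradx Om T (fun p => psi p.1) (fun p => wgrad Om psi p.1).
Proof.
move=> hp; split; last by apply: aeW => t _; exact: wgradP.
by move=> i; exact: (in_L2_const (H1_wgrad_L2v hp i)).
Qed.

Lemma is_gradx_eta eta w G : continuous eta -> in_L2 st Q w -> is_gradx Om T w G ->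
  is_gradx Om T (fun p => eta p.2 * w p) (fun p => eta p.2 *: G p).
Proof.
move=> ce wl [gl wG]; split.
  move=> i; apply: (eq_in_L2 mQ _ (in_L2_eta ce (gl i))) => p _; by rewrite mxE.
apply: filterS2 (in_L2_slice oOm wl) wG => t wt Gt It.
have := weak_gradient_comb oOm bOm (eta t) (wt It) (in_L2_0 mu mOm) (Gt It) (smooth_weak_gradient oOm bOm (smooth_cst n (0 : R))).
have -> : (fun x => eta t * slice w t x + 0) = slice (fun p => eta p.2 * w p) t.
  by apply/funext => x; rewrite addr0.
congr weak_gradient; apply/funext => x; apply/rowP => i.
by rewrite !mxE derive_cst addr0.
Qed.

Lemma L2H10_const psi : H10 Om psi -> L2H10 Om T (fun p => psi p.1).
Proof.
move=> hp; have h1 := H10_H1 hp; apply: (curve_L2H10 oOm bOm (in_L2_const (H1_L2 h1)) (is_gradx_const h1)).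
exact: (H10curve_cst T oOm bOm hp).
Qed.

Lemma L2H10_eta eta w : continuous eta -> L2H10 Om T w -> L2H10 Om T (fun p => eta p.2 * w p).
Proof.
move=> ce hw; have wl := L2H10_L2 hw.
apply: (curve_L2H10 oOm bOm (in_L2_eta ce wl) (is_gradx_eta ce wl (L2H10_gradx hw))).
have [C HC] := continuous_bounded_I T ce.
apply: (H10curve_mul oOm bOm _ HC (L2H10_curve oOm bOm hw)).
by apply: measurable_funTS; exact: continuous_measurable_fun.
Qed.

(** Makes eta' z a legitimate part of the time derivative of eta z: the L2 product with an H10
    function has dual norm at most the H1 norm of that function. *)
Lemma Hm1curve_ip (z : R -> E -> R) : H10curve z -> Hm1curve (fun t => ip mu Om (z t)).
Proof.
move=> [pz [s [ps cs]] iz].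
have le0 a b l : H10 Om a -> H10 Om b -> (forall c, H10 Om c -> l c = ip mu Om (a \- b) c) ->
    dn Om l <= hn Om (a \- b).
  move=> ha hb lE; apply: (dn_le oOm bOm); first exact: hn_ge0.
  have hab := H10_H1 (H10B oOm bOm ha hb).
  move=> c hc; rewrite lE//; apply: le_trans (ip_le_hn oOm (H1_L2 hab) (H10_H1 hc)) _.
  rewrite ler_wpM2r ?hn_ge0// /hn ler_sqrt ?hip_ge0//.
  by rewrite hipE lerDl ipv_ge0.
have ipB a b c : H10 Om a -> H10 Om b -> H10 Om c ->
    (ip mu Om a \- ip mu Om b) c = ip mu Om (a \- b) c.
  by move=> /H10_H1/H1_L2 al /H10_H1/H1_L2 bl /H10_H1/H1_L2 cl; rewrite /= -ipBl.
have ph : {ae lam, forall t, I t -> Hm1 Om (ip mu Om (z t))}.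
  by apply: filterS pz => t pz It; apply: ip_Hm1 => //; exact: (H1_L2 (H10_H1 (pz It))).
have hs : exists s, simple_approx T (Hm1 Om) (dn Om) (fun t => ip mu Om (z t)) s.
  exists (fun k t => ip mu Om (s k t)); split.
    move=> k; split; last exact: (simple_on_comp (ip mu Om) (ps k).2).
    by move=> t It; apply: ip_Hm1 => //; exact: (H1_L2 (H10_H1 ((ps k).1 t It))).
  apply: filterS2 pz cs => t pz cs It; apply: (squeeze_norm0 _ (cs It)) => k.
  have p1 := (ps k).1 t It; have p2 := pz It.
  rewrite ger0_norm ?(dn_ge0 oOm bOm)//; apply: le0 => // c hc; exact: ipB.
split => //; apply: (@aeint_sqr R T (fun t => dn Om (ip mu Om (z t))) (fun t => hn Om (z t) ^+ 2)) => //.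
- apply: (@aemeas_curve R T _ (Hm1 Om) (dn Om)) => //; try by [exact: Hm1_zero|exact: dn_ge0|exact: dn_comb|exact: dn0].
  by move=> b l1 l2; exact: Hm1_comb_Hm1.
- apply: filterS pz => t pz It; rewrite ler_pXn2r ?nnegrE ?hn_ge0 ?dn_ge0//.
  have := le0 (z t) (fun=> 0) (ip mu Om (z t)) (pz It) (H10_0 oOm bOm).
  have -> : z t \- (fun=> 0) = z t by apply/funext => x /=; rewrite subr0.
  exact.
Qed.

Lemma time_test_bounds0 eta : time_test_fun T eta -> eta 0 = 0 /\ eta T = 0.
Proof.
move=> [_ [_ sub]]; have z r : ~ (`]0, T[%classic : set R) r -> eta r = 0.
  move=> nr; apply/eqP; apply: contrapT => /negP er; apply: nr; apply: sub.
  exact: subset_closure.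
by split; apply: z; rewrite /= in_itv /= ltxx ?andbF.
Qed.

(** The pairing with a fixed function is constant in time, and the derivative of a time test
    integrates to zero because the test vanishes at 0 and T. *)
Lemma is_dt_const psi : H10 Om psi -> is_dt Om T (fun p => psi p.1) (fun _ _ => 0).
Proof.
move=> hp; apply/(is_dtP T oOm bOm); split.
  by apply: Hm1curve_cst => //; exact: Hm1_zero.
move=> chi eta hc te.
have [ce ce'] := time_test_continuous te.
have -> : \int[lam]_(t in I) (0 * eta t) = 0.
  by under eq_Rintegral do rewrite mul0r; rewrite Rint0.
rewrite (_ : Rintegral lam I _ = \int[lam]_(t in I) (ip mu Om psi chi * derive1 eta t))//.
have di : aeint lam I (derive1 eta).
  apply: aeint_ae (aeint_mulC (aeint_cst_I T 1) ce'); by apply: aeW => t _; rewrite mul1r.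
rewrite (RintZ mI _ di).
have -> : \int[lam]_(t in I) derive1 eta t = 0; last by rewrite mulr0 oppr0.
have ii : lam.-integrable `[0, T] (EFin \o derive1 eta).
  by apply: continuous_integrable_itv; exact: continuous_subspaceT.
have de x : derivable eta x 1 by case: te => /(_ 0%N x).
have [e0 eT] := time_test_bounds0 te.
have := Rint_FTC2 (ltW T0) de ce'; rewrite e0 eT subrr => E0; rewrite -[RHS]E0.
rewrite -Rintegral_itv_obnd_cbnd; last first.
  by apply: integrableS ii => // x /=; rewrite !in_itv /= => /andP[/ltW -> ->].
rewrite -Rintegral_itv_bndo_bndc//.
by apply: integrableS ii => // x /=; rewrite !in_itv /= => /andP[/ltW -> /ltW ->].
Qed.

(** The product rule: [eta] is moved onto the time test, the product of two such tests being again
    one. *)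
Lemma is_dt_eta eta z xi : time_test_fun T eta -> L2H10 Om T z -> is_dt Om T z xi ->
  is_dt Om T (fun p => eta p.2 * z p)
    (fun t psi => eta t * xi t psi + derive1 eta t * ip mu Om (slice z t) psi).
Proof.
move=> te hz /(is_dtP T oOm bOm)[hx H]; apply/(is_dtP T oOm bOm).
have [ce ce'] := time_test_continuous te.
have [C HC] := continuous_bounded_I T ce; have [C' HC'] := continuous_bounded_I T ce'.
have mc (g : R -> R) : continuous g -> measurable_fun I g.
  by move=> cg; apply: measurable_funTS; exact: continuous_measurable_fun.
have hxe := Hm1curve_mul oOm bOm (mc _ ce) HC hx.
have hze := Hm1curve_mul oOm bOm (mc _ ce') HC' (Hm1curve_ip (L2H10_curve oOm bOm hz)).
split.
  have := Hm1curve_comb oOm bOm 1 hxe hze; congr (Hm1curve _).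
  by apply/funext => t; apply/funext => psi; rewrite mul1r.
move=> psi zeta hp tz; have [cz cz'] := time_test_continuous tz.
have pl := H1_L2 (H10_H1 hp).
have sz := derive1n_smooth1 tz.1; have se := derive1n_smooth1 te.1.
have := H psi _ hp (time_testM te sz).
have i1 : aeint lam I (fun t => xi t psi * (eta t * zeta t)) := aeint_mulC (Hm1curve_pair_aeint oOm bOm hx hp) (fun x => continuousM (ce x) (cz x)).
have i0 := ip_slice_cst oOm bOm hz pl.
have i2 : aeint lam I (fun t => ip mu Om (slice z t) psi * (derive1 eta t * zeta t)) := aeint_mulC i0 (fun x => continuousM (ce' x) (cz x)).
have i3 : aeint lam I (fun t => ip mu Om (slice z t) psi * (eta t * derive1 zeta t)) := aeint_mulC i0 (fun x => continuousM (ce x) (cz' x)).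
have dE r : derive1 (fun s => eta s * zeta s) r = derive1 eta r * zeta r + eta r * derive1 zeta r.
  have de : derivable eta r 1 by case: te => /(_ 0%N r).
  have dz : derivable zeta r 1 by case: tz => /(_ 0%N r).
  by rewrite !derive1E deriveM//= addrC; congr (_ + _); rewrite /GRing.scale /= mulrC.
under [X in _ = - X]eq_Rintegral do rewrite dE mulrDr.
rewrite (RintD mI i2 i3).
have -> : \int[lam]_(t in I) ((eta t * xi t psi + derive1 eta t * ip mu Om (slice z t) psi) * zeta t) =
    \int[lam]_(t in I) (xi t psi * (eta t * zeta t)) +
    \int[lam]_(t in I) (ip mu Om (slice z t) psi * (derive1 eta t * zeta t)).
  rewrite -(RintD mI i1 i2); apply: eq_Rintegral => t _.
  by move: (xi t psi) (ip _ _ _ _) => a b; ring.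
move=> ->; rewrite opprD addrAC addNr add0r; congr (- _).
apply: ae_eq_Rintegral.
apply: filterS (in_L2_slice oOm (L2H10_L2 hz)) => t zl It.
have -> : slice (fun p => eta p.2 * z p) t = (fun x => eta t * slice z t x) by [].
by rewrite ipZl//; [rewrite mulrCA mulrA|exact: zl].
Qed.

End cutoffs.

(** For the extension [q] of [b], the primitive is nondecreasing on the times below T, so its
    backward difference quotients are nonnegative there. By [steklov] their integrals over {q < 0}
    tend to that of [q], which is thus nonnegative, and this set is null. *)
Lemma nonneg_of_time_tests (R : realType) (T : R) (b : R -> R) : 0 < T ->
  aeint (@lebesgue_measure R) (`]0, T[%classic : set (measurableTypeR R)) b ->
  (forall s t k, 0 < s -> t < T ->
     0 <= \int[@lebesgue_measure R]_(r in `]0, T[) (tapprox s t k r * b r)) ->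
  {ae @lebesgue_measure R, forall t, (`]0, T[%classic : set (measurableTypeR R)) t -> 0 <= b t}.
Proof.
move=> T0 bi H; set lam := @lebesgue_measure R; set I := (`]0, T[%classic : set (measurableTypeR R)).
have mI : measurable I by exact: measurable_itv.
have FF : Filter (nbhs (almost_everywhere lam)) by exact: (ae_filter_ringOfSetsType lam).
have [q [qi q0 bq]] := aeint_extend bi.
have qI := integrable_setT_aeint T qi.
have mono0 s t : 0 < s -> s <= t -> t < T -> prim q s <= prim q t.
  move=> s0 st tT; rewrite -subr_ge0 (primBI qi q0)//; last by move: s0; lra.
  have [_ L] : aeint lam I (fun r => q r * ((s < r < t)%R : bool)%:R) /\
     (fun k => \int[lam]_(r in I) (q r * tapprox s t k r)) @ \oo -->
     \int[lam]_(r in I) (q r * ((s < r < t)%R : bool)%:R).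
    apply: (@dominated_cvg_Rint _ _ _ lam I mI _ _ (fun r => `|q r|)).
    - move=> k; apply: aemeasM => //; first exact: aeint_aemeas.
      apply: continuous_aemeas; exact: (smooth_tapprox s t k 0%N).
    - exact: aeint_abs.
    - move=> k; apply: aeW => r _; rewrite normrM ler_piMr//.
      by have /andP[? ?] := tapprox_itv s t k r; rewrite ger0_norm.
    - apply: aeW => r _; apply: cvgMr; exact: cvg_tapprox.
  apply: (ler_cvg_to (cvg_cst 0) L); apply: nearW => k.
  have -> : \int[lam]_(r in I) (q r * tapprox s t k r) = \int[lam]_(r in I) (tapprox s t k r * b r).
    by apply: ae_eq_Rintegral; apply: filterS bq => r K Ir; rewrite K// mulrC.
  exact: H.
have mono s t : s <= t -> 0 < t -> t < T -> prim q s <= prim q t.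
  move=> st t0 tT; have [s0|s0] := ltP 0 s; first exact: mono0.
  rewrite (prim_le0 q0 s0) -(prim_le0 q0 (lexx 0)).
  have c1 : prim q x @[x --> 0^'+] --> prim q 0.
    by apply: cvg_at_right_filter; apply: continuous_prim => //; lra.
  apply: (ler_cvg_to c1 (cvg_cst (prim q t))).
  apply: filterS2 (nbhs_right_gt (0 : R)) (nbhs_right_le t0) => x x0 xt; exact: mono0.
have mq : measurable_fun setT q by apply/measurable_EFinP; exact: measurable_int qi.
pose A : set (measurableTypeR R) := [set t | q t < 0].
have mA : measurable A.
  have mb : measurable_fun [set: measurableTypeR R] (fun t => q t < 0).
    by apply: measurable_fun_ltr => //; exact: measurable_cst.
  by have := mb measurableT [set true]; rewrite setTI; apply.
have LA := steklov T0 mA qi q0.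
have IA : 0 <= \int[lam]_(t in I) (\1_A t * q t).
  apply: (ler_cvg_to (cvg_cst 0) LA); apply: nearW => k; apply: Rint_ge0; apply: aeW => t.
  rewrite /= in_itv /= => /andP[t0 tT]; rewrite mulr_ge0// mulr_ge0// subr_ge0 mono//.
  by rewrite lerBlDr lerDl invr_ge0.
have AI : aeint lam I (fun t => \1_A t * q t) by exact: aeint_indicM.
have nA : {ae lam, forall t, I t -> 0 <= - (\1_A t * q t)}.
  apply: aeW => t _; rewrite indicE; case: (boolP (t \in A)) => [/set_mem /= h|_].
    by rewrite mul1r oppr_ge0 ltW.
  by rewrite mul0r oppr0.
have NI := aeintN mI AI.
have N0 : \int[lam]_(t in I) (- (\1_A t * q t)) = 0.
  apply/eqP; rewrite eq_le Rint_ge0// andbT (RintN mI AI) oppr_le0; exact: IA.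
apply: filterS2 bq (Rint_eq0 mI NI nA N0) => t K1 K2 It; rewrite K1//.
rewrite leNgt; apply/negP => h; have := K2 It; rewrite indicE mem_set// mul1r => /eqP.
by rewrite oppr_eq0 => /eqP q00; move: h; rewrite q00 ltxx.
Unshelve. all: by end_near. Qed.

Lemma finite_set_inj (V : Type) (A : set V) : finite_set A ->
  exists f : V -> nat, forall a b, A a -> A b -> f a = f b -> a = b.
Proof.
move=> /finite_setP[m /card_set_bijP[f [_ fi _]]]; exists f => a b Aa Ab.
by apply: fi; rewrite inE.
Qed.

(** * The inequality localized in time, and a countable dense family of competitors *)

Section complementarity.
Context (R : realType) (n : nat).
Local Notation E := 'rV[R]_n.
Variables (Om : set E) (T : R) (phi : E -> R) (f : spacetime R n -> R).
Hypotheses (oOm : open Om) (bOm : bounded_set Om) (T0 : 0 < T).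
Local Notation mu := (leb R n).
Local Notation lam := (@lebesgue_measure R).
Local Notation st := (leb_st R n).
Local Notation I := (`]0, T[%classic : set (measurableTypeR R)).
Local Notation Q := (QT Om T).
Local Notation L2 := (in_L2 mu Om).
Local Notation grad := (gradx Om T).
Local Notation hn := (hn Om).
Hypotheses (fl : in_L2 st Q f).
Variables (u : spacetime R n -> R) (u0 : E -> R).
Hypotheses (hu : admissible Om T phi u).

#[local] Instance ae_filter_complementarity : Filter (nbhs (almost_everywhere lam)) := ae_filter_ringOfSetsType lam.

Let mI : measurable I. Proof. exact: measurable_itv. Qed.
Let mOm : measurable Om. Proof. exact: open_rV_measurable. Qed.
Let mQ : measurable Q. Proof. exact: measurable_QT. Qed.

(** Read as functions constant in time, these are admissible functions whose time derivative is
    zero. *)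
Definition competitor (c : E -> R) := H10 Om c /\ {ae mu, forall x, Om x -> phi x <= c x}.

Lemma slice_competitor : {ae lam, forall t, I t -> competitor (slice u t)}.
Proof.
have [hu1 _ pu] := hu; apply: filterS2 (L2H10_H10 hu1) (ae_sliceX pu) => t h1 h2 It.
by split; [exact: h1|exact: (h2 It)].
Qed.

(* The simple approximants of [u] need not lie above [phi]: each of their
   countably many values is replaced by a nearby competitor, if there is one. *)
Lemma competitors_dense : competitor u0 ->
  exists c : nat * nat * nat -> E -> R, (forall i, competitor (c i)) /\
    {ae lam, forall t, I t -> forall eps, 0 < eps -> exists i, hn (c i \- slice u t) < eps}.
Proof.
move=> hu0; have [hu1 _ _] := hu.
have [_ [s [ps cs]] _] := L2H10_curve oOm bOm hu1.
have /choice[g Hg] : forall k, exists g : (E -> R) -> nat,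
    forall a b, (s k @` I) a -> (s k @` I) b -> g a = g b -> a = b.
  by move=> k; apply: finite_set_inj; case: (ps k).2.
(* [i] holds the index of an approximant, the number of one of its values and a precision; [c] is
   close when it is within that precision of that value. *)
pose close (i : nat * nat * nat) c := forall a, (s i.1.1 @` I) a -> g i.1.1 a = i.1.2 ->
   hn (c \- a) < i.2.+1%:R^-1.
have /choice[c Hc] : forall i, exists c, competitor c /\
    ((exists2 c', competitor c' & close i c') -> close i c).
  move=> i; have [[c' h1 h2]|nc] := pselect (exists2 c', competitor c' & close i c').
    by exists c'.
  (* No competitor is near this value: [u0] is a harmless default. *)
  by exists u0.
exists c; split; first by move=> i; have [] := Hc i.
apply: filterS2 slice_competitor cs => t hut cs It eps e0.
have ht := hut It; have h1 := H10_H1 ht.1.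
have [j Hj] : exists j : nat, j.+1%:R^-1 < eps / 2.
  have e2 : 0 < eps / 2 by rewrite divr_gt0.
  by have := near_infty_natSinv_lt (PosNum e2) => -[j _ /(_ j (leqnn j))]; exists j.
have /cvgrPdist_lt/(_ j.+1%:R^-1) := cs It.
rewrite invr_gt0 ltr0n => /(_ isT)[k _ /(_ k (leqnn k))].
rewrite sub0r normrN => /(le_lt_trans (ler_norm _)) kj.
have ha : H10 Om (s k t) by exact: (ps k).1.
have ima : (s k @` I) (s k t) by exists t.
exists (k, g k (s k t), j).
have [_ Hcl] := Hc (k, g k (s k t), j).
have ex : exists2 c', competitor c' & close (k, g k (s k t), j) c'.
  exists (slice u t) => // a imA /= ga.
  rewrite (Hg k _ _ imA ima ga) (hn_distC oOm bOm)//; exact: (H10_H1 ha).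
have cj := Hcl ex (s k t) ima erefl; rewrite /= in cj.
have hcc : H10 Om (c (k, g k (s k t), j)) by have [[]] := Hc (k, g k (s k t), j).
have := hn_distD oOm bOm (H10_H1 hcc) h1 (H10_H1 ha) => /le_lt_trans; apply.
by rewrite [eps](splitr eps); apply: ltrD; apply: lt_trans Hj.
Qed.

Hypothesis VI : forall w, admissible Om T phi w ->
  \int[st]_(p in Q) (f p * (w p - u p)) <=
  \int[lam]_(t in I) dt Om T u t (slice w t \- slice u t) +
  \int[st]_(p in Q) dotv (grad u p) (grad (w \- u) p).

(* Compare [u] with [u + eta (c - u)], where the cutoff in time [eta] runs over
   [0, 1]-valued test functions. *)
Lemma local_VI c : competitor c -> {ae lam, forall t, I t ->
  0 <= dt Om T u t (c \- slice u t) - ip mu Om (slice f t) (c \- slice u t) +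
       ipv mu Om (slice (grad u) t) (wgrad Om (c \- slice u t))}.
Proof.
move=> [hc phic]; have [hu1 hdu pu] := hu.
pose z := (fun p : spacetime R n => c p.1) \- u.
have hcl := L2H10_const T oOm bOm hc.
have hz : L2H10 Om T z by exact: L2H10B.
have hdz : exists xi, is_dt Om T z xi.
  eexists; have := is_dt_comb oOm bOm (-1) hu1 hcl (dtP hdu) (is_dt_const oOm bOm T0 hc).
  have -> : (fun p => -1 * u p + c p.1) = z by apply/funext => p; rewrite mulN1r addrC.
  exact.
have [gzl wGz] := L2H10_gradx hz; have [gul _] := L2H10_gradx hu1; have zl := L2H10_L2 hz.
have [hxi _] := (is_dtP T oOm bOm u _).1 (dtP hdu); have [pxi _ _] := hxi.
have i1 := pairing_aeint oOm bOm hxi (L2H10_curve oOm bOm hz).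
have [i2 _] := ip_slice oOm fl zl; have [i3 _] := ipv_slice oOm gul gzl.
pose b t := dt Om T u t (slice z t) - ip mu Om (slice f t) (slice z t) +
  ipv mu Om (slice (grad u) t) (slice (grad z) t).
have bi : aeint lam I b by exact: (aeintD mI (aeintB mI i1 i2) i3).
have phicQ : {ae st, forall p, Q p -> phi p.1 <= c p.1}.
  move: phic => [N [mN N0 sN]]; exists (N `*` setT); split.
  - exact: measurableX.
  - apply: etrans (product_measure1E mu lam mN measurableT) _; apply/eqP.
    by rewrite mule_eq0; apply/orP; left; apply/eqP; exact: N0.
  - move=> [x t] /= /not_implyP[[Ox _] nc]; split => //; apply: sN => /= K.
    exact: nc (K Ox).
(* [b] is written with slices of [gradx], for which integrability in time is known; on almost every
   slice they agree with the [wgrad] of the statement. *)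
suff : {ae lam, forall t, I t -> 0 <= b t}.
  move=> b0; apply: filterS2 b0 wGz => t b0 wG It.
  have := b0 It; rewrite /b; congr (_ <= _ + _).
  apply: ipv_ae; first exact: aeW.
  by apply: filterS (wgrad_ae oOm bOm (wG It)) => x K Ox; rewrite -K.
apply: nonneg_of_time_tests => // s t k s0 tT.
set eta := tapprox s t k.
have te : time_test_fun T eta by exact: time_test_tapprox.
have [ce ce'] := time_test_continuous te.
pose ez := fun p : spacetime R n => eta p.2 * z p.
have hez : L2H10 Om T ez by exact: L2H10_eta.
pose w := fun p => 1 * ez p + u p.
have wu : w \- u = ez by apply/funext => p; rewrite /w /=; ring.
have hw : admissible Om T phi w.
  split; first exact: L2H10_comb.
    have [zeta hzeta] := hdz.
    exact: (ex_intro _ _ (is_dt_comb oOm bOm 1 hez hu1 (is_dt_eta oOm bOm te hz hzeta) (dtP hdu))).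
  apply: filterS2 pu phicQ => p h1 h2 Qp; rewrite /w /ez /z /= mul1r.
  have /andP[e0 e1] := tapprox_itv s t k p.2; rewrite -/eta in e0 e1.
  (* Convexity: w - phi = eta (c - phi) + (1 - eta) (u - phi), both terms being nonnegative. *)
  have := h1 Qp; have := h2 Qp; rewrite -subr_ge0 => g1; rewrite -subr_ge0 => g2.
  have := addr_ge0 (mulr_ge0 e0 g1) (mulr_ge0 (_ : 0 <= 1 - eta p.2) g2).
  rewrite subr_ge0 => /(_ e1); rewrite -[in X in _ -> X]subr_ge0; congr (_ <= _).
  by ring.
have := VI hw.
have -> : \int[st]_(p in Q) (f p * (w p - u p)) = \int[lam]_(r in I) (eta r * ip mu Om (slice f r) (slice z r)).
  have -> : \int[st]_(p in Q) (f p * (w p - u p)) = ip st Q f (w \- u) by rewrite ipE.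
  rewrite wu (ip_slice oOm fl (L2H10_L2 hez)).2; apply: ae_eq_Rintegral.
  apply: filterS2 (in_L2_slice oOm fl) (in_L2_slice oOm zl) => r fr zr Ir.
  by rewrite -(ipZr mOm (eta r) (zr Ir) (fr Ir)).
have -> : \int[lam]_(r in I) dt Om T u r (slice w r \- slice u r) = \int[lam]_(r in I) (eta r * dt Om T u r (slice z r)).
  apply: ae_eq_Rintegral; apply: filterS2 pxi (L2H10_H10 hz) => r xr zr Ir.
  rewrite -(Hm1Z oOm bOm (xr Ir) (eta r) (zr Ir)); congr (dt _ _ _ _ _).
  by apply/funext => x; rewrite -[LHS]/((w \- u) (x, r)) wu.
have -> : \int[st]_(p in Q) dotv (grad u p) (grad (w \- u) p) =
    \int[lam]_(r in I) (eta r * ipv mu Om (slice (grad u) r) (slice (grad z) r)).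
  rewrite wu; have := is_gradx_eta oOm bOm ce zl (L2H10_gradx hz); rewrite -/ez => hge.
  have U := is_gradx_unique oOm bOm (L2H10_gradx hez) hge.
  rewrite -ipvE (ipv_ae (aeW _ (fun p _ => erefl)) U) (ipv_slice oOm gul hge.1).2.
  apply: ae_eq_Rintegral; apply: filterS2 (in_L2v_slice oOm gul) (in_L2v_slice oOm gzl) => r ur zr Ir.
  by rewrite -(ipvZr mOm (eta r) (zr Ir) (ur Ir)).
move=> K; have {K} := K.
have me r : eta r * b r = eta r * dt Om T u r (slice z r) - eta r * ip mu Om (slice f r) (slice z r) +
   eta r * ipv mu Om (slice (grad u) r) (slice (grad z) r) by rewrite /b mulrDr mulrBr.
under [X in _ -> 0 <= X]eq_Rintegral do rewrite me.
have ai g : aeint lam I g -> aeint lam I (fun r => eta r * g r).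
  by move=> gi; apply: aeint_ae (aeint_mulC gi ce); apply: aeW => r _; rewrite mulrC.
rewrite (RintD mI (aeintB mI (ai _ i1) (ai _ i2)) (ai _ i3)) (RintB mI (ai _ i1) (ai _ i2)).
move: (Rintegral _ _ _) (Rintegral _ _ _) (Rintegral _ _ _) => a1 a2 a3.
by rewrite -subr_ge0; congr (_ <= _); ring.
Qed.

End complementarity.

(** * Sign of the residual at a fixed time *)

Section residual_sign.
Context (R : realType) (n : nat).
Local Notation E := 'rV[R]_n.
Variables (Om : set E) (phi : E -> R).
Hypotheses (oOm : open Om) (bOm : bounded_set Om).
Local Notation mu := (leb R n).
Local Notation L2 := (in_L2 mu Om).
Local Notation hn := (hn Om).
Local Notation ip := (ip mu Om).
Hypotheses (hphi : H1 Om phi).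
Variable p : nat -> E -> R.
Hypotheses (sp : forall k, smooth (p k)) (cp : (fun k => H1norm Om (p k \- phi)) @ \oo --> 0%E).

Let mOm : measurable Om. Proof. exact: open_rV_measurable. Qed.

Lemma competitor_add c m : competitor Om phi c -> competitor Om phi (fun x => c x + test_of Om m x).
Proof.
move=> [hc phic]; split; first exact: (H10D oOm bOm hc (test_H10 oOm bOm (test_of_test Om m))).
apply: filterS phic => x h Ox; apply: le_trans (h Ox) _.
by rewrite lerDl; have /andP[] := test_of_itv Om m x.
Qed.

(** The function is (1 - psi) c + psi phi with psi in [0, 1], hence above phi. It lies in H10
    because psi phi does, by [H10_mul_lim]. *)
Lemma competitor_mix c m : competitor Om phi c ->
  competitor Om phi (fun x => c x + test_of Om m x * (phi x - c x)).
Proof.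
move=> [hc phic]; have tm := test_of_test Om m; split.
  have h1 := H10_mul_lim oOm bOm tm hphi sp cp; have h2 := H10_mul oOm bOm tm hc.
  have := H10D oOm bOm hc (H10B oOm bOm h1 h2); congr H10.
  by apply/funext => x /=; rewrite mulrBr.
apply: filterS phic => x h Ox; have := h Ox; rewrite -subr_ge0 => c0.
have /andP[_ t1] := test_of_itv Om m x; rewrite -subr_ge0 in t1.
by have := mulr_ge0 t1 c0; rewrite -[in X in _ -> X]subr_ge0; congr (_ <= _); ring.
Qed.

Variables (r w : E -> R) (J : Type) (c : J -> E -> R).
Hypotheses (rl : L2 r) (hw : competitor Om phi w) (hc : forall j, competitor Om phi (c j)).
Hypothesis dense : forall eps, 0 < eps -> exists j, hn (c j \- w) < eps.
Hypothesis H1 : forall j m, ip r ((fun x => c j x + test_of Om m x) \- w) <= 0.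
Hypothesis H2 : forall j m, ip r ((fun x => c j x + test_of Om m x * (phi x - c j x)) \- w) <= 0.

Let wl : L2 w. Proof. exact: H1_L2 (H10_H1 hw.1). Qed.
Let cl j : L2 (c j). Proof. exact: H1_L2 (H10_H1 (hc j).1). Qed.
Let phil : L2 phi. Proof. exact: H1_L2. Qed.
Let tl m : L2 (test_of Om m). Proof. by apply: smooth_in_L2 => //; case: (test_of_test Om m). Qed.
Let tcont m : continuous (test_of Om m).
Proof. by case: (test_of_test Om m) => /smooth_continuous. Qed.

Let close eps : 0 < eps -> exists j, Num.sqrt (ip (w \- c j) (w \- c j)) <= eps.
Proof.
move=> /dense[j /ltW h]; exists j; apply: le_trans h.
rewrite /hn ler_sqrt ?hip_ge0// hipE.
have -> : ip (w \- c j) (w \- c j) = ip (c j \- w) (c j \- w).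
  by rewrite !ipE; apply: eq_Rintegral => x _ /=; ring.
by rewrite lerDl ipv_ge0.
Qed.

Let small x : (forall eps, 0 < eps -> x <= Num.sqrt (ip r r) * eps) -> x <= 0.
Proof.
move=> h; apply/ler_addgt0Pr => e e0; rewrite add0r.
have a0 : 0 < Num.sqrt (ip r r) + 1 by rewrite ltr_wpDl ?sqrtr_ge0.
have := h _ (divr_gt0 e0 a0); move=> /le_trans; apply.
by rewrite mulrA ler_pdivrMr// mulrC; apply: ler_wpM2l; [exact: ltW|rewrite lerDl].
Qed.

(** c_j + psi - w differs from psi by c_j - w, which is arbitrarily small in L2, so (r, psi) <= 0
    for every coded test psi. *)
Lemma residual_le0 : {ae mu, forall x, Om x -> r x <= 0}.
Proof.
apply: (ae_le0_of_tests oOm); first exact: in_L2_integrable.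
move=> m; rewrite -ipE; apply: small => eps /close[j Hj].
have dl := in_L2B mOm wl (cl j).
have -> : ip r (test_of Om m) = ip r ((fun x => c j x + test_of Om m x) \- w) + ip r (w \- c j).
  rewrite -ipDr//; last exact: (in_L2B mOm (in_L2D mOm (cl j) (tl m)) wl).
  by congr (ip _ _); apply/funext => x /=; ring.
apply: le_trans (lerD (H1 j m) (lexx _)) _; rewrite add0r.
apply: le_trans (ler_norm _) _; apply: le_trans (ip_le mOm rl dl) _.
by rewrite ler_wpM2l ?sqrtr_ge0.
Qed.

(** c + psi (phi - c) - w is psi (phi - w) minus (1 - psi) (w - c), and the latter is no larger than
    w - c in L2. *)
Lemma residual_obstacle_le0 : {ae mu, forall x, Om x -> r x * (phi x - w x) <= 0}.
Proof.
have pwl := in_L2B mOm phil wl.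
apply: (ae_le0_of_tests oOm); first exact: in_L2_integrableM.
move=> m; have -> : \int[mu]_(x in Om) (r x * (phi x - w x) * test_of Om m x) =
    ip r (fun x => test_of Om m x * (phi x - w x)).
  by rewrite ipE; apply: eq_Rintegral => x _; rewrite -mulrA [_ * test_of _ _ _]mulrC.
apply: small => eps /close[j Hj].
have dl := in_L2B mOm wl (cl j).
have t1 := in_L2_boundedM oOm bOm (@tcont m) pwl.
have t2 := in_L2_boundedM oOm bOm (@tcont m) (in_L2B mOm phil (cl j)).
have t3 := in_L2_boundedM oOm bOm (@tcont m) dl.
have ol : L2 (fun x => (w x - c j x) - test_of Om m x * (w x - c j x)) by exact: in_L2B.
have -> : ip r (fun x => test_of Om m x * (phi x - w x)) =
    ip r ((fun x => c j x + test_of Om m x * (phi x - c j x)) \- w) +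
    ip r (fun x => (w x - c j x) - test_of Om m x * (w x - c j x)).
  rewrite -ipDr//; last exact: (in_L2B mOm (in_L2D mOm (cl j) t2) wl).
  by congr (ip _ _); apply/funext => x /=; ring.
apply: le_trans (lerD (H2 j m) (lexx _)) _; rewrite add0r.
apply: le_trans (ler_norm _) _; apply: le_trans (ip_le mOm rl ol) _.
rewrite ler_wpM2l ?sqrtr_ge0//; apply: le_trans Hj; rewrite ler_sqrt ?ip_ge0// !ipE.
apply: le_Rint => //; [exact: in_L2_aeintM|exact: in_L2_aeintM|].
apply: aeW => x _; have /andP[a0 a1] := test_of_itv Om m x.
have -> : w x - c j x - test_of Om m x * (w x - c j x) = (1 - test_of Om m x) * (w x - c j x) by ring.
rewrite /= -!expr2 exprMn ler_piMl ?sqr_ge0// expr_le1// ?subr_ge0// lerBlDr lerDl//.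
Qed.

End residual_sign.

Lemma obstacle_residual_eq0 (R : realType) (n : nat) (Om : set 'rV[R]_n) (T : R)
    (phi u0 : 'rV[R]_n -> R) (f u v : spacetime R n -> R) (tau : spacetime R n -> 'rV[R]_n) :
  open Om -> bounded_set Om -> 0 < T -> H1 Om phi -> ae_nonpos_on_boundary Om phi ->
  in_L2 (leb_st R n) (QT Om T) f -> competitor Om phi u0 -> obstacle_solution Om T phi f u0 u ->
  L2H10 Om T v -> (exists g, is_dt_fun Om T v g) -> Hdiv Om T tau ->
  {ae leb_st R n, forall p, QT Om T p -> v p = u p} ->
  {ae leb_st R n, forall p, QT Om T p -> tau p = gradx Om T u p} ->
  {ae leb_st R n, forall p, QT Om T p -> obstacle_residual Om T phi f v tau p = 0}.
Proof.
move=> oOm bOm T0 hphi [_ [[_ [p [sp cp _]]] _]] fl hu0 [hu VI _] hv hdt htau vu tu.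
have mI : measurable (`]0, T[%classic : set (measurableTypeR R)) by exact: measurable_itv.
have mOm : measurable Om by exact: open_rV_measurable.
have FF : Filter (nbhs (almost_everywhere (@lebesgue_measure R))) by exact: (ae_filter_ringOfSetsType (@lebesgue_measure R)).
have phil := H1_L2 hphi.
apply: slice_aeX0 => //.
  exact: (measurable_obstacle_residual oOm phil fl hv hdt htau).
have [c [hc dc]] := competitors_dense oOm bOm hu hu0.
(* Pairs of a competitor and a test are countable, so their exceptional sets of times merge into a
   single null set. *)
have VIc1 : {ae @lebesgue_measure R, forall t, forall jm : (nat * nat * nat) * tcode n, `]0, T[%classic t ->
    0 <= dt Om T u t ((fun x => c jm.1 x + test_of Om jm.2 x) \- slice u t) -
      ip (leb R n) Om (slice f t) ((fun x => c jm.1 x + test_of Om jm.2 x) \- slice u t) +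
      ipv (leb R n) Om (slice (gradx Om T u) t) (wgrad Om ((fun x => c jm.1 x + test_of Om jm.2 x) \- slice u t))}.
  apply: ae_forall_count => jm; apply: (local_VI oOm bOm T0 fl hu VI).
  exact: competitor_add.
have VIc2 : {ae @lebesgue_measure R, forall t, forall jm : (nat * nat * nat) * tcode n, `]0, T[%classic t ->
    0 <= dt Om T u t ((fun x => c jm.1 x + test_of Om jm.2 x * (phi x - c jm.1 x)) \- slice u t) -
      ip (leb R n) Om (slice f t) ((fun x => c jm.1 x + test_of Om jm.2 x * (phi x - c jm.1 x)) \- slice u t) +
      ipv (leb R n) Om (slice (gradx Om T u) t) (wgrad Om ((fun x => c jm.1 x + test_of Om jm.2 x * (phi x - c jm.1 x)) \- slice u t))}.
  apply: ae_forall_count => jm; apply: (local_VI oOm bOm T0 fl hu VI).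
  exact: (competitor_mix oOm bOm hphi sp cp).
have A1 := ae_and VIc1 VIc2; have A2 := ae_and (residual_slice oOm bOm fl hdt htau) dc.
have A3 := ae_and (ae_sliceX vu) (ae_sliceX tu); have A4 := ae_and A3 (slice_competitor hu).
apply: filterS3 A1 A2 A4 => t [V1 V2] [rs dn] [[vut tut] ut] It.
have [rl rE] := rs It; have hut := ut It.
(* As v = u and tau = grad u, the identity of [residual_slice] turns the localized inequality into
   (r, a - u) <= 0. *)
have key a : competitor Om phi a -> 0 <= dt Om T u t (a \- slice u t) -
      ip (leb R n) Om (slice f t) (a \- slice u t) +
      ipv (leb R n) Om (slice (gradx Om T u) t) (wgrad Om (a \- slice u t)) ->
    ip (leb R n) Om (slice (residual Om T f v tau) t) (a \- slice u t) <= 0.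
  move=> ha; have hd := H10B oOm bOm ha.1 hut.1; have := rE _ hd.
  rewrite (dt_ae oOm bOm vu) => E0.
  have -> : ipv (leb R n) Om (slice (gradx Om T u) t) (wgrad Om (a \- slice u t)) =
      ipv (leb R n) Om (slice tau t) (wgrad Om (a \- slice u t)).
    apply: ipv_ae; last exact: aeW.
    by apply: filterS (tut It) => x K Ox; rewrite /slice K.
  by rewrite E0 oppr_ge0.
have r1 := residual_le0 oOm bOm (phi := phi) rl hut hc (dn It)
  (fun j m => key _ (competitor_add oOm bOm m (hc j)) (V1 (j, m) It)).
have r2 := residual_obstacle_le0 oOm bOm hphi rl hut hc (dn It)
  (fun j m => key _ (competitor_mix oOm bOm hphi sp cp m (hc j)) (V2 (j, m) It)).
apply: filterS3 (ae_and r1 r2) (vut It) hut.2 => x [r1x r2x] vux phiu Ox.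
rewrite /obstacle_residual /= (vux Ox); case: ifPn => [lt|_]; last first.
  by apply/max_idPl; exact: r1x.
have := r2x Ox; have := r1x Ox; rewrite /slice => h1 h2; apply/eqP; rewrite eq_le h1 /=.
by rewrite leNgt; apply/negP => h; move: h2; rewrite leNgt => /negP; apply; rewrite nmulr_rgt0// subr_lt0.
Qed.

(** * From the estimates to the majorant and its vanishing *)

Lemma ae_eq0_right_limit (R : realType) (T : R) (N : R -> R) : 0 < T -> continuous N ->
  {ae @lebesgue_measure R, forall t, (`]0, T[%classic : set (measurableTypeR R)) t -> N t = 0} -> N 0 = 0.
Proof.
move=> T0 cN [S [mS S0 NS]]; apply/eqP; apply: contrapT => /negP N0.
have /cvgrPdist_lt/(_ `|N 0|) := cN 0; rewrite normr_gt0 => /(_ N0) /nbhs_ballP[d /= d0 Hd].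
pose m := Num.min d T; have m0 : 0 < m by rewrite lt_min d0.
have sub : (`]0, m[%classic : set (measurableTypeR R)) `<=` S.
  move=> t /=; rewrite in_itv /= lt_min => /and3P[t0 td tT]; apply: NS => /= K.
  have Nt : N t = 0 by apply: K; rewrite in_itv /= t0.
  have := Hd t; rewrite /ball /= sub0r normrN gtr0_norm// => /(_ td).
  by rewrite Nt subr0 ltxx.
have := @le_measure _ _ _ (@lebesgue_measure R) `]0, m[%classic S.
rewrite !inE => /(_ (measurable_itv _) mS sub) K.
have : (lebesgue_measure (`]0%R, m[%classic : set (measurableTypeR R)) <= 0)%E.
  by apply: (le_trans K); rewrite le_eqVlt; apply/orP; left; apply/eqP; exact: S0.
by rewrite lebesgue_measure_itv /= lte_fin m0 -EFinB subr0 lee_fin leNgt m0.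
Qed.

(** Young's inequality with weight alpha, 2 s g <= alpha s^2 + g^2 / alpha, whose last term is paid
    for by part of 2 g^2. *)
Lemma young_bound (R : realFieldType) (alpha eT e0 g s : R) : 0 < alpha ->
  eT + 2 * g ^+ 2 <= e0 + 2 * (s * g) ->
  eT + (2 - alpha^-1) * g ^+ 2 <= e0 + alpha * s ^+ 2.
Proof.
move=> a0 h; have y := young s g a0.
have -> : (2 - alpha^-1) * g ^+ 2 = 2 * g ^+ 2 - alpha^-1 * g ^+ 2 by ring.
by move: (alpha * s ^+ 2) (alpha^-1 * g ^+ 2) (s * g) (g ^+ 2) h y => a b c d; lra.
Qed.

(** The obstacle residual may have infinite norm; the majorant is then infinite and the estimate is
    trivial. *)
Lemma majorant_pinfty (R : realType) (alpha C : R) (x a : \bar R) : 0 < alpha -> 0 < C ->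
  (0 <= x -> 0 <= a -> x ^+ 2 + alpha%:E * (a + C%:E * +oo) ^+ 2 = +oo)%E.
Proof.
move=> al0 C0 x0 a0; have no (y : \bar R) : (0 <= y)%E -> y != -oo%E by case: y.
rewrite gt0_muley ?lte_fin// addey ?no//.
have -> : (+oo ^+ 2 = +oo :> \bar R)%E by rewrite expe2 mulyy.
by rewrite gt0_muley ?lte_fin// addey// no// expe_ge0.
Qed.

Lemma majorant_eq0 (R : realType) (alpha C : R) (x a b : \bar R) : 0 < alpha -> 0 < C ->
  (0 <= x -> 0 <= a -> 0 <= b ->
  x ^+ 2 + alpha%:E * (a + C%:E * b) ^+ 2 = 0 -> [/\ x = 0, a = 0 & b = 0])%E.
Proof.
move=> al0 C0 x0 a0 b0 /eqP.
have s0 : (0 <= a + C%:E * b)%E by rewrite adde_ge0// mule_ge0// lee_fin ltW.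
rewrite padde_eq0; last 2 first.
- by rewrite expe_ge0.
- by rewrite mule_ge0 ?expe_ge0// lee_fin ltW.
have sq0 (y : \bar R) : (y ^+ 2)%E == 0%E -> y = 0%E.
  by rewrite expe2 mule_eq0 orbb => /eqP.
have m0 (k : R) (y : \bar R) : 0 < k -> (k%:E * y)%E == 0%E -> y = 0%E.
  by move=> k0; rewrite mule_eq0 eqe gt_eqF// => /eqP.
move=> /andP[/sq0 -> /(m0 _ _ al0)/eqP/sq0/eqP].
rewrite padde_eq0//; last by rewrite mule_ge0// lee_fin ltW.
by move=> /andP[/eqP -> /(m0 _ _ C0) ->].
Qed.

Theorem theorem2p1 (R : realType) (n : nat) (Om : set 'rV[R]_n) (T : R)
    (phi u0 : 'rV[R]_n -> R) (f : spacetime R n -> R) (C_F alpha : R)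
    (u v e : spacetime R n -> R) (tau : spacetime R n -> 'rV[R]_n)
    (n_gt0 : (0 < n)%N) (Om_open : open Om) (Om_connected : connected Om)
    (Om_bounded : bounded_set Om) (Om_lipschitz : lipschitz_boundary Om)
    (T_gt0 : 0 < T)
    (phi_H2 : H2 Om phi) (phi_bd : ae_nonpos_on_boundary Om phi)
    (f_L2 : in_L2 (leb_st R n) (QT Om T) f)
    (u0_H10 : H10 Om u0)
    (u0_phi : {ae leb R n, forall x, Om x -> phi x <= u0 x})
    (C_F_friedrichs : friedrichs_constant Om C_F)
    (u_sol : obstacle_solution Om T phi f u0 u)
    (alpha_ge : 2^-1 <= alpha)
    (v_adm : admissible Om T phi v)
    (v_dt : exists g, is_dt_fun Om T v g)
    (tau_Hdiv : Hdiv Om T tau)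
    (e_def : time_continuous_version Om T (v \- u) e) :
  let rhs : \bar R :=
    (L2norm (leb R n) Om (slice e 0%R) ^+ 2 +
     alpha%:E *
       (L2normv (leb_st R n) (QT Om T) (tau \- gradx Om T v)%R +
        C_F%:E * L2norm (leb_st R n) (QT Om T)
                   (obstacle_residual Om T phi f v tau)) ^+ 2)%E in
  (L2norm (leb R n) Om (slice e T) ^+ 2 +
   (2 - alpha^-1)%R%:E *
     L2normv (leb_st R n) (QT Om T) (gradx Om T (v \- u)%R) ^+ 2 <= rhs)%E
  /\
  (rhs = 0%E <->
     {ae leb_st R n, forall p, QT Om T p -> v p = u p} /\
     {ae leb_st R n, forall p, QT Om T p -> tau p = gradx Om T u p}).
Proof.
move=> rhs.
have a0 : 0 < alpha by apply: lt_le_trans alpha_ge; rewrite invr_gt0.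
have [C0 _] := C_F_friedrichs.
have mOm : measurable Om by exact: open_rV_measurable.
have mQ : measurable (QT Om T) by exact: measurable_QT.
have hphi : H1 Om phi by case: phi_H2.
have [hv1 _ _] := v_adm; have [hu VI _] := u_sol; have [hu1 _ _] := hu.
have hD := L2H10B Om_open Om_bounded hv1 hu1; have [gl _] := L2H10_gradx hD.
have [gvl _] := L2H10_gradx hv1; have [tl _] := tau_Hdiv.
have tvl : in_L2v (leb_st R n) (QT Om T) (tau \- gradx Om T v) by exact: (in_L2vB mQ tl gvl).
have [eL2 _ _] := e_def.
have e0l : in_L2 (leb R n) Om (slice e 0) by apply: eL2; rewrite lexx ltW.
have eTl : in_L2 (leb R n) Om (slice e T) by apply: eL2; rewrite lexx ltW.
have mF := measurable_obstacle_residual Om_open (H1_L2 hphi) f_L2 hv1 v_dt tau_Hdiv.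
set F := obstacle_residual Om T phi f v tau in rhs mF *.
have pre (Fl : in_L2 (leb_st R n) (QT Om T) F) := pre_young Om_open Om_bounded T_gt0 f_L2 hu v_adm
  (VI _ v_adm) v_dt tau_Hdiv e_def C_F_friedrichs Fl.
have n0 := L2norm_ge0 (leb_st R n) (QT Om T) F.
have n1 : (0 <= L2normv (leb_st R n) (QT Om T) (tau \- gradx Om T v)%R)%E by exact: L2norm_ge0.
split.
  have [Foo|Foo] := eqVneq (L2norm (leb_st R n) (QT Om T) F) +oo%E.
    have -> : rhs = +oo%E; last exact: leey.
    by rewrite /rhs Foo majorant_pinfty// L2norm_ge0.
  have Fl : in_L2 (leb_st R n) (QT Om T) F by split => //; rewrite ltey.
  have K := pre Fl; rewrite -/F in K.
  rewrite /rhs (L2norm_sq_ip mOm e0l) (L2norm_sq_ip mOm eTl) (L2normv_sq_ipv mQ gl).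
  rewrite (L2normv_ipv mQ tvl) (L2norm_ip mQ Fl) -!EFinM -!EFinD lee_fin.
  rewrite -(sqr_sqrtr (ipv_ge0 (leb_st R n) (QT Om T) (gradx Om T (v \- u)))).
  apply: young_bound => //; rewrite sqr_sqrtr ?ipv_ge0//.
split.
  move=> /(majorant_eq0 a0 C0 (L2norm_ge0 _ _ _) n1 n0)[E0 Et EF].
  have Fl : in_L2 (leb_st R n) (QT Om T) F by split => //; rewrite EF ltry.
  have vu : {ae leb_st R n, forall p, QT Om T p -> v p = u p}.
    have := pre Fl; rewrite -/F.
    have -> : ip (leb R n) Om (slice e 0) (slice e 0) = 0.
      by apply: EFin_inj; rewrite -L2norm_sq_ip// E0 expe2 mule0.
    have -> : ipv (leb_st R n) (QT Om T) (tau \- gradx Om T v) (tau \- gradx Om T v) = 0.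
      by apply: EFin_inj; rewrite -L2normv_sq_ipv// Et expe2 mule0.
    have -> : ip (leb_st R n) (QT Om T) F F = 0.
      by apply: EFin_inj; rewrite -L2norm_sq_ip// EF expe2 mule0.
    rewrite sqrtr0 mulr0 addr0 mul0r mulr0 addr0 => K.
    have g0 : ipv (leb_st R n) (QT Om T) (gradx Om T (v \- u)) (gradx Om T (v \- u)) = 0.
      apply/eqP; rewrite eq_le ipv_ge0 andbT.
      have := ip_ge0 (leb R n) Om (slice e T); move: K.
      by move: (ip _ _ _ _) (ipv _ _ _ _) => x y; lra.
    have := friedrichs_QT Om_open Om_bounded C_F_friedrichs hD; rewrite g0 mulr0 => d0.
    have : ip (leb_st R n) (QT Om T) (v \- u) (v \- u) = 0 by apply/eqP; rewrite eq_le d0 ip_ge0.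
    move=> /(ip_eq0 mQ (L2H10_L2 hD)); apply: filterS => p /= H Qp.
    by apply/eqP; rewrite -subr_eq0 H.
  split => //; have : ipv (leb_st R n) (QT Om T) (tau \- gradx Om T v) (tau \- gradx Om T v) = 0.
    by apply: EFin_inj; rewrite -L2normv_sq_ipv// Et expe2 mule0.
  (* The vanishing norm gives tau = grad v, and grad v is grad u because v = u almost everywhere. *)
  move=> /(ipv_eq0 mQ tvl); rewrite -(gradx_ae vu); apply: filterS => p H Qp.
  by apply/eqP; rewrite -subr_eq0; apply/eqP; exact: (H Qp).
move=> [vu tu].
have F0 := obstacle_residual_eq0 Om_open Om_bounded T_gt0 hphi phi_bd f_L2 (conj u0_H10 u0_phi)
  u_sol hv1 v_dt tau_Hdiv vu tu.
(* v = u determines [e] at almost every time only; continuity of the energy, applied to a null set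
   that contains no interval, reaches the time 0. *)
have e00 : ip (leb R n) Om (slice e 0) (slice e 0) = 0.
  have cN := continuous_energy Om_open T_gt0 e_def.
  have := ae_eq0_right_limit T_gt0 cN; rewrite /energy /clamped clamp_id ?lexx ?ltW//; apply.
  case: e_def => _ _ ew; apply: filterS2 ew (ae_sliceX vu) => t ewt vut It.
  rewrite -(Rint0 (leb R n) mOm) ipE; apply: ae_eq_Rintegral.
  apply: filterS2 (ewt It) (vut It) => x K1 K2 Ox.
  rewrite /clamped clamp_id; last by move: It; rewrite /= in_itv /= => /andP[/ltW -> /ltW ->].
  by rewrite /slice K1//= K2// subrr mulr0.
rewrite /rhs (L2norm_sq_ip mOm e0l) e00 (L2norm0 mQ F0) mule0 adde0 add0e.
rewrite (L2normv_ipv mQ tvl).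
have -> : ipv (leb_st R n) (QT Om T) (tau \- gradx Om T v) (tau \- gradx Om T v) = 0.
  rewrite ipvE -(Rint0 (leb_st R n) mQ); apply: ae_eq_Rintegral.
  apply: filterS tu => p K Qp; rewrite /= K// (gradx_ae vu) subrr /dotv.
  by rewrite big1// => i _; rewrite mxE mul0r.
by rewrite sqrtr0 expe2 mule0 mule0.
Qed.
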